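(* Let $X$ be a real separable Hilbert space, let $\mu=\mathcal N(0,Q_\mu)$, $\nu=\mathcal N(0,Q_\nu)$ be centered Gaussian measures on $X$ with Cameron–Martin spaces $H_\mu,H_\nu$, and let $T\in\mathscr L(H_\mu,H_\nu)$ be a contraction, i.e. $\|T\|_{\mathscr L(H_\mu,H_\nu)}\le1$. Then $T$ is a strict contraction (that is, $\|T\|_{\mathscr L(H_\mu,H_\nu)}<1$) of Hilbert–Schmidt type if and only if $\Gamma_{\nu,\mu}(T)$ is of Hilbert–Schmidt type from $L^2(X,\mu)$ into $L^2(X,\nu)$, and in this case $$\|\Gamma_{\nu,\mu}(T)\|_{\mathscr L_2(L^2(X,\mu),L^2(X,\nu))}=\prod_{k=1}^\infty\frac1{1-t_k^2},$$ where $\{t_k\}_{k\in\mathbb N}$ are the eigenvalues of $T^\star T$.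
   Context: For $\gamma=\mathcal N(0,Q_\gamma)$, the Cameron–Martin space is $H_\gamma=Q_\gamma^{1/2}(X)$ with $\langle h,k\rangle_{H_\gamma}=\langle Q_\gamma^{-1/2}h,Q_\gamma^{-1/2}k\rangle_X$, where $Q_\gamma^{-1/2}h$ is the unique $z\in(\ker Q_\gamma^{1/2})^\perp$ with $Q_\gamma^{1/2}z=h$. For $T\in\mathscr L(H_\mu,H_\nu)$ let $(f_k)$ be an orthonormal basis (finite or countable) of $(\ker Q_\mu)^\perp$ consisting of eigenvectors of $Q_\mu$ and let $\pi_m$ be the orthogonal projection of $X$ onto $\mathrm{span}\{f_1,\dots,f_m\}\subseteq H_\mu$. $T_\infty^{\nu,\mu}$ is the limit (it exists) of $T\pi_m$ in $L^2(X,\mu;X)$, for which a linear measurable version is fixed; $T_\infty^\mu:=T_\infty^{\mu,\mu}$ when $\nu=\mu$. For $\|T\|_{\mathscr L(H_\mu,H_\nu)}\le1$ and $f:X\to\mathbb R$ measurable with $|f(x)|\le Me^{c\|x\|_X}$ for some $M,c>0$, $$(\Gamma_{\nu,\mu}(T)f)(x)=\int_Xf\big[(T^\star)_\infty^{\mu,\nu}x+((I-T^\star T)^{1/2})_\infty^\mu y\big]\mu(dy),$$ where $T^\star\in\mathscr L(H_\nu,H_\mu)$ is the adjoint of $T$. For every $p\in[1,\infty)$ it extends by density to a bounded operator $L^p(X,\mu)\to L^p(X,\nu)$ of norm $1$, denoted in the same way. $\|\cdot\|_{\mathscr L_2(E,F)}$ is the Hilbert–Schmidt norm, $\|S\|_{\mathscr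 L_2(E,F)}=\big(\sum_k\|Se_k\|_F^2\big)^{1/2}$ for any Hilbert basis $\{e_k\}$ of $E$.
   Formalization: The printed norm formula is false (X=ℝ, μ=ν=N(0,1), T=s with s²=1/2: norm √2, product 4/3); the theorem proves that the squared Hilbert–Schmidt norm of Γ(T) equals ∏ 1/(1−t_k), with t_k the eigenvalues of T*T listed with multiplicity. *)

(* Defs.v *)
From HB Require Import structures.
From mathcomp Require Import all_boot all_order all_algebra.
From mathcomp Require Import all_classical all_reals all_analysis.
From mathcomp Require Import sesquilinear.

Set Implicit Arguments.
Unset Strict Implicit.
Unset Printing Implicit Defensive.
Import Order.TTheory GRing.Theory Num.Theory.
Import numFieldNormedType.Exports.

Local Open Scope classical_set_scope.
Local Open Scope ring_scope.

(* A space with an inner product is presented as a left module [V] together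
   with a form [ip : V -> V -> R]. For L^2 the elements of the module are the
   square integrable functions themselves, so [ip] is only semidefinite there
   and equality in L^2 is equality almost everywhere. *)
Section inner_product.
Context {R : realType}.

Section one_space.
Context {V : lmodType R}.
Implicit Types (ip : V -> V -> R) (D : set nat) (e : nat -> V).

Definition ip_norm ip (x : V) : R := Num.sqrt (ip x x).

Definition orthonormal_on ip D e :=
  forall j k, D j -> D k -> ip (e j) (e k) = (j == k)%:R.

(* Finite or countable orthonormal bases of the subspace [E]: the index set [D]
   is an arbitrary subset of nat and [e] is irrelevant outside [D]. *)
Definition hilbert_basis_of ip (E : set V) D e :=
  [/\ orthonormal_on ip D e,
      forall k, D k -> E (e k) &
      forall x, E x -> forall eps : R, 0 < eps ->
        exists n (c : nat -> R),
          ip_norm ip (x - \sum_(k < n | `[< D k >]) c k *: e k) < eps].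

Definition hilbert_basis ip D e := hilbert_basis_of ip setT D e.

Definition symmetric_op ip (F : V -> V) := forall x y, ip (F x) y = ip x (F y).

Definition nonneg_op ip (F : V -> V) := forall x, 0 <= ip (F x) x.

Definition is_sqrt_op ip (F S : V -> V) :=
  [/\ symmetric_op ip S, nonneg_op ip S & forall x, S (S x) = F x].

(* [t] lists the eigenvalues of [F], repeated according to multiplicity. For
   F = T^* T these are the squares of the singular values s_k of [T], and the
   squared Hilbert-Schmidt norm of Gamma(T) is the product of the 1/(1 - t_k),
   i.e. of the 1/(1 - s_k^2): when X = R, mu = nu = N(0,1) and T = s, the
   Hermite polynomials diagonalize Gamma(T) with eigenvalues s^n, so that the
   squared norm is the sum of the s^(2n). *)
Definition eigen_enumeration ip (F : V -> V) D e (t : nat -> R) :=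
  hilbert_basis ip D e /\ forall k, D k -> F (e k) = t k *: e k.

End one_space.

Section two_spaces.
Context {V W : lmodType R}.
Implicit Types (ipV : V -> V -> R) (ipW : W -> W -> R) (F : V -> W).

Definition opnorm ipV ipW F : \bar R :=
  ereal_sup [set (ip_norm ipW (F x))%:E | x in [set x | ip_norm ipV x <= 1]].

Definition is_adjoint ipV ipW F (G : W -> V) :=
  forall x y, ipV (G y) x = ipW y (F x).

Definition hs_norm ipW F (D : set nat) (e : nat -> V) : \bar R :=
  ((\esum_(k in D) ((ip_norm ipW (F (e k))) ^+ 2)%:E) `^ 2^-1)%E.

Definition hilbert_schmidt ipV ipW F :=
  exists D e, hilbert_basis ipV D e /\ (hs_norm ipW F D e < +oo)%E.

End two_spaces.
End inner_product.

Section cameron_martin.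
Context {R : realType} {X : completeNormedModType R}.

Definition cm_pred (S : {linear X -> X}) : {pred X} := fun x => x \in range S.

Lemma cm_submod_closed S : submod_closed (cm_pred S).
Proof.
split=> [|a x y]; first by apply/mem_set; exists 0; rewrite ?linear0.
move=> /set_mem[u _ <-] /set_mem[v _ <-]; apply/mem_set.
by exists (a *: u + v); rewrite ?linearP.
Qed.

HB.instance Definition _ S :=
  GRing.isSubmodClosed.Build R X (cm_pred S) (cm_submod_closed S).

(* The range of [S]; it is the Cameron-Martin space of N(0,Q) for [S] the
   nonnegative square root of [Q]. *)
Record cm_space (S : {linear X -> X}) :=
  CMSpace { cm_val : X; _ : cm_val \in cm_pred S }.

HB.instance Definition _ S := [isSub for @cm_val S].
HB.instance Definition _ S := [Choice of cm_space S by <:].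
HB.instance Definition _ S := [SubChoice_isSubLmodule of cm_space S by <:].

Variable ip : X -> X -> R.

Definition orthocomp (E : set X) : set X := [set z | forall w, E w -> ip z w = 0].

Definition ker (F : X -> X) : set X := F @^-1` [set 0].

Definition pinv (S : X -> X) (h : X) : X :=
  xget 0 [set z | orthocomp (ker S) z /\ S z = h].

Definition cm_ip (S : {linear X -> X}) (h k : cm_space S) : R :=
  ip (pinv S (cm_val h)) (pinv S (cm_val k)).

End cameron_martin.

Arguments cm_ip {R X} ip S h k.

Section gaussian.
Context {R : realType} {X : completeNormedModType R}.

Definition borel_type := g_sigma_algebraType (@open X).

Variable ip : X -> X -> R.

Definition separable := exists A : set X, countable A /\ dense A.

Definition covariance_op (Q : X -> X) :=
  [/\ continuous Q, symmetric_op ip Q, nonneg_op ip Q &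
      exists D e, hilbert_basis ip D e /\
        (\esum_(k in D) (ip (Q (e k)) (e k))%:E < +oo)%E].

(* [normal_prob] is not a Dirac mass when its standard deviation is 0. *)
Definition centered_normal (v : R) : set (measurableTypeR R) -> \bar R :=
  if v == 0 then \d_(0 : measurableTypeR R) else normal_prob 0 (Num.sqrt v).

Definition gaussian (mu : probability borel_type R) (Q : X -> X) :=
  covariance_op Q /\
  forall (h : X) (B : set (measurableTypeR R)), measurable B ->
    mu [set x : borel_type | B (ip h x)] = centered_normal (ip (Q h) h) B.

(* The function [A] is a version of the limit in L^2(X,mu;X) of T pi_m, for
   mu = N(0,Q) and S the square root of Q. An everywhere linear Borel map would
   be continuous, so [A] is Borel on X and linear on a Borel subspace of full
   measure. *)
Definition is_linear_version (mu : probability borel_type R) (A : X -> X) :=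
  measurable_fun setT (A : borel_type -> borel_type) /\
  exists L : set borel_type,
    [/\ measurable L, mu L = 1%E, L 0 &
        forall (a : R) (x y : X), L x -> L y ->
          L (a *: x + y) /\ A (a *: x + y) = a *: A x + A y].

Definition is_measurable_extension (mu : probability borel_type R)
    (Q S : {linear X -> X}) (S' : {linear X -> X})
    (T : cm_space S -> cm_space S') (A : X -> X) :=
  is_linear_version mu A /\
  exists (D : set nat) (f : nat -> cm_space S) (l : nat -> R),
    [/\ hilbert_basis_of ip (orthocomp ip (ker Q)) D (fun k => cm_val (f k)),
        forall k, D k -> Q (cm_val (f k)) = l k *: cm_val (f k) &
        (fun m => (\int[mu]_x
           (`|(\sum_(k < m | `[< D k >]) ip x (cm_val (f k)) *: cm_val (T (f k))) - A x|
              ^+ 2)%:E)%E) @ \oo --> 0%E].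

End gaussian.

Arguments borel_type {R} X.
Arguments separable {R} X.

Section gamma.
Context {R : realType} {X : completeNormedModType R}.

Definition L2 (mu : probability (borel_type X) R) := LfunType mu (lee1n 2).

Definition L2_ip (mu : probability (borel_type X) R) (f g : L2 mu) : R :=
  \int[mu]_x (f x * g x).

Definition exp_growth (f : X -> R) :=
  exists M c : R, [/\ 0 < M, 0 < c & forall x, `|f x| <= M * expR (c * `|x|)].

(* [G] is the bounded operator from L^2(mu) to L^2(nu) extending
   f |-> (x |-> \int f (A x + B y) mu(dy)), in terms of representatives. *)
Definition is_Gamma (mu nu : probability (borel_type X) R) (A B : X -> X)
    (G : L2 mu -> L2 nu) :=
  [/\ forall (a : R) (f g : L2 mu),
        {ae nu, forall x, G (a *: f + g) x = a * G f x + G g x},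
      (opnorm (L2_ip (mu := mu)) (L2_ip (mu := nu)) G < +oo)%E &
      forall f : L2 mu, exp_growth f ->
        {ae nu, forall x : borel_type X,
          G f x = \int[mu]_y f (A x + B y)}].

End gamma.

Arguments L2_ip {R X} mu f g.

(* Main.v *)
(* Finite combinations of the exponentials eps_u(x) = e^(<u,x> - <Qmu u,u>/2) are
   dense in L^2(mu), with <eps_u, eps_v> = e^<h_u, h_v> for h_u = Qmu u in H_mu,
   and Gamma(T) maps them to a family with Gram matrix e^<T h_u, T h_v>. So the
   squared Hilbert-Schmidt norm of Gamma(T) is the trace of the form e^<Th, Tk>
   relative to the kernel e^<h, k>, computed on the Gram-Schmidt family b_k of
   the exponentials. If e_k diagonalizes T^* T with eigenvalues t_k, expanding
   the form e^<Th, Tk> in monomials in the coordinates on the e_k splits it into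
   rank one forms of norm prod_k t_k^(a_k), and the trace is the product of the
   geometric series 1/(1 - t_k). Conversely the form dominates its linear part
   <Th, Tk>, so a finite trace makes T Hilbert-Schmidt, hence T^* T
   diagonalizable, and finiteness of the product forces every t_k < 1. *)
Require Import Defs.
From HB Require Import structures.
From mathcomp Require Import all_boot all_order all_algebra.
From mathcomp Require Import all_classical all_reals all_analysis.
From mathcomp Require Import sesquilinear.
From mathcomp Require Import measurable_realfun.
From mathcomp Require Import ring lra.
Import Order.TTheory GRing.Theory Num.Theory.
Import numFieldNormedType.Exports.
Local Open Scope classical_set_scope.
Local Open Scope ring_scope.
Set Implicit Arguments.
Unset Strict Implicit.
Unset Printing Implicit Defensive.

(** * Semi-inner products and orthonormal families *)

(** Neither Wiener chaos nor Hermite polynomials enter: every trace is reduced to squared dual norms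
    of functionals on finite combinations of exponentials. The functional given by the monomial x^a
    / sqrt(a!) has dual norm at most 1 because it is one term in the expansion of the exponential
    kernel, and at least 1 because suitable finite differences of exponentials concentrate on it;
    orthogonality between monomials is never computed. Gram-Schmidt is run on formal combinations,
    so that the same coefficients serve for the kernel, for L^2 and for the image form. In the
    converse no eigenvalue is available at first: the linear part of the form is tested with [Ts] on
    a basis of H_nu, and only afterwards is T^* T diagonalized, by iterating it once it is scaled to
    norm one. Eigenvalues below 1 alone do not make [T] a strict contraction; their summability
    keeps them away from 1. Totality of the exponentials is proved without Fourier uniqueness: a
    closure under dominated limits is shown to contain the indicators of Borel sets. *)

Lemma cvg_bigsum {R : realType} {I T : Type} (r : seq I) (P : pred I) (F : set_system T)
    {FF : Filter F} (f : I -> T -> R) (l : I -> R) :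
  (forall i, P i -> f i x @[x --> F] --> l i) ->
  \sum_(i <- r | P i) f i x @[x --> F] --> \sum_(i <- r | P i) l i.
Proof.
move=> fl; elim: r => [|i r IH].
  by rewrite big_nil; under eq_fun do rewrite big_nil; exact: cvg_cst.
rewrite big_cons; under eq_fun do rewrite big_cons.
by case: ifPn => // Pi; apply: cvgD => //; exact: fl.
Qed.

Lemma cvg_exprn {R : realType} {T : Type} (F : set_system T) {FF : Filter F}
    (f : T -> R) (l : R) n :
  f x @[x --> F] --> l -> f x ^+ n @[x --> F] --> l ^+ n.
Proof.
move=> fl; elim: n => [|n IH]; first by under eq_fun do rewrite expr0; exact: cvg_cst.
by rewrite exprS; under eq_fun do rewrite exprS; exact: cvgM.
Qed.

(** Definiteness is left out on purpose: the L^2 forms vanish on functions that are null almost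
    everywhere, and the kernel forms may vanish on nonzero formal combinations. *)
Record semi_inner {R : realType} {V : lmodType R} (ip : V -> V -> R) : Prop := {
  sipC : forall x y, ip x y = ip y x;
  sipDZ : forall a x y z, ip (a *: x + y) z = a * ip x z + ip y z;
  sip_ge0 : forall x, 0 <= ip x x }.

Section semi_inner.
Context {R : realType} {V : lmodType R} {ip : V -> V -> R}.
Hypothesis sip : semi_inner ip.

Lemma sip0l x : ip 0 x = 0.
Proof. by have := sipDZ sip (-1) x x x; rewrite scaleN1r addNr => ->; ring. Qed.
Lemma sipDl x y z : ip (x + y) z = ip x z + ip y z.
Proof. by have := sipDZ sip 1 x y z; rewrite scale1r mul1r. Qed.
Lemma sipZl a x z : ip (a *: x) z = a * ip x z.
Proof. by have := sipDZ sip a x 0 z; rewrite addr0 sip0l addr0. Qed.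
Lemma sipNl x z : ip (- x) z = - ip x z.
Proof. by rewrite -scaleN1r sipZl mulN1r. Qed.
Lemma sipBl x y z : ip (x - y) z = ip x z - ip y z.
Proof. by rewrite sipDl sipNl. Qed.
Lemma sip0r x : ip x 0 = 0. Proof. by rewrite (sipC sip) sip0l. Qed.
Lemma sipDr x y z : ip x (y + z) = ip x y + ip x z.
Proof. by rewrite !(sipC sip x) sipDl. Qed.
Lemma sipZr a x z : ip x (a *: z) = a * ip x z.
Proof. by rewrite !(sipC sip x) sipZl. Qed.
Lemma sipNr x z : ip x (- z) = - ip x z.
Proof. by rewrite !(sipC sip x) sipNl. Qed.
Lemma sipBr x y z : ip x (y - z) = ip x y - ip x z.
Proof. by rewrite !(sipC sip x) sipBl. Qed.
Lemma sip_suml I (r : seq I) (P : pred I) (F : I -> V) z :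
  ip (\sum_(i <- r | P i) F i) z = \sum_(i <- r | P i) ip (F i) z.
Proof.
by elim/big_rec2: _ => [|i y1 y2 _ <-]; [exact: sip0l|exact: sipDl].
Qed.
Lemma sip_sumr I (r : seq I) (P : pred I) (F : I -> V) z :
  ip z (\sum_(i <- r | P i) F i) = \sum_(i <- r | P i) ip z (F i).
Proof. by rewrite (sipC sip) sip_suml; apply: eq_bigr => i _; exact: sipC. Qed.

Lemma sip_sqD x y : ip (x + y) (x + y) = ip x x + 2 * ip x y + ip y y.
Proof. by rewrite sipDl !sipDr (sipC sip y x); ring. Qed.
Lemma sip_sqB x y : ip (x - y) (x - y) = ip x x - 2 * ip x y + ip y y.
Proof. by rewrite sip_sqD sipNr sipNl sipNr; ring. Qed.
Lemma sip_sqZ a x : ip (a *: x) (a *: x) = a ^+ 2 * ip x x.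
Proof. by rewrite sipZl sipZr; ring. Qed.
Lemma sip_sqBC x y : ip (x - y) (x - y) = ip (y - x) (y - x).
Proof. by rewrite !sip_sqB (sipC sip y x); ring. Qed.

Lemma sip_CS x y : ip x y ^+ 2 <= ip x x * ip y y.
Proof.
have H t : 0 <= ip x x - 2 * t * ip x y + t ^+ 2 * ip y y.
  have := sip_ge0 sip (x - t *: y).
  by rewrite sip_sqB sip_sqZ sipZr mulrA.
have := sip_ge0 sip y; rewrite le_eqVlt => /predU1P[y0|y0]; last first.
  have := H (ip x y / ip y y); set a := ip x y; set b := ip y y in y0 *.
  set c := ip x x.
  have -> : c - 2 * (a / b) * a + (a / b) ^+ 2 * b = c - a ^+ 2 / b.
    by field; rewrite gt_eqF.
  by rewrite subr_ge0 ler_pdivrMr.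
rewrite -y0 mulr0; have [->|xy0] := eqVneq (ip x y) 0; first by rewrite expr0n.
(* When [ip y y = 0] the quadratic in [t] is affine; this [t] gives it the value -1. *)
have := H ((ip x x + 1) / (2 * ip x y)); rewrite -y0 mulr0 addr0.
have -> : ip x x - 2 * ((ip x x + 1) / (2 * ip x y)) * ip x y = -1 by field.
by rewrite lerNr oppr0 ler10.
Qed.

Lemma sip_null x y : ip x x = 0 -> ip x y = 0.
Proof.
move=> x0; apply/eqP; rewrite -sqrf_eq0 eq_le sqr_ge0 andbT.
by rewrite (le_trans (sip_CS x y))// x0 mul0r.
Qed.

Lemma sip_nullD x y : ip y y = 0 -> ip (x + y) (x + y) = ip x x.
Proof. by move=> y0; rewrite sip_sqD (sipC sip x) (sip_null _ y0) y0; ring. Qed.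

Lemma sip_leD x y : ip (x + y) (x + y) <= 2 * ip x x + 2 * ip y y.
Proof. by have := sip_ge0 sip (x - y); rewrite sip_sqB sip_sqD; lra. Qed.

Lemma ip_norm_sqr x : ip_norm ip x ^+ 2 = ip x x.
Proof. by rewrite sqr_sqrtr// sip_ge0. Qed.

Lemma sip_cvg (u : nat -> V) x : (fun n => ip (u n - x) (u n - x)) @ \oo --> 0 ->
  forall z, ip (u n) z @[n --> \oo] --> ip x z.
Proof.
move=> ux z; suff H : (fun n => ip (u n - x) z) @ \oo --> (0 : R).
  rewrite -[ip x z]add0r; under eq_fun do rewrite -(subrK x (u _)) sipDl.
  by apply: cvgD => //; exact: cvg_cst.
apply/cvgr0Pnorm_lt => eps eps0.
have e20 : 0 < eps ^+ 2 / (ip z z + 1).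
  by rewrite divr_gt0 ?exprn_gt0// ltr_wpDl// sip_ge0.
move/cvgr0Pnorm_lt : ux => /(_ _ e20); apply: filterS => n.
rewrite ger0_norm ?sip_ge0// ltr_pdivlMr ?ltr_wpDl ?sip_ge0// => un.
rewrite -(ltr_pXn2r (n := 2))// ?nnegrE ?ltW// real_normK ?num_real//.
apply: le_lt_trans (sip_CS _ _) _; apply: le_lt_trans un.
by rewrite ler_wpM2l ?sip_ge0// lerDl.
Qed.

Lemma sip_cvg_sq (u : nat -> V) x : (fun n => ip (u n - x) (u n - x)) @ \oo --> 0 ->
  ip (u n) (u n) @[n --> \oo] --> ip x x.
Proof.
move=> ux.
have -> : (fun n => ip (u n) (u n)) =
    (fun n => ip (u n - x) (u n - x) + (2 * ip (u n) x - ip x x)).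
  by apply/funext => n; rewrite sip_sqB; ring.
rewrite -[ip x x in X in _ --> X]add0r; apply: cvgD => //.
rewrite [X in _ --> X](_ : _ = 2 * ip x x - ip x x); last by ring.
by apply: cvgB; [apply: cvgM; [exact: cvg_cst|exact: sip_cvg ux x]|exact: cvg_cst].
Qed.

End semi_inner.

Section orthonormal_families.
Context {R : realType} {V : lmodType R} {ip : V -> V -> R}.
Hypothesis sip : semi_inner ip.

(* Bases are extended by zero to all of nat: [E k = 0] for [k] outside [D]. *)
Definition zext (D : set nat) (e : nat -> V) (k : nat) : V :=
  if `[< D k >] then e k else 0.

Definition ortho_fam (D : set nat) (E : nat -> V) :=
  (forall j k, ip (E j) (E k) = ((j == k) && `[< D k >])%:R) /\
  (forall k, ~ D k -> E k = 0).

Lemma zext_ortho D e : orthonormal_on ip D e -> ortho_fam D (zext D e).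
Proof.
move=> oe; split=> [j k|k nDk]; last by rewrite /zext asboolF.
rewrite /zext; case: asboolP => Dj; case: asboolP => Dk; rewrite ?sip0l ?(sip0r sip)//.
- by rewrite oe// andbT.
- by rewrite andbF.
- by case: eqP Dj => // ->.
- by rewrite andbF.
Qed.

Variables (D : set nat) (E : nat -> V).
Hypothesis oE : ortho_fam D E.

Lemma ortho_sum (c : nat -> R) n k :
  ip (\sum_(i < n) c i *: E i) (E k) = if ((k < n)%N && `[< D k >]) then c k else 0.
Proof.
rewrite (sip_suml sip)//; under eq_bigr do rewrite (sipZl sip)// oE.1.
case: ifPn => [/andP[kn Dk]|].
  rewrite (bigD1 (Ordinal kn))//= eqxx Dk mulr1 big1 ?addr0// => i ik.
  by rewrite (_ : (i == k :> nat) = false) ?mulr0//; apply/negP => /eqP ik';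
     move/eqP: ik; apply; exact: val_inj.
rewrite negb_and => kn; rewrite big1// => i _; case: eqVneq => [ik|]; last first.
  by rewrite mulr0.
by case/orP: kn; [rewrite -ik ltn_ord|move/negbTE->; rewrite mulr0].
Qed.

Lemma ortho_comb (c : nat -> R) n : (forall k, ~ D k -> c k = 0) ->
  ip (\sum_(i < n) c i *: E i) (\sum_(i < n) c i *: E i) = \sum_(i < n) c i ^+ 2.
Proof.
move=> c0; rewrite (sip_sumr sip)//; apply: eq_bigr => i _.
rewrite (sipZr sip)// ortho_sum ltn_ord /=.
by case: asboolP => [_|/c0 ->]; rewrite ?expr2// mulr0 expr0n.
Qed.

Definition fproj n x := \sum_(i < n) ip x (E i) *: E i.

Lemma ip_E0 x k : ~ D k -> ip x (E k) = 0.
Proof. by move=> /oE.2 ->; rewrite sip0r. Qed.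

Lemma sq_proj n x : ip (fproj n x) (fproj n x) = \sum_(i < n) ip x (E i) ^+ 2.
Proof. by rewrite /fproj (ortho_comb n (c := fun k => ip x (E k)))// => k; exact: ip_E0. Qed.

Lemma ip_proj n x : ip x (fproj n x) = \sum_(i < n) ip x (E i) ^+ 2.
Proof.
by rewrite (sip_sumr sip)//; apply: eq_bigr => i _; rewrite (sipZr sip)// expr2.
Qed.

Lemma sq_Bproj n x :
  ip (x - fproj n x) (x - fproj n x) = ip x x - \sum_(i < n) ip x (E i) ^+ 2.
Proof. by rewrite (sip_sqB sip)// ip_proj sq_proj; ring. Qed.

Lemma bessel n x : \sum_(i < n) ip x (E i) ^+ 2 <= ip x x.
Proof. by rewrite -subr_ge0 -sq_Bproj sip_ge0. Qed.

(** The two sides differ by the sum of the squares of [c i - ip x (E i)]. *)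
Lemma best_approx n x (c : nat -> R) : (forall k, ~ D k -> c k = 0) ->
  ip x x - \sum_(i < n) ip x (E i) ^+ 2 <=
  ip (x - \sum_(i < n) c i *: E i) (x - \sum_(i < n) c i *: E i).
Proof.
move=> c0; rewrite (sip_sqB sip)// ortho_comb// (sip_sumr sip)// -subr_ge0 mulr_sumr.
under [X in _ - X + _]eq_bigr do rewrite (sipZr sip)//.
set a := ip x x.
rewrite [X in 0 <= X](_ : _ = \sum_(i < n) (c i - ip x (E i)) ^+ 2).
  by apply: sumr_ge0 => i _; exact: sqr_ge0.
transitivity ((\sum_(i < n) c i ^+ 2 + \sum_(i < n) ip x (E i) ^+ 2)
   - \sum_(i < n) 2 * (c i * ip x (E i))); last first.
  by rewrite -big_split -sumrB; apply: eq_bigr => i _ /=; ring.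
set s1 := \sum_(i < n) _; set s2 := \sum_(i < n) _; set s3 := \sum_(i < n) _.
by ring.
Qed.

(** Totality in a form from which [D] has disappeared: zero vectors outside [D] contribute nothing,
    so sums over a basis become plain series over nat. *)
Definition parseval_fam :=
  forall x, (fun n => \sum_(i < n) ip x (E i) ^+ 2) @ \oo --> ip x x.

Lemma approx_parseval :
  (forall x eps, 0 < eps -> exists n (c : nat -> R),
     (forall k, ~ D k -> c k = 0) /\
     ip (x - \sum_(i < n) c i *: E i) (x - \sum_(i < n) c i *: E i) < eps) ->
  parseval_fam.
Proof.
move=> H x; apply/cvgrPdist_lt => eps eps0.
have [n [c [c0 cn]]] := H x _ eps0.
exists n => // m /= nm; rewrite ger0_norm; last by rewrite subr_ge0 bessel.
apply: le_lt_trans cn; apply: le_trans (best_approx n x c0).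
rewrite lerD2l lerN2 -!(big_mkord xpredT (fun i => ip x (E i) ^+ 2)).
rewrite [leRHS](big_cat_nat (n := n))//= lerDl.
by apply: sumr_ge0 => i _; exact: sqr_ge0.
Qed.

Lemma parseval_proj x : parseval_fam ->
  (fun n => ip (fproj n x - x) (fproj n x - x)) @ \oo --> (0 : R).
Proof.
move=> pE; under eq_fun do rewrite (sip_sqBC sip)// sq_Bproj.
suff : (fun n => ip x x - \sum_(i < n) ip x (E i) ^+ 2) @ \oo --> ip x x - ip x x.
  by rewrite subrr.
by apply: cvgB; [exact: cvg_cst|exact: pE].
Qed.

Lemma parseval_ip x y : parseval_fam ->
  (fun n => \sum_(i < n) ip x (E i) * ip y (E i)) @ \oo --> ip x y.
Proof.
move=> pE; have := @sip_cvg _ _ _ sip _ _ (parseval_proj x pE) y.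
suff -> : (fun n => ip (fproj n x) y) =
  (fun n => \sum_(i < n) ip x (E i) * ip y (E i)) by [].
apply/funext => n; rewrite (sip_suml sip)//; apply: eq_bigr => i _.
by rewrite (sipZl sip)// (sipC sip y).
Qed.

Lemma parseval_ereal x : parseval_fam ->
  (\sum_(0 <= k <oo) (ip x (E k) ^+ 2)%:E)%E = (ip x x)%:E.
Proof.
move=> pE; apply/cvg_lim => //.
under eq_fun do rewrite big_mkord sumEFin.
by apply: cvg_EFin; [exact: nearW|exact: pE].
Qed.

End orthonormal_families.

Section hilbert_bases.
Context {R : realType} {V : lmodType R} {ip : V -> V -> R}.
Hypothesis sip : semi_inner ip.

Lemma sum_zext (D : set nat) (e : nat -> V) (c : nat -> R) n :
  \sum_(k < n | `[< D k >]) c k *: e k =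
  \sum_(k < n) (if `[< D k >] then c k else 0) *: zext D e k.
Proof.
by rewrite big_mkcond; apply: eq_bigr => i _; rewrite /zext; case: asboolP;
  rewrite ?scale0r.
Qed.

Lemma hilbert_basis_parseval D e : hilbert_basis ip D e ->
  ortho_fam (ip := ip) D (zext D e) /\ parseval_fam (ip := ip) (zext D e).
Proof.
move=> [oe _ H]; have oE := zext_ortho sip oe; split=> //.
apply: (approx_parseval sip oE) => x eps eps0.
have [|n [c Hc]] := H x I (Num.sqrt eps); first by rewrite sqrtr_gt0.
exists n, (fun k => if `[< D k >] then c k else 0); split=> [k nDk|].
  by rewrite asboolF.
rewrite -sum_zext; move: Hc; rewrite /ip_norm ltr_sqrt//.
Qed.

Lemma parseval_hilbert_basis D e : orthonormal_on ip D e ->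
  parseval_fam (ip := ip) (zext D e) -> hilbert_basis ip D e.
Proof.
move=> oe pE; have oE := zext_ortho sip oe; split=> // x _ eps eps0.
have e20 : 0 < eps ^+ 2 by rewrite exprn_gt0.
have /cvgr0Pnorm_lt/(_ _ e20)[n _ /(_ n (leqnn n))] :=
  parseval_proj sip oE x pE.
rewrite ger0_norm ?sip_ge0// (sip_sqBC sip)// => Hn.
exists n, (fun k => ip x (zext D e k)).
rewrite (sum_zext D e (fun k => ip x (zext D e k))) (eq_bigr (fun k : 'I_n => ip x (zext D e k) *: zext D e k)).
  by rewrite -(ltr_pXn2r (n := 2)) ?nnegrE ?sqrtr_ge0 ?ltW// ip_norm_sqr.
by move=> i _; case: (asboolP (D i)) => // nD; rewrite (oE.2 _ nD) !scaler0.
Qed.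

Lemma esum_zext (D : set nat) (e : nat -> V) (f : V -> R) : f 0 = 0 -> (forall v, 0 <= f v) ->
  (\esum_(k in D) (f (e k))%:E = \sum_(0 <= k <oo) (f (zext D e k))%:E)%E.
Proof.
move=> f0 fge0; rewrite nneseries_esumT//; last by move=> n; rewrite lee_fin.
rewrite esum_mkcond; apply: eq_esum => k _; rewrite /zext.
case: asboolP => Dk; first by rewrite ifT// inE.
by rewrite ifF ?f0//; apply/negP; rewrite inE.
Qed.

End hilbert_bases.

(** * Gram-Schmidt in a semidefinite space *)

Section gram_schmidt.
Context {R : realType} {V : lmodType R} {ip : V -> V -> R}.
Hypothesis sip : semi_inner ip.
Variable v : nat -> V.

Definition gs_res (s : seq V) x := x - \sum_(w <- s) ip x w *: w.

(* On a null residual the inverse of 0 is 0, so the vector produced is 0. *)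
Definition gs_next (s : seq V) x :=
  (Num.sqrt (ip (gs_res s x) (gs_res s x)))^-1 *: gs_res s x.

(** The whole list of earlier outputs is carried along, since each step projects on all of them and
    structural recursion sees only the previous one. *)
Fixpoint gs_seq n : seq V :=
  if n is m.+1 then rcons (gs_seq m) (gs_next (gs_seq m) (v m)) else [::].

Definition gs k := gs_next (gs_seq k) (v k).

Definition gs_rem k := v k - \sum_(i < k) ip (v k) (gs i) *: gs i.

Definition gs_dom : set nat := [set k | ip (gs_rem k) (gs_rem k) != 0].

Lemma gs_seqE n : gs_seq n = mkseq gs n.
Proof. by elim: n => //= n IH; rewrite /gs {1}IH /mkseq -addn1 iotaD map_cat cats1. Qed.

Lemma gs_resE k : gs_res (gs_seq k) (v k) = gs_rem k.
Proof.
rewrite /gs_res gs_seqE /mkseq big_map -[X in iota _ X]subn0.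
by rewrite -[iota _ _]/(index_iota 0 k) big_mkord.
Qed.

Lemma gsE k : gs k = (Num.sqrt (ip (gs_rem k) (gs_rem k)))^-1 *: gs_rem k.
Proof. by rewrite /gs /gs_next gs_resE. Qed.

Lemma gs0 k : ~ gs_dom k -> gs k = 0.
Proof.
by move=> /negP; rewrite negbK gsE => /eqP ->; rewrite sqrtr0 invr0 scale0r.
Qed.

Lemma gs_norm k : gs_dom k -> ip (gs k) (gs k) = 1.
Proof.
move=> Dk; rewrite gsE (sip_sqZ sip) exprVn sqr_sqrtr ?(sip_ge0 sip)//.
by rewrite mulVf.
Qed.

Lemma gs_orth k : forall j, (j < k)%N -> ip (gs k) (gs j) = 0.
Proof.
elim/ltn_ind: k => k IH j jk.
suff H : ip (gs_rem k) (gs j) = 0 by rewrite gsE (sipZl sip) H mulr0.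
rewrite (sipBl sip) (sip_suml sip) (bigD1 (Ordinal jk))//=.
rewrite big1 => [|i ij]; last first.
  have {}ij : i != j :> nat by apply: contraNN ij => /eqP ij; apply/eqP/val_inj.
  rewrite (sipZl sip); case: (ltngtP i j) ij => // ij _.
  - by rewrite (sipC sip (gs i)) (IH j) ?mulr0.
  - by rewrite (IH i) ?mulr0.
rewrite (sipZl sip) addr0.
have [Dj|nDj] := pselect (gs_dom j); first by rewrite gs_norm// mulr1 subrr.
by rewrite gs0// !(sip0r sip) mulr0 subrr.
Qed.

Lemma gs_ortho : ortho_fam (ip := ip) gs_dom gs.
Proof.
split=> [j k|]; last exact: gs0.
case: (ltngtP j k) => [jk|jk|->] /=.
- by rewrite (sipC sip) gs_orth.
- by rewrite gs_orth.
- by case: asboolP => Dk; [rewrite gs_norm|rewrite gs0// (sip0r sip)].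
Qed.

(** Membership in the span holds only up to a null vector: a remainder of norm 0 need not be 0, yet
    it is dropped. By best approximation one good choice of coordinates is enough. *)
Lemma gs_span n i : (i < n)%N ->
  ip (v i - fproj (ip := ip) gs n (v i)) (v i - fproj (ip := ip) gs n (v i)) = 0.
Proof.
move=> iltn; apply/eqP; rewrite eq_le (sip_ge0 sip) andbT.
set r := Num.sqrt (ip (gs_rem i) (gs_rem i)).
(* The recursion read backwards: [v i] is its projection on the earlier vectors plus [r] times
   [gs i]. *)
pose c j := if (j < i)%N then ip (v i) (gs j) else if j == i then r else 0.
have c0 k : ~ gs_dom k -> c k = 0.
  move=> nD; rewrite /c gs0// (sip0r sip); case: ifP => // _; case: eqP => // ki.
  by rewrite /r -ki; move/negP : nD; rewrite negbK => /eqP ->; rewrite sqrtr0.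
rewrite (sq_Bproj sip gs_ortho).
apply: le_trans (best_approx sip gs_ortho n (v i) c0) _.
have -> : \sum_(j < n) c j *: gs j = \sum_(j < i) ip (v i) (gs j) *: gs j + r *: gs i.
  rewrite -(big_mkord xpredT (fun j => c j *: gs j)).
  rewrite (big_cat_nat (n := i.+1))//= [X in _ + X]big_nat_cond [X in _ + X]big1 => [|j]; last first.
    move=> /andP[/andP[ij _] _]; rewrite /c ltnNge (ltnW ij)/=.
    by rewrite gtn_eqF// scale0r.
  rewrite addr0 big_mkord big_ord_recr/= /c ltnn eqxx; congr (_ + _).
  by apply: eq_bigr => j _; rewrite ltn_ord.
rewrite opprD addrA -/(gs_rem i) gsE -/r.
have [r0|r0] := eqVneq (ip (gs_rem i) (gs_rem i)) 0.
  by rewrite /r r0 sqrtr0 scale0r subr0 r0.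
rewrite scalerA divff ?scale1r ?subrr ?(sip0l sip)//.
by rewrite sqrtr_eq0 -ltNge lt_neqAle eq_sym r0 (sip_ge0 sip).
Qed.

Lemma gs_parseval :
  (forall x eps, 0 < eps -> exists n (c : nat -> R),
     ip (x - \sum_(i < n) c i *: v i) (x - \sum_(i < n) c i *: v i) < eps) ->
  parseval_fam (ip := ip) gs.
Proof.
move=> H; apply: (approx_parseval sip gs_ortho) => x eps eps0.
have [n [c Hc]] := H x eps eps0.
pose d j := \sum_(i < n) c i * ip (v i) (gs j).
exists n, d; split=> [k nD|].
  by rewrite /d gs0//; apply: big1 => i _; rewrite (sip0r sip) mulr0.
(* Replacing each [v i] by its projection changes the combination by a null vector, which leaves the
   distance to [x] unchanged. *)
suff -> : x - \sum_(i < n) d i *: gs i = x - \sum_(i < n) c i *: v i +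
    \sum_(i < n) c i *: (v i - fproj (ip := ip) gs n (v i)).
  rewrite (sip_nullD sip)// (sip_suml sip) big1// => i _.
  by rewrite (sipZl sip) (sip_null sip) ?mulr0// gs_span.
rewrite -addrA; congr (_ + _).
under [X in _ = _ + X]eq_bigr do rewrite scalerBr.
rewrite sumrB addKr /d; congr (- _).
under eq_bigr do rewrite scaler_suml.
rewrite exchange_big; apply: eq_bigr => i _ /=.
by rewrite /fproj scaler_sumr; apply: eq_bigr => j _; rewrite [RHS]scalerA.
Qed.

End gram_schmidt.

(** * Dual norms of functionals, and Hilbert-Schmidt sums independent of the basis *)

Section functionals.
Context {R : realType} {V : lmodType R} {ip : V -> V -> R}.
Hypothesis sip : semi_inner ip.
Variables (D : set nat) (E : nat -> V).
Hypotheses (oE : ortho_fam (ip := ip) D E).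
Variables (phi : V -> R) (N : R).
Hypotheses (phiDZ : forall a x y, phi (a *: x + y) = a * phi x + phi y)
  (phiN : forall x, phi x ^+ 2 <= N * ip x x).

Let phi0 : phi 0 = 0.
Proof. by have := phiDZ (-1) 0 0; rewrite scaler0 addr0; lra. Qed.

Let phi_sum (c : nat -> R) (u : nat -> V) n :
  phi (\sum_(i < n) c i *: u i) = \sum_(i < n) c i * phi (u i).
Proof.
by elim/big_rec2: _ => // i y1 y2 _ <-; rewrite phiDZ.
Qed.

(** Evaluate [phi] on its own truncated Riesz vector: with s the sum, s^2 <= N s. *)
Lemma functional_bessel n : 0 <= N -> \sum_(i < n) phi (E i) ^+ 2 <= N.
Proof.
move=> N0; have c0 k : ~ D k -> phi (E k) = 0 by move=> /oE.2 ->.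
have := phiN (\sum_(i < n) phi (E i) *: E i).
rewrite (ortho_comb sip oE _ c0) (phi_sum (fun i => phi (E i))).
under eq_bigr do rewrite -expr2.
set s := \sum_(i < n) _; have : 0 <= s by apply: sumr_ge0 => i _; exact: sqr_ge0.
rewrite le_eqVlt => /predU1P[<-//|s0]; rewrite expr2 ler_pM2r//.
Qed.

(** With [functional_bessel], this identifies the sum of the [phi (E i) ^+ 2] as the squared dual
    norm of [phi]. Cauchy-Schwarz on partial sums replaces the Riesz representation, as the space of
    formal combinations is not complete in general. *)
Lemma functional_parseval (S : R) : parseval_fam (ip := ip) E ->
  (forall n, \sum_(i < n) phi (E i) ^+ 2 <= S) ->
  forall x, phi x ^+ 2 <= S * ip x x.
Proof.
move=> pE HS x.
have H1 n : phi (fproj (ip := ip) E n x) ^+ 2 <= S * ip x x.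
  have S0 : 0 <= S by apply: le_trans (HS 0%N); rewrite big_ord0.
  rewrite (phi_sum (fun i => ip x (E i))).
  apply: (@le_trans _ _ ((\sum_(i < n) phi (E i) ^+ 2) *
      (\sum_(i < n) ip x (E i) ^+ 2))); last first.
    apply: ler_pM => //; last exact: (bessel sip oE).
    - by apply: sumr_ge0 => i _; exact: sqr_ge0.
    - by apply: sumr_ge0 => i _; exact: sqr_ge0.
  set a := \sum_(i < n) phi (E i) ^+ 2.
  set b := \sum_(i < n) ip x (E i) ^+ 2.
  set c := \sum_(i < n) ip x (E i) * phi (E i).
  have Hq t : 0 <= a - 2 * t * c + t ^+ 2 * b.
    rewrite (_ : _ + _ = \sum_(i < n) (phi (E i) - t * ip x (E i)) ^+ 2).
      by apply: sumr_ge0 => i _; exact: sqr_ge0.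
    rewrite /a /b /c !mulr_sumr -sumrB -big_split/=.
    by apply: eq_bigr => i _; ring.
  have b0 : 0 <= b by apply: sumr_ge0 => i _; exact: sqr_ge0.
  move: b0; rewrite le_eqVlt => /predU1P[b0|b0].
    have -> : c = 0.
      apply: big1 => i _; suff /eqP : ip x (E i) ^+ 2 = 0.
        by rewrite sqrf_eq0 => /eqP ->; rewrite mul0r.
      by apply: (psumr_eq0P _ (esym b0)) => // j _; exact: sqr_ge0.
    by rewrite expr0n mulr_ge0// -?b0//; apply: sumr_ge0 => i _; exact: sqr_ge0.
  have := Hq (c / b).
  have -> : a - 2 * (c / b) * c + (c / b) ^+ 2 * b = a - c ^+ 2 / b.
    by field; rewrite gt_eqF.
  by rewrite subr_ge0 ler_pdivrMr.
have phiB y z : phi (y - z) = phi y - phi z.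
  by have := phiDZ (-1) z y; rewrite scaleN1r mulN1r addrC => ->; rewrite addrC.
have H2 : (fun n => phi (fproj (ip := ip) E n x)) @ \oo --> phi x.
  apply/cvgrPdist_lt => eps eps0.
  have e20 : 0 < eps ^+ 2 / (`|N| + 1) by rewrite divr_gt0 ?exprn_gt0// ltr_wpDl.
  have /cvgr0Pnorm_lt/(_ _ e20) := parseval_proj sip oE x pE.
  apply: filterS => n; rewrite ger0_norm ?(sip_ge0 sip)// ltr_pdivlMr ?ltr_wpDl//.
  move=> Hn; rewrite distrC -phiB.
  rewrite -(ltr_pXn2r (n := 2))// ?nnegrE ?ltW// real_normK ?num_real//.
  apply: le_lt_trans (phiN _) _; apply: le_lt_trans Hn; rewrite mulrC.
  by rewrite ler_wpM2l ?(sip_ge0 sip)// (le_trans (ler_norm _))// lerDl.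
have : (fun n => phi (fproj (ip := ip) E n x) ^+ 2) @ \oo --> phi x ^+ 2.
  by apply: cvgM.
by move=> H3; apply: (ler_cvg_to H3 (cvg_cst (S * ip x x))); exact: nearW.
Qed.

End functionals.

Section basis_independence.
Context {R : realType} {V W : lmodType R} {ip : V -> V -> R} {ipW : W -> W -> R}.
Hypotheses (sip : semi_inner ip) (sipW : semi_inner ipW).

Lemma ereal_nneg_sum_le (f : nat -> R) (S : R) : (forall i, 0 <= f i) ->
  (\sum_(0 <= k <oo) (f k)%:E <= S%:E)%E -> forall n, \sum_(i < n) f i <= S.
Proof.
move=> f0 HS n; rewrite -lee_fin; apply: le_trans HS.
rewrite -sumEFin -(big_mkord xpredT (fun i => (f i)%:E)).
by apply: nneseries_lim_ge => k _ _; rewrite lee_fin.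
Qed.

Lemma ereal_sum_le (f : nat -> R) (S : R) : (forall i, 0 <= f i) ->
  (forall n, \sum_(i < n) f i <= S) -> (\sum_(0 <= k <oo) (f k)%:E <= S%:E)%E.
Proof.
move=> f0 HS; apply: lime_le.
  by apply: is_cvg_nneseries => k _ _; rewrite lee_fin.
by apply: nearW => n; rewrite big_mkord sumEFin lee_fin.
Qed.

Lemma functional_sum_le D E D' E' (phi : V -> R) (N : R) :
  ortho_fam (ip := ip) D E -> ortho_fam (ip := ip) D' E' ->
  parseval_fam (ip := ip) E' ->
  (forall a x y, phi (a *: x + y) = a * phi x + phi y) ->
  (forall x, phi x ^+ 2 <= N * ip x x) ->
  (\sum_(0 <= k <oo) (phi (E k) ^+ 2)%:E <= \sum_(0 <= k <oo) (phi (E' k) ^+ 2)%:E)%E.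
Proof.
move=> oE oE' pE' phiDZ phiN.
have sq0 F (i : nat) : 0 <= phi (F i) ^+ 2 by exact: sqr_ge0.
case HS : (\sum_(0 <= k <oo) (phi (E' k) ^+ 2)%:E)%E => [S| |]; last first.
- suff : (0 <= -oo :> \bar R)%E by [].
  by rewrite -HS; apply: nneseries_ge0 => k _ _; rewrite lee_fin.
- by rewrite leey.
have S0 : 0 <= S.
  by rewrite -lee_fin -HS; apply: nneseries_ge0 => k _ _; rewrite lee_fin.
apply: ereal_sum_le => // n; apply: (functional_bessel sip oE phiDZ) => //.
apply: (functional_parseval sip oE' phiDZ phiN pE').
by apply: (ereal_nneg_sum_le (f := fun k => phi (E' k) ^+ 2)) => //; rewrite HS.
Qed.

(* [G] need only be linear up to null vectors, as for maps between L2 spaces. *)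
Definition null_linear (G : V -> W) := forall a x y,
  ipW (G (a *: x + y) - (a *: G x + G y)) (G (a *: x + y) - (a *: G x + G y)) = 0.

(** Expand each [G (E k)] in the family [U] and exchange the sums: for fixed [j] the inner sum
    compares squared dual norms of the single functional [ipW (G x) (U j)]. *)
Lemma hs_basis_le D E D' E' DW U (G : V -> W) (N : R) :
  ortho_fam (ip := ip) D E -> ortho_fam (ip := ip) D' E' ->
  parseval_fam (ip := ip) E' ->
  ortho_fam (ip := ipW) DW U -> parseval_fam (ip := ipW) U ->
  null_linear G ->
  (forall x, ipW (G x) (G x) <= N * ip x x) ->
  (\sum_(0 <= k <oo) (ipW (G (E k)) (G (E k)))%:E <=
   \sum_(0 <= k <oo) (ipW (G (E' k)) (G (E' k)))%:E)%E.
Proof.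
move=> oE oE' pE' oU pU Glin GN.
have H F : (\sum_(0 <= k <oo) (ipW (G (F k)) (G (F k)))%:E =
    \sum_(0 <= j <oo) \sum_(0 <= k <oo) (ipW (G (F k)) (U j) ^+ 2)%:E)%E.
  rewrite nneseries_interchange; last by move=> i j; rewrite lee_fin sqr_ge0.
  by apply: eq_eseriesr => k _; rewrite (parseval_ereal _ pU).
rewrite !H; apply: lee_nneseries => [j _ _|j _].
  by apply: nneseries_ge0 => k _ _; rewrite lee_fin sqr_ge0.
apply: (functional_sum_le (N := N) (phi := fun x => ipW (G x) (U j)) oE oE' pE') => [a x y|x].
  rewrite -(sipDZ sipW) -[LHS]addr0; apply/eqP; rewrite addr0 -subr_eq0 -(sipBl sipW).
  by rewrite (sip_null sipW).
apply: le_trans (sip_CS sipW _ _) _; apply: le_trans (GN x).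
rewrite -[leRHS]mulr1 ler_wpM2l ?(sip_ge0 sipW)// oU.1 eqxx /=.
by case: asboolP.
Qed.

Lemma hs_basis_indep D E D' E' DW U (G : V -> W) (N : R) :
  ortho_fam (ip := ip) D E -> parseval_fam (ip := ip) E ->
  ortho_fam (ip := ip) D' E' -> parseval_fam (ip := ip) E' ->
  ortho_fam (ip := ipW) DW U -> parseval_fam (ip := ipW) U ->
  null_linear G ->
  (forall x, ipW (G x) (G x) <= N * ip x x) ->
  (\sum_(0 <= k <oo) (ipW (G (E k)) (G (E k)))%:E =
   \sum_(0 <= k <oo) (ipW (G (E' k)) (G (E' k)))%:E)%E.
Proof.
move=> oE pE oE' pE' oU pU Gl GN; apply/eqP; rewrite eq_le.
by rewrite (hs_basis_le oE oE' pE' oU pU Gl GN) (hs_basis_le oE' oE pE oU pU Gl GN).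
Qed.

End basis_independence.

(** * The spectral theorem for Hilbert-Schmidt positive operators *)

Section completeness.
Context {R : realType} {V : lmodType R} (ip : V -> V -> R).

Definition cauchy_ip (u : nat -> V) := forall eps : R, 0 < eps ->
  exists N, forall m n, (N <= m)%N -> (N <= n)%N ->
    ip (u m - u n) (u m - u n) < eps.

Definition cvg_ip (u : nat -> V) x :=
  (fun n => ip (u n - x) (u n - x)) @ \oo --> (0 : R).

Definition complete_ip := forall u, cauchy_ip u -> exists x, cvg_ip u x.

Definition definite_ip := forall x, ip x x = 0 -> x = 0.

End completeness.

Section fourier.
Context {R : realType} {V : lmodType R} {ip : V -> V -> R}.
Hypotheses (sip : semi_inner ip) (ipV : complete_ip ip) (def : definite_ip ip).

Lemma definite_eq x y : (forall z, ip x z = ip y z) -> x = y.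
Proof.
move=> H; apply/eqP; rewrite -subr_eq0; apply/eqP/def.
by rewrite (sipBl sip) H subrr.
Qed.

Lemma cauchy_ip_of_cvg (u : nat -> V) (a : nat -> R) :
  cvgn a -> (forall m n, (n <= m)%N -> ip (u m - u n) (u m - u n) <= `|a m - a n|) ->
  cauchy_ip ip u.
Proof.
move=> ca H eps eps0.
have e20 : 0 < eps / 2 by rewrite divr_gt0.
have /cvgrPdist_lt/(_ _ e20)[N _ HN] := ca; exists N.
have Ha m n : (N <= m)%N -> (N <= n)%N -> `|a m - a n| < eps.
  move=> /HN /= am /HN /= an.
  rewrite (le_lt_trans (ler_distD (limn a) _ _))// (splitr eps) ltrD//.
  by rewrite distrC.
move=> m n Nm Nn; case/orP: (leq_total n m) => mn.
  by apply: le_lt_trans (H _ _ mn) _; exact: Ha.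
by rewrite (sip_sqBC sip); apply: le_lt_trans (H _ _ mn) _; exact: Ha.
Qed.

Section family.
Variables (D : set nat) (E : nat -> V).
Hypothesis oE : ortho_fam (ip := ip) D E.

(** Squared distances between partial sums are increments of the Bessel sums, which are monotone and
    bounded. *)
Lemma fourier_cvg x : exists y, cvg_ip ip (fun n => fproj (ip := ip) E n x) y.
Proof.
apply: ipV; pose s n := \sum_(i < n) ip x (E i) ^+ 2.
have snd : nondecreasing_seq s.
  apply/nondecreasing_seqP => n; rewrite /s big_ord_recr/= lerDl; exact: sqr_ge0.
apply: (cauchy_ip_of_cvg (a := s)).
  apply: nondecreasing_is_cvgn => //; exists (ip x x) => _ [n _ <-].
  exact: (bessel sip oE).
move=> m n nm; rewrite (sip_sqB sip) !(sq_proj sip oE) -/(s m) -/(s n).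
suff -> : ip (fproj (ip := ip) E m x) (fproj (ip := ip) E n x) = s n.
  by rewrite ger0_norm ?subr_ge0 ?snd// le_eqVlt; apply/orP; left; apply/eqP; ring.
rewrite /fproj (sip_sumr sip); apply: eq_bigr => i _.
rewrite (sipZr sip) (ortho_sum sip oE (fun k => ip x (E k))).
rewrite (leq_trans (ltn_ord i) nm) /=; case: asboolP => [_|nD].
  by rewrite expr2.
by rewrite (ip_E0 sip oE _ nD) mulr0 expr0n.
Qed.

Definition oproj x := projT1 (cid (fourier_cvg x)).

Lemma oprojP x : cvg_ip ip (fun n => fproj (ip := ip) E n x) (oproj x).
Proof. by rewrite /oproj; case: cid. Qed.

Lemma ip_oproj_E x k : ip (oproj x) (E k) = ip x (E k).
Proof.
have /(_ (E k)) H := @sip_cvg _ _ _ sip _ _ (oprojP x).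
apply: (cvg_unique _ H) => //; apply: cvg_near_cst.
exists k.+1 => // n /= kn; rewrite (ortho_sum sip oE (fun k => ip x (E k))) kn/=.
by case: asboolP => // nD; rewrite (ip_E0 sip oE _ nD).
Qed.

Lemma ip_oproj x y : (forall k, ip y (E k) = 0) -> ip (oproj x) y = 0.
Proof.
move=> yE; have H := @sip_cvg _ _ _ sip _ _ (oprojP x) y.
apply: (cvg_unique _ H) => //; apply: cvg_near_cst; apply: nearW => n.
rewrite (sip_suml sip) big1// => i _.
by rewrite (sipZl sip) (sipC sip _ y) yE mulr0.
Qed.

Lemma oproj_parseval : (forall x, oproj x = x) -> parseval_fam (ip := ip) E.
Proof.
move=> H x; have := sip_cvg_sq sip (oprojP x); rewrite H.
by under eq_fun do rewrite (sq_proj sip oE).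
Qed.

End family.
End fourier.

Section positive_operators.
Context {R : realType} {V : lmodType R} {ip : V -> V -> R}.
Hypotheses (sip : semi_inner ip) (ipV : complete_ip ip) (def : definite_ip ip).
Variable F : V -> V.
Hypotheses (FDZ : forall a x y, F (a *: x + y) = a *: F x + F y)
  (Fsym : symmetric_op ip F) (Fpos : nonneg_op ip F).

Lemma pos_form : semi_inner (fun x y => ip (F x) y).
Proof.
split=> [x y|a x y z|x]; last exact: Fpos.
- by rewrite Fsym (sipC sip).
- by rewrite FDZ (sipDZ sip).
Qed.

Lemma iter_sym n x y : ip (iter n F x) y = ip x (iter n F y).
Proof. by elim: n x y => //= n IH x y; rewrite Fsym IH -iterSr. Qed.

Lemma iter_ip m n x : ip (iter m F x) (iter n F x) = ip (iter (m + n) F x) x.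
Proof. by rewrite addnC iterD [RHS]iter_sym. Qed.

Section contraction.
Hypothesis Fle : forall x, ip (F x) x <= ip x x.

(** The operator inequality F^2 <= F: Cauchy-Schwarz for the form [ip (F x) y] at [x] and [F x],
    then division by the squared norm of [F x]. *)
Lemma pos_sq_le x : ip (F x) (F x) <= ip (F x) x.
Proof.
have := sip_CS pos_form x (F x); have := Fle (F x).
have := sip_ge0 sip (F x); rewrite le_eqVlt => /predU1P[<- _ _|F0 H1 H2].
  exact: Fpos.
rewrite -(ler_pM2r F0) -expr2; apply: le_trans H2 _.
by rewrite ler_wpM2l.
Qed.

(** An even exponent 2k steps down by F <= 1 at F^k x, an odd exponent 2k + 1 by F^2 <= F at F^k
    x. *)
Lemma iter_nonincreasing x : nonincreasing_seq (fun n => ip (iter n F x) x).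
Proof.
apply/nonincreasing_seqP => n.
have H1 k : ip (iter (k + k).+1 F x) x <= ip (iter (k + k) F x) x.
  by rewrite -iter_ip -addSn -iter_ip /=; exact: Fle.
have H2 k : ip (iter (k + k).+2 F x) x <= ip (iter (k + k).+1 F x) x.
  rewrite -(addnS k k) -(addSn k k.+1) -iter_ip (addnC k k.+1) -iter_ip /=.
  exact: pos_sq_le.
rewrite -(odd_double_half n) -addnn; case: (odd n); [exact: H2|exact: H1].
Qed.

Lemma iter_ge0 n x : 0 <= ip (iter n F x) x.
Proof.
rewrite -(odd_double_half n) -addnn; case: (odd n).
  by rewrite -[(true + _)%N]/(n./2.+1 + n./2)%N -iter_ip /=; exact: Fpos.
by rewrite -[(false + _)%N]/(n./2 + n./2)%N -iter_ip; exact: (sip_ge0 sip).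
Qed.

(** With a_n = <F^n x, x>, the squared distance of F^m x and F^n x is a_2m - 2 a_(m+n) + a_2n.
    Monotonicity bounds it by the increment of a_2n, so the powers converge strongly, necessarily to
    a fixed vector. *)
Lemma iter_cvg x : exists y, cvg_ip ip (fun n => iter n F x) y /\ F y = y.
Proof.
pose a n := ip (iter n F x) x.
have ca : cvgn a.
  apply: nonincreasing_is_cvgn; first exact: iter_nonincreasing.
  by exists 0 => _ [n _ <-]; exact: iter_ge0.
have [y ylim] : exists y, cvg_ip ip (fun n => iter n F x) y.
  apply: ipV; apply: (cauchy_ip_of_cvg sip (a := fun n => a (n + n)%N)).
    apply/cvg_ex; exists (limn a); apply: (cvg_comp _ _ _ ca).
    by move=> A [N _ NA]; exists N => // n /= Nn; apply: NA; exact: leq_trans (leq_addr _ _).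
  move=> m n nm; rewrite (sip_sqB sip) !iter_ip -/(a (m + m)%N) -/(a (n + n)%N) -/(a (m + n)%N).
  have amn : a (m + m)%N <= a (m + n)%N by apply: iter_nonincreasing; rewrite leq_add2l.
  have ann : a (m + n)%N <= a (n + n)%N by apply: iter_nonincreasing; rewrite leq_add2r.
  by rewrite ler0_norm ?subr_le0 ?(le_trans amn)//; lra.
exists y; split=> //; apply: (definite_eq sip def) => z.
have H1 := @sip_cvg _ _ _ sip _ _ ylim (F z); rewrite Fsym.
have H2 := @sip_cvg _ _ _ sip _ _ ylim z.
apply: (cvg_unique _ H1) => //; rewrite -(cvg_shiftS (fun n => ip (iter n F x) z)) in H2.
suff -> : (fun n => ip (iter n F x) (F z)) = (fun n => ip (iter n.+1 F x) z) by [].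
by apply/funext => n; rewrite /= Fsym.
Qed.

(** Repeated doubling by Cauchy-Schwarz: <F^k x, x>^2 <= <F^2k x, x> on the unit ball. *)
Lemma iter_lower n x : ip x x <= 1 ->
  ip (F x) x ^+ (2 ^ n) <= ip (iter (2 ^ n) F x) x.
Proof.
move=> x1; elim: n => [|n IH]; first by rewrite expn0 expr1.
rewrite expnS mul2n -addnn exprD -expr2 -iter_ip.
apply: (@le_trans _ _ (ip (iter (2 ^ n) F x) x ^+ 2)).
  by rewrite ler_pXn2r// ?nnegrE ?exprn_ge0 ?Fpos// iter_ge0.
apply: le_trans (sip_CS sip _ _) _.
by rewrite -[leRHS]mulr1 ler_wpM2l ?(sip_ge0 sip).
Qed.

End contraction.

Lemma sym_hs_bound (K : V -> V) (S : R) E :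
  symmetric_op ip K -> parseval_fam (ip := ip) E ->
  (forall n, \sum_(i < n) ip (K (E i)) (K (E i)) <= S) ->
  forall x, ip (K x) (K x) <= S * ip x x.
Proof.
move=> Ksym pE HS x; have := pE (K x).
move=> H; apply: (ler_cvg_to H (cvg_cst (S * ip x x))).
apply: nearW => n; apply: (@le_trans _ _ ((\sum_(i < n) ip (K (E i)) (K (E i))) * ip x x)).
  rewrite mulr_suml ler_sum// => i _.
  by rewrite Ksym mulrC; exact: (sip_CS sip).
by rewrite ler_wpM2r ?(sip_ge0 sip).
Qed.

Section hs_contraction.
Hypothesis Fle : forall x, ip (F x) x <= ip x x.
Variables (E : nat -> V) (S : R).
Hypotheses (pE : parseval_fam (ip := ip) E)
  (FS : forall n, \sum_(i < n) ip (F (E i)) (F (E i)) <= S).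

Lemma iter_sq_le n x : (0 < n)%N -> ip (iter n F x) (iter n F x) <= ip (F x) (F x).
Proof.
move=> n0; rewrite -[X in _ <= ip X _]/(iter 1 F x) -[X in _ <= ip _ X]/(iter 1 F x).
by rewrite !iter_ip; apply: iter_nonincreasing => //; exact: leq_add.
Qed.

(** Strong convergence to 0 becomes convergence in Hilbert-Schmidt norm: finitely many terms go to 0
    and the others are dominated by a tail for [F] itself. *)
Lemma iter_hs_small (eps : R) : 0 < eps ->
  (forall k, cvg_ip ip (fun n => iter n F (E k)) 0) ->
  exists N, forall n m, (N <= n)%N ->
    \sum_(i < m) ip (iter n F (E i)) (iter n F (E i)) <= eps.
Proof.
move=> eps0 HE.
pose a i := ip (F (E i)) (F (E i)); pose s n := \sum_(i < n) a i.
have a0 i : 0 <= a i by exact: (sip_ge0 sip).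
have snd : nondecreasing_seq s.
  by apply/nondecreasing_seqP => n; rewrite /s big_ord_recr/= lerDl.
have cs : cvgn s by apply: nondecreasing_is_cvgn => //; exists S => _ [n _ <-]; exact: FS.
have e20 : 0 < eps / 2 by rewrite divr_gt0.
have /cvgrPdist_lt/(_ _ e20)[K _ /(_ K (leqnn K)) HK] := cs.
have head : (fun n => \sum_(i < K) ip (iter n F (E i)) (iter n F (E i))) @ \oo --> (0 : R).
  rewrite [X in _ --> X](_ : _ = \sum_(i < K) (0 : R)); last by rewrite big1.
  apply: cvg_bigsum => i _; have := HE i; rewrite /cvg_ip.
  by under eq_fun do rewrite subr0.
have /cvgr0Pnorm_lt/(_ _ e20)[N _ HN] := head.
(* The exponent must be at least 1 for the tail of F^n to be dominated by that of [F]. *)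
exists (maxn N 1) => n m; rewrite geq_max => /andP[Nn n1].
apply: (@le_trans _ _ (\sum_(i < K + m) ip (iter n F (E i)) (iter n F (E i)))).
  rewrite addnC -!(big_mkord xpredT (fun i => ip (iter n F (E i)) (iter n F (E i)))).
  rewrite [leRHS](big_cat_nat (n := m))//= ?leq_addr// lerDl.
  by apply: sumr_ge0 => i _; exact: (sip_ge0 sip).
rewrite big_split_ord/= (splitr eps) lerD//.
  by have /= := HN n Nn; rewrite ger0_norm; [exact: ltW|
    by apply: sumr_ge0 => i _; exact: (sip_ge0 sip)].
apply: (@le_trans _ _ (s (K + m)%N - s K)).
  rewrite /s big_split_ord/= addrAC subrr add0r ler_sum// => i _; exact: iter_sq_le.
apply: le_trans (_ : limn s - s K <= _).
  by rewrite lerD2r; exact: nondecreasing_cvgn_le.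
by apply: le_trans (ler_norm _) _; exact: ltW.
Qed.

(** Without a fixed vector the powers of [F] tend to 0 strongly, hence in Hilbert-Schmidt norm and
    in operator norm; vectors that almost attain norm 1 prevent this. *)
Lemma exists_fixpoint :
  (forall d : R, 0 < d -> exists x, ip x x <= 1 /\ 1 - d <= ip (F x) x) ->
  exists x, x <> 0 /\ F x = x.
Proof.
move=> Hsup; apply: contrapT => /forallNP Hno.
have HE k : cvg_ip ip (fun n => iter n F (E k)) 0.
  have [y [Hy Fy]] := iter_cvg Fle (E k).
  suff <- : y = 0 by [].
  by apply: contrapT => y0; apply: (Hno y).
have q0 : 0 < 4^-1 :> R by rewrite invr_gt0.
have [N HN] := iter_hs_small q0 HE.
pose n := (2 ^ N)%N.
have Hn x : ip (iter n F x) (iter n F x) <= 4^-1 * ip x x.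
  apply: (sym_hs_bound _ pE) => [y z|m]; first exact: iter_sym.
  by apply: HN; exact: ltnW (ltn_expl _ _).
have n0 : 0 < n%:R :> R by rewrite ltr0n expn_gt0.
(* The exponent [n] is fixed first. By Bernoulli, (1 - 1/(4n))^n >= 3/4, whereas F^n has norm at
   most 1/2, and 9/16 > 1/4 contradicts Cauchy-Schwarz. *)
have d0 : 0 < (4 * n%:R)^-1 :> R by rewrite invr_gt0 mulr_gt0.
have [x [x1 Hx]] := Hsup _ d0.
have H34 : 3 / 4 <= ip (iter n F x) x.
  apply: (le_trans _ (iter_lower N x1)).
  apply: (@le_trans _ _ ((1 - (4 * n%:R)^-1) ^+ n)).
    have bern m : (m <= n)%N -> 1 - m%:R * (4 * n%:R)^-1 <= (1 - (4 * n%:R)^-1) ^+ m :> R.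
      elim: m => [|m IH] mn; first by rewrite mul0r subr0 expr0.
      have d1 : 0 <= 1 - (4 * n%:R)^-1 :> R.
        rewrite subr_ge0 invf_le1 ?mulr_gt0// -natrM ler1n muln_gt0/=.
        by rewrite expn_gt0.
      rewrite exprSr; apply: (le_trans _ (ler_wpM2r d1 (IH (ltnW mn)))).
      rewrite -natr1; set d := (4 * n%:R)^-1; rewrite -subr_ge0.
      by rewrite (_ : _ - _ = m%:R * d ^+ 2); [rewrite mulr_ge0 ?sqr_ge0|ring].
    apply: (le_trans _ (bern n (leqnn n))).
    by rewrite invfM mulrCA divff ?gt_eqF//; lra.
  rewrite lerXn2r ?nnegrE ?Fpos// ?subr_ge0 ?invf_le1 ?mulr_gt0//.
  by rewrite -natrM ler1n muln_gt0 expn_gt0.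
have := sip_CS sip (iter n F x) x; have := Hn x.
have := sip_ge0 sip x; have := sip_ge0 sip (iter n F x).
set a := ip (iter n F x) (iter n F x); set b := ip x x in x1 *; set c := ip (iter n F x) x in H34 *.
by nra.
Qed.

End hs_contraction.

End positive_operators.

Section eigenvectors.
Context {R : realType} {V : lmodType R} {ip : V -> V -> R}.
Hypotheses (sip : semi_inner ip) (ipV : complete_ip ip) (def : definite_ip ip).

(** The supremum [l] of the quadratic form on the unit ball is an eigenvalue: F / l is a positive
    contraction that almost attains 1, so it has a fixed vector. *)
Lemma exists_eigenvector (F : V -> V) E (S : R) :
  (forall a x y, F (a *: x + y) = a *: F x + F y) ->
  symmetric_op ip F -> nonneg_op ip F ->
  parseval_fam (ip := ip) E ->
  (forall n, \sum_(i < n) ip (F (E i)) (F (E i)) <= S) ->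
  (exists x, F x <> 0) -> exists (l : R) x, [/\ 0 < l, x <> 0 & F x = l *: x].
Proof.
move=> FDZ Fsym Fpos pE FS [x0 Fx0].
have FS2 := sym_hs_bound sip Fsym pE FS.
have S0 : 0 <= S by apply: le_trans (FS 0%N); rewrite big_ord0.
pose A := [set r : R | exists x, ip x x <= 1 /\ r = ip (F x) x].
have F0 : F 0 = 0 by have := FDZ (-1) 0 0; rewrite scaler0 addr0 scaleN1r addNr.
have FZ a x : F (a *: x) = a *: F x by have := FDZ a x 0; rewrite F0 !addr0.
have hsA : has_sup A.
  split; first by exists (ip (F 0) 0), 0; rewrite (sip0l sip).
  exists (S + 1) => _ [x [x1 ->]].
  have := FS2 x; have := sip_CS sip (F x) x.
  have := sip_ge0 sip x; have := sip_ge0 sip (F x).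
  set a := ip (F x) (F x); set b := ip x x in x1 *; set c := ip (F x) x.
  by nra.
set l := sup A.
have FleA x : ip (F x) x <= l * ip x x.
  have := sip_ge0 sip x; rewrite le_eqVlt => /predU1P[x0'|x0'].
    by rewrite -x0' mulr0 (sipC sip) (sip_null sip).
  rewrite -ler_pdivrMr//; apply: (ub_le_sup hsA.2).
  exists ((Num.sqrt (ip x x))^-1 *: x); rewrite FZ (sip_sqZ sip) (sipZl sip) (sipZr sip).
  rewrite mulrA -expr2 exprVn sqr_sqrtr ?(sip_ge0 sip)//.
  by split; [rewrite mulVf ?gt_eqF|rewrite mulrC].
have l0 : 0 < l.
  rewrite ltNge; apply/negP => l0; apply: Fx0; apply: def.
  have H : ip (F x0) x0 = 0.
    by apply/eqP; rewrite eq_le Fpos andbT (le_trans (FleA x0))// mulr_le0_ge0 ?(sip_ge0 sip).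
  by rewrite (sip_null (pos_form sip FDZ Fsym Fpos) (F x0) H).
pose B x := l^-1 *: F x.
have BDZ a x y : B (a *: x + y) = a *: B x + B y.
  by rewrite /B FDZ scalerDr !scalerA mulrC.
have Bsym : symmetric_op ip B.
  by move=> x y; rewrite /B (sipZl sip) (sipZr sip) Fsym.
have Bpos : nonneg_op ip B.
  by move=> x; rewrite /B (sipZl sip) mulr_ge0 ?invr_ge0 ?(ltW l0)//; exact: Fpos.
have Ble x : ip (B x) x <= ip x x.
  by rewrite /B (sipZl sip) ler_pdivrMl.
have BS n : \sum_(i < n) ip (B (E i)) (B (E i)) <= l^-1 ^+ 2 * S.
  under eq_bigr do rewrite /B (sip_sqZ sip).
  by rewrite -mulr_sumr ler_wpM2l// sqr_ge0.
have [|x [xn0 Bx]] := exists_fixpoint sip ipV def BDZ Bsym Bpos Ble pE BS.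
  move=> d d0; have ld : 0 < l * d by rewrite mulr_gt0.
  have [_ [x [x1 ->]] Hx] := sup_adherent ld hsA.
  exists x; split => //; rewrite /B (sipZl sip) ler_pdivlMl// ltW//.
  by rewrite mulrBr mulr1.
exists l, x; split=> //; rewrite -{2}Bx /B scalerA divff ?scale1r//.
by rewrite gt_eqF.
Qed.

End eigenvectors.

Section spectral.
Context {R : realType} {V : lmodType R} {ip : V -> V -> R}.
Hypotheses (sip : semi_inner ip) (ipV : complete_ip ip) (def : definite_ip ip).
Variables (F : V -> V) (E : nat -> V) (S : R) (h : nat -> V).
Hypotheses (FDZ : forall a x y, F (a *: x + y) = a *: F x + F y)
  (Fsym : symmetric_op ip F) (Fpos : nonneg_op ip F)
  (pE : parseval_fam (ip := ip) E)
  (FS : forall n, \sum_(i < n) ip (F (E i)) (F (E i)) <= S)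
  (hdense : forall x (eps : R), 0 < eps -> exists n, ip (x - h n) (x - h n) < eps).

Definition eigen_orthonormal (O : set V) :=
  (forall x, O x -> ip x x = 1 /\ exists l : R, F x = l *: x) /\
  (forall x y, O x -> O y -> x <> y -> ip x y = 0).

Lemma maximal_eigen_orthonormal : exists O, eigen_orthonormal O /\
  forall O', O `<` O' -> ~ eigen_orthonormal O'.
Proof.
apply: Zorn_bigcup => C CP tC; split=> [x [Y CY Yx]|x y]; last first.
  move=> [Y CY Yx] [Y' CY' Y'y].
  have [YY'|Y'Y] := tC _ _ CY CY'.
  - by have [_] := CP _ CY'; apply=> //; exact: YY'.
  - by have [_] := CP _ CY; apply=> //; exact: Y'Y.
by have [/(_ _ Yx)] := CP _ CY.
Qed.

(* Distinct elements of an orthonormal set are at distance sqrt 2, so nearest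
   points in a dense sequence index the set by integers. *)
Lemma eigen_family : exists D' (e : nat -> V),
  [/\ orthonormal_on ip D' e, (forall k, D' k -> exists l : R, F (e k) = l *: e k) &
  forall v (l : R), (forall k, D' k -> ip v (e k) = 0) -> F v = l *: v -> v = 0].
Proof.
have [ O [ [ O1 O2] Omax]] := maximal_eigen_orthonormal.
(* Two points at squared distance below 1/2 from the same [h n] are at squared distance below 2, the
   value for distinct orthonormal vectors. *)
have h2 : 0 < 2^-1 :> R by rewrite invr_gt0.
pose N x := projT1 (cid (hdense x h2)).
have NP x : ip (x - h (N x)) (x - h (N x)) < 2^-1 by rewrite /N; case: cid.
have Ninj x y : O x -> O y -> N x = N y -> x = y.
  move=> Ox Oy Nxy; apply: contrapT => xy.
  have H := sip_leD sip (x - h (N x)) (h (N x) - y).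
  have := NP x; have := NP y; rewrite -Nxy; move: H.
  rewrite addrA subrK (sip_sqB sip x y) (O2 _ _ Ox Oy xy) (O1 _ Ox).1 (O1 _ Oy).1.
  rewrite (sip_sqBC sip (h (N x)) y); lra.
pose D' := N @` O; pose e k := xget 0 [set x | O x /\ N x = k].
have eP k : D' k -> O (e k) /\ N (e k) = k.
  by move=> [x Ox xk]; apply: (xgetPex 0 (P := [set x | O x /\ N x = k])); exists x.
have eN x : O x -> e (N x) = x.
  move=> Ox; have [| Oe Ne] := eP (N x); first by exists x.
  by apply: Ninj.
exists D', e; split=> [j k Dj Dk|k Dk|v l vO Fv].
- have [jk|jk] := eqVneq j k; first by rewrite jk (O1 _ (eP _ Dk).1).1.
  rewrite (O2 _ _ (eP _ Dj).1 (eP _ Dk).1)// => ejk.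
  by move/eqP: jk; apply; rewrite -(eP _ Dj).2 -(eP _ Dk).2 ejk.
- by have [] := O1 _ (eP _ Dk).1.
- apply: contrapT => v0.
  have vv : 0 < ip v v.
    by rewrite lt_neqAle eq_sym (sip_ge0 sip) andbT; apply/eqP => /def.
  have vO' x : O x -> ip v x = 0 by move=> Ox; rewrite -(eN _ Ox) vO//; exists x.
  pose w := (Num.sqrt (ip v v))^-1 *: v.
  have ww : ip w w = 1.
    by rewrite (sip_sqZ sip) exprVn sqr_sqrtr ?ltW// mulVf ?gt_eqF.
  have wO x : O x -> ip w x = 0 by move=> /vO' vx; rewrite (sipZl sip) vx mulr0.
  have F0 : F 0 = 0 by have := FDZ (-1) 0 0; rewrite scaler0 addr0 scaleN1r addNr.
  have Fw : F w = l *: w.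
    by have := FDZ (Num.sqrt (ip v v))^-1 v 0; rewrite F0 !addr0 Fv !scalerA mulrC.
  apply: (Omax (O `|` [set w])).
    split; first by move=> x; left.
    by move=> /(_ w (or_intror erefl))/wO; rewrite ww => /eqP; rewrite oner_eq0.
  split=> [x|x y].
    by case=> [/O1//|->]; split=> //; exists l.
  case=> [ Ox|->]; case=> [ Oy|->] xy.
  + exact: O2.
  + by rewrite (sipC sip) wO.
  + exact: wO.
  + by [].
Qed.

(** Compress [F] to the complement of a maximal orthonormal family of eigenvectors. A nonzero
    compression would have an eigenvector there; so it vanishes, the complement consists of vectors
    with eigenvalue 0, and maximality makes it trivial. *)
Lemma spectral_theorem : exists D' e t, eigen_enumeration ip F D' e t.
Proof.
have [D' [e [oe eF emax]]] := eigen_family.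
have oz := zext_ortho sip oe; pose Z := zext D' e.
pose P := oproj sip ipV oz.
have F0 : F 0 = 0 by have := FDZ (-1) 0 0; rewrite scaler0 addr0 scaleN1r addNr.
have FB x y : F (x - y) = F x - F y.
  by have := FDZ (-1) y x; rewrite scaleN1r addrC => ->; rewrite scaleN1r addrC.
have ZE k : D' k -> Z k = e k by move=> Dk; rewrite /Z /zext asboolT.
pose M v := forall k, ip v (Z k) = 0.
have MB x : M (x - P x) by move=> k; rewrite (sipBl sip) /P ip_oproj_E subrr.
have MF v : M v -> M (F v).
  move=> Mv k; rewrite Fsym; have [Dk|nDk] := pselect (D' k); last first.
    by rewrite /Z oz.2// F0 (sip0r sip).
  by have [l Fl] := eF _ Dk; rewrite ZE// Fl (sipZr sip) -ZE// Mv mulr0.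
have Mmax v (l : R) : M v -> F v = l *: v -> v = 0.
  move=> Mv; apply: emax => k Dk; by have := Mv k; rewrite ZE.
have PM x v : M v -> ip (P x) v = 0 by exact: ip_oproj.
have M0 v : M v -> P v = 0.
  move=> Mv; apply: def; rewrite -[RHS](ip_oproj sip ipV oz v (y := P v))//.
  by move=> k; rewrite ip_oproj_E.
have PB x : P (x - P x) = 0 by apply: M0.
have PDZ a x y : P (a *: x + y) = a *: P x + P y.
  apply/eqP; rewrite -subr_eq0; apply/eqP; apply: def.
  set w := P _ - _.
  have Mw : M w.
    by move=> k; rewrite (sipBl sip) !(sipDZ sip) /P !ip_oproj_E (sipDZ sip) subrr.
  by rewrite {1}/w (sipBl sip) (sipDZ sip) !PM// mulr0 addr0 subr0.
pose F' x := F (x - P x).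
have F'DZ a x y : F' (a *: x + y) = a *: F' x + F' y.
  rewrite /F' -FDZ; congr F; rewrite PDZ scalerBr opprD !addrA; congr (_ - _).
  by rewrite addrAC.
have F'M x : M (F' x) by apply: MF; exact: MB.
have F'E z w : ip (F' z) w = ip (F' z) (w - P w).
  by rewrite (sipBr sip) (sipC sip _ (P w)) PM// subr0.
have F'sym : symmetric_op ip F'.
  by move=> x y; rewrite F'E (sipC sip x) (F'E y x) /F' Fsym (sipC sip).
have F'pos : nonneg_op ip F' by move=> x; rewrite F'E; exact: Fpos.
have F'S n : \sum_(i < n) ip (F' (E i)) (F' (E i)) <= S.
  apply: le_trans (FS n); apply: ler_sum => i _; set x := E i.
  have -> : F x = F' x + F (P x) by rewrite /F' FB subrK.
  rewrite (sip_sqD sip).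
  have -> : ip (F' x) (F (P x)) = 0.
    by rewrite -Fsym (sipC sip) PM//; exact: MF.
  by rewrite mulr0 addr0 lerDl (sip_ge0 sip).
have F'0 x : F' x = 0.
  apply: contrapT => Fx.
  have [|l [v [l0 v0 Fv]]] :=
    exists_eigenvector sip ipV def F'DZ F'sym F'pos pE F'S; first by exists x.
  have Mv : M v.
    move=> k; have := F'M v k; rewrite Fv (sipZl sip) => /eqP.
    by rewrite mulf_eq0 gt_eqF//= => /eqP.
  by apply: v0; apply: (Mmax _ l) => //; rewrite -Fv /F' M0// subr0.
have PE x : P x = x.
  apply/esym/eqP; rewrite -subr_eq0; apply/eqP; apply: (Mmax _ 0) => //.
  by rewrite scale0r; exact: F'0.
exists D', e, (fun k => ip (F (e k)) (e k)); split.
  by apply: (parseval_hilbert_basis sip oe); exact: (oproj_parseval PE).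
move=> k Dk; have [l Fl] := eF _ Dk.
by rewrite Fl (sipZl sip) oe// eqxx mulr1.
Qed.

End spectral.

(** * The exponential kernel *)

Section exponential_forms.
Context {R : realType} {I : finType}.
Variables (y : I -> nat -> R) (t : nat -> R).
Hypothesis t0 : forall k, 0 <= t k.

(** The quadratic form of the kernel exp(sum_k t_k y_ik y_jk), truncated to the first [n]
    coordinates. *)
Definition qf n (c : I -> R) := \sum_i \sum_j
  c i * c j * \prod_(k < n) expR (t k * (y i k * y j k)).

Lemma qf0 c : qf 0 c = (\sum_i c i) ^+ 2.
Proof.
rewrite expr2 mulr_suml; apply: eq_bigr => i _; rewrite mulr_sumr.
by apply: eq_bigr => j _; rewrite big_ord0 mulr1.
Qed.

(** Expand the exponential of the last coordinate: its m-th term is a product of a factor in i and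
    one in j, so it is absorbed in the coefficients. Positivity, monotonicity and all lower bounds
    below come from discarding terms of this series. *)
Lemma qfS n c : (fun M => \sum_(m < M) t n ^+ m / m`!%:R * qf n (fun i => c i * y i n ^+ m))
  @ \oo --> qf n.+1 c.
Proof.
have -> : (fun M => \sum_(m < M) t n ^+ m / m`!%:R * qf n (fun i => c i * y i n ^+ m)) =
  (fun M => \sum_i \sum_j (c i * c j * \prod_(k < n) expR (t k * (y i k * y j k))) *
     series (exp_coeff (t n * (y i n * y j n))) M).
  apply/funext => M.
  under eq_bigr do rewrite /qf mulr_sumr.
  rewrite exchange_big; apply: eq_bigr => i _.
  under eq_bigr do rewrite mulr_sumr.
  rewrite exchange_big; apply: eq_bigr => j _ /=.
  rewrite /series/= big_mkord mulr_sumr; apply: eq_bigr => m _.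
  by rewrite /exp_coeff/= !exprMn; ring.
rewrite /qf; apply: cvg_bigsum => i _; apply: cvg_bigsum => j _.
rewrite [\prod_(k < n.+1) _]big_ord_recr/= [c i * c j * (_ * _)]mulrA.
apply: cvgM; first exact: cvg_cst.
by rewrite /expR; exact: is_cvg_series_exp_coeff.
Qed.

Lemma qf_ge0 n c : 0 <= qf n c.
Proof.
elim: n c => [|n IH] c; first by rewrite qf0 sqr_ge0.
apply: (ler_cvg_to (cvg_cst 0) (qfS (n := n) (c := c))); apply: nearW => M.
by apply: sumr_ge0 => m _; rewrite mulr_ge0// divr_ge0// exprn_ge0.
Qed.

Lemma qf_partial n c M :
  \sum_(m < M) t n ^+ m / m`!%:R * qf n (fun i => c i * y i n ^+ m) <= qf n.+1 c.
Proof.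
apply: (ler_cvg_to (cvg_cst _) (qfS (n := n) (c := c))).
exists M => // M' /= MM'.
rewrite -!(big_mkord xpredT (fun m => t n ^+ m / m`!%:R * qf n (fun i => c i * y i n ^+ m))).
rewrite [leRHS](big_cat_nat (n := M))//= lerDl.
by apply: sumr_ge0 => m _; rewrite mulr_ge0 ?qf_ge0// divr_ge0// exprn_ge0.
Qed.

Lemma qf_term n c m :
  t n ^+ m / m`!%:R * qf n (fun i => c i * y i n ^+ m) <= qf n.+1 c.
Proof.
apply: le_trans (qf_partial n c m.+1); rewrite big_ord_recr/= lerDr.
by apply: sumr_ge0 => j _; rewrite mulr_ge0 ?qf_ge0// divr_ge0// exprn_ge0.
Qed.

Lemma qf_le n c : qf n c <= qf n.+1 c.
Proof.
have := qf_term n c 0; rewrite fact0 expr0 divr1 mul1r.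
by under [qf n _]eq_bigr do under eq_bigr do rewrite !mulr1.
Qed.

Lemma qf_nondecreasing c : nondecreasing_seq (qf ^~ c).
Proof. by apply/nondecreasing_seqP => n; exact: qf_le. Qed.

Lemma qf_series n c : (\sum_(0 <= m <oo)
  (t n ^+ m / m`!%:R * qf n (fun i => c i * y i n ^+ m))%:E = (qf n.+1 c)%:E)%E.
Proof.
apply/cvg_lim => //; under eq_fun do rewrite big_mkord sumEFin.
by apply: cvg_EFin; [exact: nearW|exact: qfS].
Qed.

(** In each coordinate keep the terms of degree 0 and 1 only; the degree 1 term is bounded below by
    its value with no coordinate left. *)
Lemma qf_linear_le n c : (forall k, t k = 1) ->
  \sum_(k < n) (\sum_i c i * y i k) ^+ 2 <= qf n c.
Proof.
move=> t1; have q0 m c' : (\sum_i c' i) ^+ 2 <= qf m c'.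
  by rewrite -qf0; apply: qf_nondecreasing.
elim: n => [|n IH]; first by rewrite big_ord0 qf_ge0.
rewrite big_ord_recr/=; apply: le_trans (qf_partial n c 2).
rewrite !big_ord_recr big_ord0/= add0r t1 fact0 expr0 expr1 !divr1 !mul1r.
apply: lerD.
  by under [leRHS]eq_bigr do under eq_bigr do rewrite !mulr1.
exact: (q0 n (fun i => c i * y i n)).
Qed.

(** In coordinate [k] keep the single term of degree [a k]. *)
Lemma qf_monomial_le n (a : nat -> nat) c : (forall k, t k = 1) ->
  (\sum_i c i * \prod_(k < n) (y i k ^+ a k / Num.sqrt (a k)`!%:R)) ^+ 2 <= qf n c.
Proof.
move=> t1; elim: n c => [|n IH] c.
  by rewrite qf0; under eq_bigr do rewrite big_ord0 mulr1.
apply: le_trans (qf_term n c (a n)); rewrite t1 expr1n mul1r.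
apply: le_trans (ler_wpM2l _ (IH _)); last by rewrite invr_ge0.
have f0 : 0 < (a n)`!%:R :> R by rewrite ltr0n fact_gt0.
rewrite -{1}(sqr_sqrtr (ltW f0)) -exprVn -exprMn mulr_sumr.
rewrite le_eqVlt; apply/orP; left; apply/eqP; congr (_ ^+ 2).
by apply: eq_bigr => i _; rewrite big_ord_recr/=; ring.
Qed.

End exponential_forms.

Section polynomial_combinations.
Context {R : realType}.

(* Polynomials serve as formal finite combinations of a sequence. *)
Definition pcomb {W : lmodType R} (v : nat -> W) (p : {poly R}) : W :=
  \sum_(i < size p) p`_i *: v i.

Lemma pcombE {W : lmodType R} (v : nat -> W) n (p : {poly R}) :
  (size p <= n)%N -> pcomb v p = \sum_(i < n) p`_i *: v i.
Proof.
move=> pn; rewrite /pcomb -!(big_mkord xpredT (fun i => p`_i *: v i)).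
rewrite [RHS](big_cat_nat (n := size p))//= [X in _ = _ + X]big_nat_cond.
rewrite [X in _ = _ + X]big1 ?addr0// => i /andP[/andP[ip _] _].
by rewrite nth_default// scale0r.
Qed.

Lemma pcombDZ {W : lmodType R} (v : nat -> W) a (p q : {poly R}) :
  pcomb v (a *: p + q) = a *: pcomb v p + pcomb v q.
Proof.
pose n := maxn (size (a *: p + q)) (maxn (size p) (size q)).
rewrite !(@pcombE _ _ n) ?leq_max ?leqnn ?orbT//.
rewrite scaler_sumr -big_split; apply: eq_bigr => i _ /=.
by rewrite coefD coefZ scalerDl scalerA.
Qed.

Lemma pcombZX {W : lmodType R} (v : nat -> W) a i : pcomb v (a *: 'X^i) = a *: v i.
Proof.
rewrite (@pcombE _ _ i.+1) ?(leq_trans (size_scale_leq _ _)) ?size_polyXn//.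
rewrite big_ord_recr/= big1 ?add0r; last first.
  by move=> j _; rewrite coefZ coefXn ltn_eqF ?ltn_ord// mulr0 scale0r.
by rewrite coefZ coefXn eqxx mulr1.
Qed.

Lemma pcomb_sum {W : lmodType R} (v : nat -> W) (I : finType) (c : I -> R) (s : I -> nat) :
  pcomb v (\sum_i c i *: 'X^(s i)) = \sum_i c i *: v (s i).
Proof.
have p0 : pcomb v 0 = 0 by rewrite /pcomb size_poly0 big_ord0.
transitivity (\sum_i pcomb v (c i *: 'X^(s i))); last first.
  by apply: eq_bigr => i _; rewrite pcombZX.
elim/big_rec2: _ => // i q1 q2 _ <-.
by have := pcombDZ v 1 (c i *: 'X^(s i)) q2; rewrite !scale1r.
Qed.

Definition plin (w : nat -> R) : {poly R} -> R := pcomb (W := R^o) w.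

Lemma plinDZ w a p q : plin w (a *: p + q) = a * plin w p + plin w q.
Proof. exact: pcombDZ. Qed.

Lemma plinE w p : plin w p = \sum_(i < size p) p`_i * w i. Proof. by []. Qed.

Lemma plin_sum w (I : finType) (c : I -> R) (s : I -> nat) :
  plin w (\sum_i c i *: 'X^(s i)) = \sum_i c i * w (s i).
Proof. exact: pcomb_sum. Qed.

Definition pker (K : nat -> nat -> R) (p q : {poly R}) :=
  plin (fun i => plin (K i) q) p.

Lemma pkerE K p q :
  pker K p q = \sum_(i < size p) \sum_(j < size q) p`_i * q`_j * K i j.
Proof.
rewrite /pker plinE; apply: eq_bigr => i _; rewrite plinE mulr_sumr.
by apply: eq_bigr => j _; rewrite mulrA.
Qed.

Lemma pker_sum K (I : finType) (c : I -> R) (s : I -> nat) :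
  pker K (\sum_i c i *: 'X^(s i)) (\sum_i c i *: 'X^(s i)) =
  \sum_i \sum_j c i * c j * K (s i) (s j).
Proof.
rewrite /pker plin_sum; apply: eq_bigr => i _; rewrite plin_sum mulr_sumr.
by apply: eq_bigr => j _; rewrite mulrA.
Qed.

Lemma pker_semi_inner K : (forall i j, K i j = K j i) ->
  (forall p, 0 <= pker K p p) -> semi_inner (pker K).
Proof.
move=> Ksym K0; split=> // [p q|a p q r]; last exact: plinDZ.
rewrite !pkerE exchange_big; apply: eq_bigr => i _; apply: eq_bigr => j _.
by rewrite Ksym; ring.
Qed.

Lemma pcomb_ip {W : lmodType R} (ip : W -> W -> R) (v : nat -> W) p q :
  semi_inner ip -> ip (pcomb v p) (pcomb v q) = pker (fun i j => ip (v i) (v j)) p q.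
Proof.
move=> sip; rewrite pkerE /pcomb (sip_suml sip); apply: eq_bigr => i _.
rewrite (sip_sumr sip); apply: eq_bigr => j _.
by rewrite (sipZl sip) (sipZr sip); ring.
Qed.

End polynomial_combinations.

Section exponential_kernel.
Context {R : realType} {H : lmodType R} {ip : H -> H -> R}.
Hypothesis sip : semi_inner ip.

Definition expker (x : nat -> H) i j := expR (ip (x i) (x j)).

Lemma qf_cvg (I : finType) (x : I -> H) (c : I -> R) (e : nat -> H) (K : I -> I -> R)
  (t : nat -> R) :
  (forall i j, (fun n => \sum_(k < n) t k * (ip (x i) (e k) * ip (x j) (e k))) @ \oo --> K i j) ->
  qf (fun i k => ip (x i) (e k)) t n c @[n --> \oo] --> \sum_i \sum_j c i * c j * expR (K i j).
Proof.
move=> HK; apply: cvg_bigsum => i _; apply: cvg_bigsum => j _.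
apply: cvgM; first exact: cvg_cst.
under eq_fun do rewrite -expR_sum.
by apply: continuous_cvg; [exact: continuous_expR|exact: HK].
Qed.

Lemma cvg_qf_bound (u : nat -> R) (l : R) n : nondecreasing_seq u -> u @ \oo --> l -> u n <= l.
Proof.
move=> nu ul; apply: (ler_cvg_to (cvg_cst _) ul).
by exists n => // m /= nm; exact: nu.
Qed.

Section basis.
Variables (D : set nat) (e : nat -> H).
Hypotheses (oe : ortho_fam (ip := ip) D e) (pe : parseval_fam (ip := ip) e).

Lemma qf1_cvg (I : finType) (x : I -> H) (c : I -> R) :
  qf (fun i k => ip (x i) (e k)) (fun=> 1) n c @[n --> \oo] -->
    \sum_i \sum_j c i * c j * expR (ip (x i) (x j)).
Proof.
apply: qf_cvg => i j; under eq_fun do under eq_bigr do rewrite mul1r.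
exact: (parseval_ip sip oe).
Qed.

Lemma qf1_le (I : finType) (x : I -> H) (c : I -> R) n :
  qf (fun i k => ip (x i) (e k)) (fun=> 1) n c <=
    \sum_i \sum_j c i * c j * expR (ip (x i) (x j)).
Proof.
apply: (cvg_qf_bound (u := (qf (fun i k => ip (x i) (e k)) (fun=> 1))^~ c)).
  exact: qf_nondecreasing.
exact: qf1_cvg.
Qed.

Lemma expker_ge0 (x : nat -> H) p : 0 <= pker (expker x) p p.
Proof.
rewrite pkerE; apply: le_trans (qf1_le (fun i : 'I_(size p) => x i) _ 0).
by apply: qf_ge0.
Qed.

Lemma expker_semi_inner (x : nat -> H) : semi_inner (pker (expker x)).
Proof.
by apply: pker_semi_inner => [i j|p]; [rewrite /expker (sipC sip)|exact: expker_ge0].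
Qed.

Lemma expker_linear_le (x : nat -> H) p :
  ip (pcomb x p) (pcomb x p) <= pker (expker x) p p.
Proof.
have H1 := @pe (pcomb x p); apply: (ler_cvg_to H1 (cvg_cst (pker (expker x) p p))).
apply: nearW => n; rewrite pkerE.
apply: le_trans (qf1_le (fun i : 'I_(size p) => x i) _ n).
apply: le_trans (qf_linear_le _ _ n _ _) => //.
rewrite le_eqVlt; apply/orP; left; apply/eqP; apply: eq_bigr => k _.
by rewrite (sip_suml sip); under eq_bigr do rewrite (sipZl sip).
Qed.

(** Normalized so that, in finitely many coordinates, exp(<x, y>) is the sum over [a] of
    [monomial a N x] times [monomial a N y]. *)
Definition monomial (a : nat -> nat) N (x : H) :=
  \prod_(k < N) (ip x (e k) ^+ a k / Num.sqrt (a k)`!%:R).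

Lemma expker_monomial_le (x : nat -> H) a N p :
  plin (fun i => monomial a N (x i)) p ^+ 2 <= pker (expker x) p p.
Proof.
rewrite pkerE plinE; apply: le_trans (qf1_le (fun i : 'I_(size p) => x i) _ N).
by apply: (qf_monomial_le (fun (i : 'I_(size p)) k => ip (x i) (e k))).
Qed.

End basis.
End exponential_kernel.

(** * Finite differences, used to isolate monomials by combinations of exponentials *)

Section finite_differences.
Context {R : realType}.

(** The n-th forward difference of [f] at 0. *)
Fixpoint fdiff n (f : nat -> R) : R :=
  if n is m.+1 then fdiff m (fun r => f r.+1 - f r) else f 0%N.

Lemma fdiff_coef n : exists c : nat -> R, forall f,
  fdiff n f = \sum_(r < n.+1) c r * f r.
Proof.
elim: n => [|n [c IH]]; first by exists (fun=> 1) => f; rewrite big_ord1 mul1r.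
exists (fun r => (if r is r'.+1 then c r' else 0) - (if (r <= n)%N then c r else 0)) => f.
rewrite /= IH /=; under [RHS]eq_bigr do rewrite mulrBl.
under [LHS]eq_bigr do rewrite mulrBr.
rewrite !sumrB; congr (_ - _).
  by rewrite [RHS]big_ord_recl mul0r add0r.
rewrite [RHS]big_ord_recr/= ltnn mul0r addr0.
by apply: eq_bigr => i _; rewrite -ltnS ltn_ord.
Qed.

Lemma eq_fdiff n f g : f =1 g -> fdiff n f = fdiff n g.
Proof. by move=> /funext ->. Qed.

Lemma fdiff_sum n M (a : nat -> R) (f : nat -> nat -> R) :
  fdiff n (fun r => \sum_(i < M) a i * f i r) = \sum_(i < M) a i * fdiff n (f i).
Proof.
elim: n f => //= n IH f; rewrite -(IH (fun i r => f i r.+1 - f i r)).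
by apply: eq_fdiff => r; rewrite -sumrB; apply: eq_bigr => i _; rewrite mulrBr.
Qed.

Lemma fdiff_exp n x : fdiff n (fun r => expR (r%:R * x)) = (expR x - 1) ^+ n.
Proof.
have H a m : fdiff m (fun r => a * expR (r%:R * x)) = a * (expR x - 1) ^+ m.
  elim: m a => [|m IH] a /=; first by rewrite mul0r expR0 expr0.
  rewrite (eq_fdiff _ (g := fun r => (a * (expR x - 1)) * expR (r%:R * x))).
    by rewrite IH exprS mulrA.
  by move=> r; rewrite -natr1 mulrDl mul1r expRD; ring.
by rewrite -[RHS]mul1r -H; apply: eq_fdiff => r; rewrite mul1r.
Qed.

(** One difference turns r^(m+1) into a polynomial of degree m with leading coefficient m + 1, by
    the binomial formula. *)
Lemma fdiff_pow n m : (m <= n)%N ->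
  fdiff n (fun r => r%:R ^+ m) = if m == n then n`!%:R else 0.
Proof.
elim: n m => [|n IH] m; first by rewrite leqn0 => /eqP ->; rewrite /= fact0 expr0.
move=> mn /=; case: m mn => [_|m mn].
  rewrite (eq_fdiff _ (g := fun r => \sum_(i < 0) 0 * (fun=> 0) r)).
    by rewrite (fdiff_sum n 0 (fun=> 0) (fun _ _ => 0)) big_ord0.
  by move=> r; rewrite big_ord0 !expr0 subrr.
rewrite (eq_fdiff _ (g := fun r => \sum_(i < m.+1) 'C(m.+1, i)%:R * r%:R ^+ i)).
  rewrite (fdiff_sum n m.+1 (fun i => 'C(m.+1, i)%:R) (fun i r => r%:R ^+ i)).
  rewrite big_ord_recr/= big1 => [|i _]; last first.
    by rewrite IH ?(leq_trans (ltnW (ltn_ord i)))// ltn_eqF ?mulr0// (leq_trans (ltn_ord i)).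
  rewrite add0r IH// eqSS binSn; case: eqP => [->|_]; last by rewrite mulr0.
  by rewrite factS natrM.
move=> r; rewrite -natr1 [r%:R + 1]addrC exprDn big_ord_recr/=.
rewrite binn subnn expr0 mul1r mulr1n addrK.
by apply: eq_bigr => i _; rewrite expr1n mul1r mulr_natl.
Qed.

(** With tau = 1/(m+1)^2, the quotient lies between r and r e^(r tau). *)
Lemma expR_diff_cvg r : (fun m => (expR (r%:R * m.+1%:R^-1 ^+ 2) - 1) / m.+1%:R^-1 ^+ 2)
  @ \oo --> (r%:R : R).
Proof.
have tau0 : (fun m => m.+1%:R^-1 ^+ 2) @ \oo --> (0 : R).
  by rewrite -[0](mulr0 0); under eq_fun do rewrite expr2; apply: cvgM; exact: cvg_harmonic.
have ex : (fun m => r%:R * expR (r%:R * m.+1%:R^-1 ^+ 2)) @ \oo --> (r%:R : R).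
  rewrite -[X in _ --> X]mulr1; apply: cvgM; first exact: cvg_cst.
  have H0 : (fun m => r%:R * m.+1%:R^-1 ^+ 2) @ \oo --> (r%:R * 0 : R).
    by apply: cvgM => //; exact: cvg_cst.
  have := continuous_cvg _ (@continuous_expR R _) H0.
  by rewrite mulr0 expR0; apply.
apply: squeeze_cvgr ex; [|exact: (@cvg_cst R)].
apply: nearW => m; set tau := m.+1%:R^-1 ^+ 2.
have t0 : 0 < tau by rewrite exprn_gt0// invr_gt0.
rewrite ler_pdivlMr// ler_pdivrMr//; apply/andP; split.
  by rewrite lerBrDl expR_ge1Dx.
have := expR_ge1Dx (- (r%:R * tau)); rewrite expRN => H.
have e0 := expR_gt0 (r%:R * tau).
move: H; rewrite -(ler_pM2l e0) divff ?gt_eqF// mulrDr mulr1 => H.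
have -> : r%:R * expR (r%:R * tau) * tau = expR (r%:R * tau) * (r%:R * tau).
  by rewrite (mulrC r%:R) -mulrA.
move: H.
by set E := expR _; set q := r%:R * tau; lra.
Qed.

End finite_differences.

Section density.
Context {R : realType} {H : lmodType R} {ip : H -> H -> R}.
Hypothesis sip : semi_inner ip.

Lemma cvg_ipD u v x y : cvg_ip ip u x -> cvg_ip ip v y ->
  cvg_ip ip (fun n => u n + v n) (x + y).
Proof.
move=> ux vy; rewrite /cvg_ip.
apply: (squeeze_cvgr (f := cst 0) (h := fun n =>
  2 * ip (u n - x) (u n - x) + 2 * ip (v n - y) (v n - y))).
- apply: nearW => n; rewrite (sip_ge0 sip)/= opprD addrACA; exact: (sip_leD sip).
- exact: cvg_cst.
- rewrite -[X in _ --> X](addr0 (0 : R)) -{1}(mulr0 2) -{2}(mulr0 2).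
  by apply: cvgD; apply: cvgM => //; exact: cvg_cst.
Qed.

Lemma cvg_ip2 u v x y : cvg_ip ip u x -> cvg_ip ip v y ->
  ip (u n) (v n) @[n --> \oo] --> ip x y.
Proof.
move=> ux vy.
have E a b : ip a b = (ip (a + b) (a + b) - ip a a - ip b b) / 2.
  by rewrite (sip_sqD sip); field.
rewrite E; under eq_fun do rewrite E.
apply: cvgM; last exact: cvg_cst.
apply: cvgB; last exact: (sip_cvg_sq sip vy).
apply: cvgB; last exact: (sip_cvg_sq sip ux).
exact: (sip_cvg_sq sip (cvg_ipD ux vy)).
Qed.

Variable h : nat -> H.
Hypothesis hdense : forall x (eps : R), 0 < eps -> exists n, ip (x - h n) (x - h n) < eps.

Lemma dense_seq x : exists s : nat -> nat, cvg_ip ip (fun n => h (s n)) x.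
Proof.
have H1 n : exists k, ip (x - h k) (x - h k) < n.+1%:R^-1.
  by apply: hdense; rewrite invr_gt0.
exists (fun n => projT1 (cid (H1 n))); rewrite /cvg_ip.
apply: (squeeze_cvgr (f := cst 0) (h := fun n => n.+1%:R^-1)).
- apply: nearW => n; rewrite (sip_ge0 sip)/=; case: cid => k /= Hk.
  by rewrite (sip_sqBC sip) ltW.
- exact: cvg_cst.
- exact: cvg_harmonic.
Qed.

(** The bound on [om] is known on combinations of the points [h i], while the test points for lower
    bounds are combinations of basis vectors or multiples of a given vector. Density and continuity
    carry the bound to them. *)
Lemma functional_extend (om : H -> R) (S : R) :
  (forall u x, cvg_ip ip u x -> om (u n) @[n --> \oo] --> om x) ->
  (forall p, plin (fun i => om (h i)) p ^+ 2 <= S * pker (expker (ip := ip) h) p p) ->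
  forall (I : finType) (c : I -> R) (x : I -> H),
  (\sum_i c i * om (x i)) ^+ 2 <=
    S * \sum_i \sum_j c i * c j * expR (ip (x i) (x j)).
Proof.
move=> omc HS I c x.
pose s n i := projT1 (cid (dense_seq (x i))) n.
have sx i : cvg_ip ip (fun n => h (s n i)) (x i) by rewrite /s; case: cid.
have L : (fun n => (\sum_i c i * om (h (s n i))) ^+ 2) @ \oo --> (\sum_i c i * om (x i)) ^+ 2.
  have L0 : (fun n => (\sum_i c i * om (h (s n i)))) @ \oo --> (\sum_i c i * om (x i)).
    apply: cvg_bigsum => i _; apply: cvgM; [exact: cvg_cst|].
    exact: (omc (fun n => h (s n i))).
  by rewrite expr2; under eq_fun do rewrite expr2; exact: cvgM.
have Q : (fun n => S * \sum_i \sum_j c i * c j * expR (ip (h (s n i)) (h (s n j)))) @ \oo -->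
    S * \sum_i \sum_j c i * c j * expR (ip (x i) (x j)).
  apply: cvgM; [exact: cvg_cst|]; apply: cvg_bigsum => i _; apply: cvg_bigsum => j _.
  apply: cvgM; [exact: cvg_cst|].
  apply: continuous_cvg; first exact: continuous_expR.
  exact: (cvg_ip2 (sx i) (sx j)).
apply: (ler_cvg_to L Q); apply: nearW => n.
have := HS (\sum_i c i *: 'X^(s n i)); rewrite plin_sum pker_sum.
by [].
Qed.

End density.

Section monomial_norm.
Context {R : realType} {H : lmodType R} {ip : H -> H -> R}.
Hypothesis sip : semi_inner ip.
Variables (D : set nat) (e : nat -> H).
Hypotheses (oe : ortho_fam (ip := ip) D e).

Definition fdc n : nat -> R := projT1 (cid (fdiff_coef n)).

Lemma fdcP n f : fdiff n f = \sum_(r < n.+1) fdc n r * f r.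
Proof. by rewrite /fdc; case: cid. Qed.

(** The n-th difference with step [d], scaled so that it takes the value 1 on the function x^n /
    sqrt(n!). *)
Definition fdn (d : R) n r := fdc n r / (d ^+ n * Num.sqrt n`!%:R).

(** The squared kernel norm of the combination with coefficients [fdn d n r] of the exponentials at
    r d e, for a unit vector e. *)
Definition fdE (d : R) n := \sum_(r < n.+1) \sum_(s < n.+1)
  fdn d n r * fdn d n s * expR (r%:R * s%:R * d ^+ 2).

Lemma sqrt_fact n : Num.sqrt n`!%:R != 0 :> R.
Proof. by rewrite sqrtr_eq0 -ltNge ltr0n fact_gt0. Qed.

(** For fixed r the sum over s is the n-th difference of e^(r s d^2), that is (e^(r d^2) - 1)^n.
    Divided by d^(2n) it tends to r^n, and the remaining difference of r^n is n!. *)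
Lemma fdE_cvg n : fdE m.+1%:R^-1 n @[m --> \oo] --> (1 : R).
Proof.
have -> : (fun m => fdE m.+1%:R^-1 n) = (fun m => (\sum_(r < n.+1)
    fdc n r * ((expR (r%:R * m.+1%:R^-1 ^+ 2) - 1) / m.+1%:R^-1 ^+ 2) ^+ n) / n`!%:R).
  apply/funext => m; rewrite /fdE; set d := m.+1%:R^-1.
  have d0 : d != 0 by rewrite invr_eq0 pnatr_eq0.
  rewrite mulr_suml; apply: eq_bigr => r _.
  rewrite expr_div_n -fdiff_exp fdcP mulr_suml mulr_sumr mulr_suml.
  apply: eq_bigr => s _; rewrite /fdn.
  rewrite [s%:R * (r%:R * _)]mulrA [s%:R * r%:R]mulrC.
  have Hq : n`!%:R = Num.sqrt n`!%:R ^+ 2 :> R by rewrite sqr_sqrtr.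
  move: (sqrt_fact n) Hq; set q := Num.sqrt _ => q0 ->.
  by rewrite -exprM mulnC exprM; field; rewrite q0 expf_neq0.
rewrite [X in _ --> X](_ : _ = (\sum_(r < n.+1) fdc n r * r%:R ^+ n) / n`!%:R); last first.
  by rewrite -(fdcP n (fun r => r%:R ^+ n)) fdiff_pow// eqxx divff// pnatr_eq0 -lt0n fact_gt0.
apply: cvgM; last exact: cvg_cst.
apply: cvg_bigsum => r _; apply: cvgM; first exact: cvg_cst.
by apply: cvg_exprn; exact: expR_diff_cvg.
Qed.

(** The test combination for the dual norm of a monomial: a tensor product of one-dimensional
    differences, built one coordinate at a time by adding multiples of [e N] to the earlier
    points. *)
Lemma monomial_family (a : nat -> nat) (d : R) N : d != 0 ->
  (forall k, (k < N)%N -> ~ D k -> a k = 0%N) ->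
  exists (I : finType) (c : I -> R) (x : I -> H),
  [/\ forall i k, (N <= k)%N -> ip (x i) (e k) = 0,
      \sum_i c i * monomial (ip := ip) e a N (x i) = 1 &
      \sum_i \sum_j c i * c j * expR (ip (x i) (x j)) = \prod_(k < N) fdE d (a k)].
Proof.
move=> d0; elim: N => [|N IH] aD.
  exists unit, (fun=> 1), (fun=> 0); split=> [i k _||]; first exact: (sip0l sip).
    by rewrite (big_pred1 tt) ?mul1r; [rewrite /monomial big_ord0|case].
  rewrite (big_pred1 tt); last by case.
  rewrite (big_pred1 tt); last by case.
  by rewrite big_ord0 (sip0l sip) expR0 !mulr1.
have [|I [c [x [x0 x1 xx]]]] := IH; first by move=> k kN; apply: aD; exact: ltnW.
set n := a N.
(* Either [e N] is a unit vector, or the exponent is 0; in that case the only new index is r = 0 and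
   the points do not move. *)
have en : ip (e N) (e N) = 1 \/ n = 0%N.
  have [DN|nDN] := pselect (D N); [left|right; exact: aD].
  by rewrite oe.1 eqxx asboolT.
exists (I * 'I_n.+1)%type, (fun u : I * 'I_n.+1 => c u.1 * fdn d n u.2),
  (fun u : I * 'I_n.+1 => x u.1 + (u.2%:R * d) *: e N); split=> [[i r] k Nk /=||].
- rewrite (sipDl sip) (sipZl sip) x0 ?(ltnW Nk)// add0r oe.1 ltn_eqF// mulr0//.
- have M (u : I * 'I_n.+1) : monomial (ip := ip) e a N.+1 (x u.1 + (u.2%:R * d) *: e N) =
      monomial (ip := ip) e a N (x u.1) * (u.2%:R ^+ n * (d ^+ n / Num.sqrt n`!%:R)) :> R.
    rewrite /monomial big_ord_recr/=; congr (_ * _).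
      apply: eq_bigr => k _; rewrite (sipDl sip) (sipZl sip) oe.1.
      by rewrite gtn_eqF ?ltn_ord//= mulr0 addr0.
    rewrite (sipDl sip) (sipZl sip) x0// add0r -/n.
    move: (nat_of_ord u.2) => r.
    by case: en => [->|->]; [rewrite mulr1 exprMn mulrA|rewrite !expr0 !mul1r].
  under eq_bigr do rewrite M.
  rewrite -(pair_bigA _ (fun i (r : 'I_n.+1) => c i * fdn d n r *
     (monomial (ip := ip) e a N (x i) * (r%:R ^+ n * (d ^+ n / Num.sqrt n`!%:R)))))/=.
  rewrite -[RHS]x1; apply: eq_bigr => i _.
  transitivity (c i * monomial (ip := ip) e a N (x i) *
     ((\sum_(r < n.+1) fdc n r * r%:R ^+ n) / n`!%:R)).
    rewrite mulr_suml mulr_sumr; apply: eq_bigr => r _; rewrite /fdn.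
    have Hq : n`!%:R = Num.sqrt n`!%:R ^+ 2 :> R by rewrite sqr_sqrtr.
    move: (sqrt_fact n) Hq; set q := Num.sqrt _ => q0 ->.
    by field; rewrite q0 expf_neq0.
  rewrite -(fdcP n (fun r => r%:R ^+ n)) fdiff_pow// eqxx.
  have fn0 : n`!%:R != 0 :> R by rewrite pnatr_eq0 -lt0n fact_gt0.
  by rewrite (divff fn0) mulr1.
- rewrite big_ord_recr/= -xx -/n.
  have M (u v : I * 'I_n.+1) : expR (ip (x u.1 + (u.2%:R * d) *: e N) (x v.1 + (v.2%:R * d) *: e N)) =
    expR (ip (x u.1) (x v.1)) * expR (u.2%:R * v.2%:R * d ^+ 2) :> R.
    rewrite -expRD; congr expR; rewrite (sipDl sip) !(sipDr sip) !(sipZl sip) !(sipZr sip).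
    rewrite (sipC sip (e N)) !x0// !mulr0 addr0 add0r; congr (_ + _).
    case: en => [->|n0]; first by ring.
    have u0 : (u.2 <= 0)%N by rewrite -[X in (_ <= X)%N]n0 -ltnS ltn_ord.
    by move: u0; rewrite leqn0 => /eqP ->; rewrite !mul0r.
  transitivity (\sum_(u : I * 'I_n.+1) \sum_(v : I * 'I_n.+1) (c u.1 * c v.1 * expR (ip (x u.1) (x v.1))) *
     (fdn d n u.2 * fdn d n v.2 * expR (u.2%:R * v.2%:R * d ^+ 2))).
    by apply: eq_bigr => u _; apply: eq_bigr => v _; rewrite M; ring.
  rewrite -(pair_bigA _ (fun i (r : 'I_n.+1) => \sum_(v : I * 'I_n.+1) (c i * c v.1 * expR (ip (x i) (x v.1))) *
     (fdn d n r * fdn d n v.2 * expR (r%:R * v.2%:R * d ^+ 2))))/=.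
  rewrite mulr_suml; apply: eq_bigr => i _.
  under eq_bigr => r _.
    rewrite -(pair_bigA _ (fun j (s : 'I_n.+1) => (c i * c j * expR (ip (x i) (x j))) *
      (fdn d n r * fdn d n s * expR (r%:R * s%:R * d ^+ 2))))/=.
    over.
  rewrite exchange_big/= mulr_suml; apply: eq_bigr => j _.
  rewrite /fdE mulr_sumr; apply: eq_bigr => r _.
  by rewrite mulr_sumr.
Qed.

End monomial_norm.

(** * Traces relative to the exponential kernel *)

Section kernel_traces.
Context {R : realType} {H : lmodType R} {ip : H -> H -> R}.
Hypothesis sip : semi_inner ip.
Variables (D : set nat) (e : nat -> H).
Hypotheses (oe : ortho_fam (ip := ip) D e) (pe : parseval_fam (ip := ip) e).
Variable h : nat -> H.
Hypothesis hdense : forall x (eps : R), 0 < eps -> exists n, ip (x - h n) (x - h n) < eps.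
Variables (Db : set nat) (b : nat -> {poly R}).
Let ipK := pker (expker (ip := ip) h).
Hypotheses (ob : ortho_fam (ip := ipK) Db b) (pb : parseval_fam (ip := ipK) b).

Let sipK : semi_inner ipK := expker_semi_inner sip oe pe h.

Lemma monomial_cvg a N u x : cvg_ip ip u x ->
  monomial (ip := ip) e a N (u n) @[n --> \oo] --> monomial (ip := ip) e a N x.
Proof.
move=> ux; elim: N => [|N IH]; rewrite /monomial.
  by under eq_fun do rewrite big_ord0; rewrite big_ord0; exact: cvg_cst.
under eq_fun do rewrite big_ord_recr/=; rewrite big_ord_recr/=.
apply: cvgM; first exact: IH.
apply: cvgM; last exact: cvg_cst.
by apply: cvg_exprn; exact: (@sip_cvg _ _ _ sip _ _ ux).
Qed.

Lemma ereal_sum_fin (f : nat -> R) (B : R) : (forall i, 0 <= f i) ->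
  (forall n, \sum_(i < n) f i <= B) ->
  exists S : R, [/\ (\sum_(0 <= k <oo) (f k)%:E = S%:E)%E,
    forall n, \sum_(i < n) f i <= S & S <= B].
Proof.
move=> f0 fB; have leB := ereal_sum_le f0 fB.
have fin : (\sum_(0 <= k <oo) (f k)%:E \is a fin_num)%E.
  rewrite ge0_fin_numE; last by apply: nneseries_ge0 => k _ _; rewrite lee_fin.
  by apply: (le_lt_trans leB); exact: ltry.
exists (fine (\sum_(0 <= k <oo) (f k)%:E)%E); rewrite fineK//; split=> //.
  by apply: ereal_nneg_sum_le => //; rewrite fineK.
by rewrite -lee_fin fineK.
Qed.

(** The sum is the squared dual norm of the monomial functional. It is at most 1 by
    [expker_monomial_le]; on the families of [monomial_family] the functional is 1 while their
    kernel norm tends to 1. *)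
Lemma trace_monomial a N : (forall k, (k < N)%N -> ~ D k -> a k = 0%N) ->
  (\sum_(0 <= k <oo) (plin (fun i => monomial (ip := ip) e a N (h i)) (b k) ^+ 2)%:E = 1)%E.
Proof.
move=> aD; set phi := plin _.
have phiN p : phi p ^+ 2 <= 1 * ipK p p.
  by rewrite mul1r; exact: (expker_monomial_le sip oe pe).
have f1 n : \sum_(i < n) phi (b i) ^+ 2 <= 1.
  by apply: (functional_bessel sipK ob (plinDZ _) phiN).
have f0 k : 0 <= phi (b k) ^+ 2 by exact: sqr_ge0.
have [S [-> HS S1]] := ereal_sum_fin f0 f1.
congr EFin; apply/eqP; rewrite eq_le S1 /=.
have SN := functional_parseval sipK ob (plinDZ _) phiN pb HS.
have Sm m : 1 <= S * \prod_(k < N) fdE m.+1%:R^-1 (a k).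
  have d0 : m.+1%:R^-1 != 0 :> R by rewrite invr_eq0 pnatr_eq0.
  have [I [c [x [_ x1 <-]]]] := monomial_family sip oe d0 aD.
  have omc u y : cvg_ip ip u y -> monomial (ip := ip) e a N (u n) @[n --> \oo] -->
      monomial (ip := ip) e a N y by exact: monomial_cvg.
  by have := functional_extend sip hdense omc SN c x; rewrite x1 expr1n.
have L : (fun m => S * \prod_(k < N) fdE m.+1%:R^-1 (a k)) @ \oo --> S * 1.
  apply: cvgM; first exact: cvg_cst.
  elim: {Sm aD phi phiN f1 f0 HS SN}N => [|n IH].
    by under eq_fun do rewrite big_ord0; exact: cvg_cst.
  under eq_fun do rewrite big_ord_recr/=.
  by have := cvgM IH (fdE_cvg (R := R) (a n)); rewrite mulr1; apply.
suff : 1 <= S * 1 by rewrite mulr1.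
by apply: (ler_cvg_to (cvg_cst (1 : R)) L); exact: nearW.
Qed.

Section diagonal.
Variable t : nat -> R.
Hypotheses (t0 : forall k, 0 <= t k) (tD : forall k, ~ D k -> t k = 0).

(** Kept as an extended real product of series: a factor with [t m >= 1] is +oo, which later
    excludes such eigenvalues. *)
Fixpoint geom_prod n : \bar R :=
  if n is m.+1 then ((\sum_(0 <= j <oo) (t m ^+ j)%:E) * geom_prod m)%E else 1%E.

Lemma geom_series_ge0 m : (0 <= \sum_(0 <= j <oo) (t m ^+ j)%:E)%E.
Proof. by apply: nneseries_ge0 => j _ _; rewrite lee_fin exprn_ge0. Qed.

Lemma geom_prod_ge0 n : (0 <= geom_prod n)%E.
Proof. by elim: n => //= n IH; rewrite mule_ge0// geom_series_ge0. Qed.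

Definition tail_monomial (a : nat -> nat) n N x :=
  \prod_(n <= k < N) (ip x (e k) ^+ a k / Num.sqrt (a k)`!%:R).

(** The weights [w] hold the monomial part already split off from the coordinates beyond [n]. *)
Definition qfp n (p : {poly R}) (w : nat -> R) :=
  qf (fun (i : 'I_(size p)) k => ip (h i) (e k)) t n (fun i => p`_i * w i).

Lemma qfp_ge0 n p w : 0 <= qfp n p w. Proof. exact: qf_ge0. Qed.

Lemma qfp_series n p w : (\sum_(0 <= m <oo) ((t n ^+ m)%:E *
  (qfp n p (fun i => w i * (ip (h i) (e n) ^+ m / Num.sqrt m`!%:R)))%:E) =
  (qfp n.+1 p w)%:E)%E.
Proof.
rewrite /qfp -qf_series//; apply: eq_eseriesr => m _; rewrite -EFinM; congr EFin.
rewrite -mulrA; congr (_ * _); rewrite /qf mulr_sumr; apply: eq_bigr => i _.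
rewrite mulr_sumr; apply: eq_bigr => j _.
have Hq : m`!%:R = Num.sqrt m`!%:R ^+ 2 :> R by rewrite sqr_sqrtr.
move: (@sqrt_fact R m) Hq; set q := Num.sqrt _ => q0 ->.
by field.
Qed.

(** The tail monomial is what the induction needs: expanding coordinate [n] moves a power of it into
    the tail and leaves a factor t_n^m. At n = 0 only a monomial remains, of trace 1; summing over m
    gives the geometric series. *)
Lemma trace_qf_tail n N a : (n <= N)%N ->
  (forall k, (n <= k < N)%N -> ~ D k -> a k = 0%N) ->
  (\sum_(0 <= k <oo) (qfp n (b k) (fun i => tail_monomial a n N (h i)))%:E = geom_prod n)%E.
Proof.
elim: n a => [|n IH] a nN aD.
  rewrite -[RHS](trace_monomial (a := a) (N := N)) => [|k kN]; last by apply: aD.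
  apply: eq_eseriesr => k _; congr EFin; rewrite /qfp qf0 plinE.
  by congr (_ ^+ 2); apply: eq_bigr => i _; rewrite /tail_monomial /monomial big_mkord.
under eq_eseriesr do rewrite -qfp_series.
rewrite nneseries_interchange; last first.
  by move=> i j; rewrite -EFinM lee_fin mulr_ge0 ?qfp_ge0// exprn_ge0.
have step m : (\sum_(0 <= k <oo) ((t n ^+ m)%:E * (qfp n (b k) (fun i =>
    tail_monomial a n.+1 N (h i) * (ip (h i) (e n) ^+ m / Num.sqrt m`!%:R)))%:E) =
    (t n ^+ m)%:E * geom_prod n)%E.
  have tm : (0 <= (t n ^+ m)%:E)%E by rewrite lee_fin exprn_ge0.
  rewrite nneseriesZl; last by move=> k _; rewrite lee_fin qfp_ge0.
  (* For [n] outside [D] and m > 0 the factor [t n ^+ m] is 0, so the induction hypothesis is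
     applied only to exponents supported in [D]. *)
  have [Dn|nDn] := pselect (D n \/ m = 0%N); last first.
    have -> : t n ^+ m = 0.
      rewrite tD ?expr0n; last by move=> Dn; apply: nDn; left.
      by case: eqP => // m0; exfalso; apply: nDn; right.
    by rewrite !mul0e.
  congr (_ * _)%E; pose a' k := if k == n then m else a k.
  rewrite -(IH a' (ltnW nN)).
    apply: eq_eseriesr => k _; congr EFin; congr qfp; apply/funext => i.
    rewrite /tail_monomial [RHS]big_ltn// /a' eqxx mulrC; congr (_ * _).
    by apply: eq_big_nat => j /andP[nj _]; rewrite gtn_eqF.
  move=> k /andP[nk kN] nDk; rewrite /a'; case: eqP => [kn|kn].
    by case: Dn => // Dn; exfalso; apply: nDk; rewrite kn.
  by apply: aD => //; rewrite kN andbT ltn_neqAle eq_sym nk andbT; exact/eqP.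
under eq_eseriesr do rewrite step; rewrite [RHS]/=.
have : (0 <= geom_prod n)%E by exact: geom_prod_ge0.
case: (geom_prod n) => [g||//] g0.
  rewrite muleC -nneseriesZl; last by move=> k _; rewrite lee_fin exprn_ge0.
  by apply: eq_eseriesr => k _; rewrite muleC.
(* If [geom_prod n] is +oo, the term m = 0 alone makes the series infinite. *)
have ge1 (f : nat -> \bar R) : (forall k, 0 <= f k)%E ->
    (f 0%N <= \sum_(0 <= k <oo) f k)%E.
  move=> f0; apply: (@le_trans _ _ (\sum_(0 <= k < 1) f k)%E); first by rewrite big_nat1.
  by apply: nneseries_lim_ge => k _ _.
transitivity (+oo : \bar R)%E.
  apply/eqP; rewrite -leye_eq.
  apply: (le_trans _ (ge1 _ _)) => [|k]; first by rewrite expr0 mul1e.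
  by rewrite mule_ge0// lee_fin exprn_ge0.
rewrite gt0_muley//; apply: lt_le_trans (ge1 (fun k => (t n ^+ k)%:E) _).
  by rewrite expr0 lte_fin.
by move=> k; rewrite lee_fin exprn_ge0.
Qed.

Lemma trace_qf n : (\sum_(0 <= k <oo) (qfp n (b k) (fun=> 1))%:E = geom_prod n)%E.
Proof.
rewrite -(@trace_qf_tail n n (fun=> 0%N))//.
apply: eq_eseriesr => k _; congr EFin; congr qfp; apply/funext => i.
by rewrite /tail_monomial big_geq.
Qed.

Variable kap : nat -> nat -> R.
Hypothesis kapE : forall i j,
  (fun n => \sum_(k < n) t k * (ip (h i) (e k) * ip (h j) (e k))) @ \oo --> kap i j.
Let ipF := pker (fun i j => expR (kap i j)).

Lemma qfp_cvg p : qfp n p (fun=> 1) @[n --> \oo] --> ipF p p.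
Proof.
rewrite /ipF pkerE /qfp (_ : (fun i : 'I_(size p) => p`_i * 1) = (fun i => p`_i)).
  exact: (qf_cvg (x := fun i : 'I_(size p) => h i)).
by apply/funext => i; rewrite mulr1.
Qed.

Lemma qfp_le n p : qfp n p (fun=> 1) <= ipF p p.
Proof.
apply: (cvg_qf_bound (u := fun n => qfp n p (fun=> 1))); last exact: qfp_cvg.
exact: qf_nondecreasing.
Qed.

Lemma trace_ge n : (geom_prod n <= \sum_(0 <= k <oo) (ipF (b k) (b k))%:E)%E.
Proof.
rewrite -trace_qf; apply: lee_nneseries => [k _ _|k _]; rewrite lee_fin.
  exact: qfp_ge0.
exact: qfp_le.
Qed.

(** A partial sum over [k] is finite, so it commutes with the limit in the number of coordinates. *)
Lemma trace_le (B : R) : (forall n, (geom_prod n <= B%:E)%E) ->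
  (\sum_(0 <= k <oo) (ipF (b k) (b k))%:E <= B%:E)%E.
Proof.
move=> HB; apply: ereal_sum_le => [k|K].
  by apply: le_trans (qfp_le 0 _); exact: qfp_ge0.
have L : (fun n => \sum_(k < K) qfp n (b k) (fun=> 1)) @ \oo --> \sum_(k < K) ipF (b k) (b k).
  by apply: cvg_bigsum => k _; exact: qfp_cvg.
apply: (ler_cvg_to L (cvg_cst B)); apply: nearW => n.
apply: (ereal_nneg_sum_le (f := fun k => qfp n (b k) (fun=> 1))) => [k|].
  exact: qfp_ge0.
by rewrite trace_qf.
Qed.

End diagonal.

(** A lower bound for the dual norm of p -> <pcomb h p, g>. The difference quotient of the
    exponentials at d g and 0 takes the value q = <g, g> and has squared kernel norm (e^(d^2 q) - 1)
    / d^2, which tends to q; so q^2 <= S q. *)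
Lemma trace_linear g :
  ((ip g g)%:E <= \sum_(0 <= k <oo) (plin (fun i => ip (h i) g) (b k) ^+ 2)%:E)%E.
Proof.
set phi := plin _.
have phiN p : phi p ^+ 2 <= ip g g * ipK p p.
  have -> : phi p = ip (pcomb h p) g.
    rewrite /phi plinE /pcomb (sip_suml sip); apply: eq_bigr => i _.
    by rewrite (sipZl sip).
  apply: le_trans (sip_CS sip _ _) _; rewrite mulrC ler_wpM2l ?(sip_ge0 sip)//.
  exact: (expker_linear_le sip oe pe).
have f1 n : \sum_(i < n) phi (b i) ^+ 2 <= ip g g.
  by apply: (functional_bessel sipK ob (plinDZ _) phiN); rewrite (sip_ge0 sip).
have f0 k : 0 <= phi (b k) ^+ 2 by exact: sqr_ge0.
have [S [-> HS S1]] := ereal_sum_fin f0 f1.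
have S0 : 0 <= S by apply: le_trans (HS 0%N); rewrite big_ord0.
have SN := functional_parseval sipK ob (plinDZ _) phiN pb HS.
have gc u x : cvg_ip ip u x -> ip (u n) g @[n --> \oo] --> ip x g.
  by move=> ux; exact: (@sip_cvg _ _ _ sip _ _ ux).
have ext := functional_extend sip hdense gc SN.
rewrite lee_fin; set q := ip g g.
have q0 : 0 <= q by exact: (sip_ge0 sip).
have Sm m : q ^+ 2 <= S * ((expR (1%:R * m.+1%:R^-1 ^+ 2 * q) - 1) / m.+1%:R^-1 ^+ 2).
  set d := m.+1%:R^-1.
  have d0 : d != 0 by rewrite invr_eq0 pnatr_eq0.
  have := ext bool (fun i => if i then d^-1 else - d^-1) (fun i => if i then d *: g else 0).
  rewrite !big_bool /= !(sip0l sip) !(sip0r sip) (sipZl sip) (sipZl sip) (sipZr sip) -/q expR0.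
  rewrite (_ : d^-1 * (d * q) + _ = q); last by field.
  move=> /le_trans; apply; rewrite ler_wpM2l//.
  rewrite (_ : d * (d * q) = 1%:R * d ^+ 2 * q); last by ring.
  set E := expR _; rewrite le_eqVlt; apply/orP; left; apply/eqP.
  by field.
move: q0; rewrite le_eqVlt => /predU1P[<-//|q0].
suff : q ^+ 2 <= S * q by rewrite expr2 ler_pM2r.
have tau0 : (fun m => m.+1%:R^-1 ^+ 2 * q) @ \oo --> (0 : R).
  rewrite -(mul0r q); apply: cvgM; last exact: cvg_cst.
  by rewrite -[0](mulr0 0); under eq_fun do rewrite expr2; apply: cvgM; exact: cvg_harmonic.
have L : (fun m => S * (q * expR (m.+1%:R^-1 ^+ 2 * q))) @ \oo --> S * q.
  apply: cvgM; first exact: cvg_cst.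
  rewrite -[X in _ --> X]mulr1; apply: cvgM; first exact: cvg_cst.
  by have := continuous_cvg _ (@continuous_expR R _) tau0; rewrite expR0; apply.
apply: (ler_cvg_to (cvg_cst (q ^+ 2)) L); apply: nearW => m.
apply: le_trans (Sm m) _; rewrite ler_wpM2l// mul1r.
set tau := m.+1%:R^-1 ^+ 2.
have t0 : 0 < tau by rewrite exprn_gt0// invr_gt0.
rewrite ler_pdivrMr//.
have := expR_ge1Dx (- (tau * q)); rewrite expRN => H1.
have e0 := expR_gt0 (tau * q).
move: H1; rewrite -(ler_pM2l e0) divff ?gt_eqF// mulrDr mulr1.
have -> : q * expR (tau * q) * tau = expR (tau * q) * (tau * q).
  by rewrite mulrC mulrA mulrC.
by set E := expR _; set r := tau * q; lra.
Qed.

(** The vectors [U k] are arbitrary: no diagonalization is assumed, so the bound applies before T^*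
    T is known to be compact. Each [U j] contributes one square of the linear part of exp(kap). *)
Lemma trace_hs_ge (U : nat -> H) (kap : nat -> nat -> R) :
  (forall i j, (fun n => \sum_(k < n) ip (h i) (U k) * ip (h j) (U k)) @ \oo --> kap i j) ->
  (\sum_(0 <= k <oo) (ip (U k) (U k))%:E <=
   \sum_(0 <= k <oo) (pker (fun i j => expR (kap i j)) (b k) (b k))%:E)%E.
Proof.
move=> kapE; apply: lime_le.
  by apply: is_cvg_nneseries => k _ _; rewrite lee_fin (sip_ge0 sip).
apply: nearW => n; rewrite big_mkord.
apply: (@le_trans _ _ (\sum_(j < n) \sum_(0 <= k <oo)
    (plin (fun i => ip (h i) (U j)) (b k) ^+ 2)%:E)%E).
  by apply: lee_sum => j _; exact: trace_linear.
rewrite -nneseries_sum; last by move=> j k _; rewrite lee_fin sqr_ge0.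
apply: lee_nneseries => [k _ _|k _].
  by apply: sume_ge0 => j _; rewrite lee_fin sqr_ge0.
rewrite sumEFin lee_fin pkerE.
pose y (i : 'I_(size (b k))) k := ip (h i) (U k).
have L : qf y (fun=> 1) n (fun i => (b k)`_i) @[n --> \oo] -->
    \sum_(i < size (b k)) \sum_(j < size (b k)) (b k)`_i * (b k)`_j * expR (kap i j).
  apply: (qf_cvg (x := fun i : 'I_(size (b k)) => h i)) => i j.
  by under eq_fun do under eq_bigr do rewrite mul1r; exact: kapE.
apply: le_trans (cvg_qf_bound (u := fun n => qf y (fun=> 1) n (fun i => (b k)`_i)) n _ L).
  by apply: (qf_linear_le y).
by apply: qf_nondecreasing.
Qed.

End kernel_traces.

(** * Cameron-Martin spaces *)

Section hilbert_space.
Context {R : realType} {X : completeNormedModType R} (ip : X -> X -> R).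
Hypotheses (sip : semi_inner ip) (hip : forall x, ip x x = `|x| ^+ 2).

Lemma dot_semi_inner (dot : {dot X for idfun}) : semi_inner dot.
Proof.
split=> [x y|a x y z|x].
- by rewrite hermC /= expr0 mul1r.
- by rewrite linearPl.
- have [->|x0] := eqVneq x 0; first by rewrite linear0l.
  by apply: ltW; exact: neq0_dnorm_gt0.
Qed.

Lemma ip_norm_def : definite_ip ip.
Proof. by move=> x; rewrite hip => /eqP; rewrite sqrf_eq0 normr_eq0 => /eqP. Qed.

Lemma ip_norm_complete : complete_ip ip.
Proof.
move=> u cu.
have : cvgn u.
  apply: cauchy_cvg; apply: cauchy_exP => eps eps0.
  have [N HN] := cu (eps ^+ 2) (exprn_gt0 _ eps0).
  exists (u N); exists N => // n /= Nn; rewrite -ball_normE /ball_/=.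
  by have := HN _ _ (leqnn N) Nn; rewrite hip ltr_pXn2r// nnegrE// ltW.
move=> /cvg_ex[l ul]; exists l; rewrite /cvg_ip.
apply/cvgr0Pnorm_lt => eps eps0.
have s0 : 0 < Num.sqrt eps by rewrite sqrtr_gt0.
have /cvgrPdist_lt/(_ _ s0) := ul; apply: filterS => n.
rewrite distrC hip ger0_norm ?sqr_ge0// => H.
by rewrite -(sqr_sqrtr (ltW eps0)) ltr_pXn2r// nnegrE// ltW.
Qed.

End hilbert_space.

Section pseudoinverse.
Context {R : realType} {X : completeNormedModType R} (ip : X -> X -> R).
Hypotheses (sip : semi_inner ip) (hip : forall x, ip x x = `|x| ^+ 2).
Variables (Q S : {linear X -> X}) (hS : is_sqrt_op ip Q S).
Variables (D : set nat) (f : nat -> X).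
Hypothesis fQ : hilbert_basis_of ip (orthocomp ip (ker Q)) D f.

Let Ssym : symmetric_op ip S := let: And3 a _ _ := hS in a.
Let SS x : S (S x) = Q x. Proof. by have [_ _] := hS. Qed.
Let def : definite_ip ip := ip_norm_def hip.
Let of_ := zext_ortho sip (let: And3 a _ _ := fQ in a).

Lemma ker_sqrt x : (S x = 0) <-> (Q x = 0).
Proof.
split=> [Sx|Qx]; first by rewrite -SS Sx linear0.
by apply: def; rewrite Ssym SS Qx (sip0r sip).
Qed.

Lemma orthocomp_ker z : orthocomp ip (ker S) z <-> orthocomp ip (ker Q) z.
Proof.
by split=> H w kw; apply: H; move: kw; rewrite /ker /= => /ker_sqrt.
Qed.

Lemma range_orthocomp x : orthocomp ip (ker S) (S x).
Proof. by move=> w /= Sw; rewrite Ssym Sw (sip0r sip). Qed.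

Lemma orthocompDZ a x y : orthocomp ip (ker S) x -> orthocomp ip (ker S) y ->
  orthocomp ip (ker S) (a *: x + y).
Proof. by move=> Hx Hy w kw; rewrite (sipDZ sip) Hx// Hy// mulr0 addr0. Qed.

Lemma orthocomp_inj x y : orthocomp ip (ker S) x -> orthocomp ip (ker S) y ->
  S x = S y -> x = y.
Proof.
move=> Hx Hy Sxy; apply/eqP; rewrite -subr_eq0; apply/eqP; apply: def.
have -> : x - y = -1 *: y + x by rewrite scaleN1r addrC.
apply: (orthocompDZ (-1) Hy Hx); rewrite /ker /=.
by rewrite linearP Sxy scaleN1r addNr.
Qed.

Lemma orthocomp_parseval x : orthocomp ip (ker S) x ->
  (fun n => \sum_(i < n) ip x (zext D f i) ^+ 2) @ \oo --> ip x x.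
Proof.
move=> /orthocomp_ker Hx; have [_ _ fd] := fQ.
apply/cvgrPdist_lt => eps eps0.
have [|n [c Hc]] := fd x Hx (Num.sqrt eps); first by rewrite sqrtr_gt0.
exists n => // m /= nm; rewrite ger0_norm; last by rewrite subr_ge0 (bessel sip of_).
pose c' k := if `[< D k >] then c k else 0.
have c'0 k : ~ D k -> c' k = 0 by move=> nD; rewrite /c' asboolF.
apply: (@le_lt_trans _ _ (ip x x - \sum_(i < n) ip x (zext D f i) ^+ 2)).
  rewrite lerD2l lerN2 -!(big_mkord xpredT (fun i => ip x (zext D f i) ^+ 2)).
  rewrite [leRHS](big_cat_nat (n := n))//= lerDl.
  by apply: sumr_ge0 => i _; exact: sqr_ge0.
apply: le_lt_trans (best_approx sip of_ n x c'0) _.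
move: Hc; rewrite (sum_zext D f c) /ip_norm ltr_sqrt//.
Qed.

(** The witness is the projection P x on the span of the eigenvectors. The residue x - P x is
    orthogonal to every S (S w), hence killed by [Q] and so by [S]. *)
Lemma orthocomp_exists x : exists z, orthocomp ip (ker S) z /\ S z = S x.
Proof.
pose P := oproj sip (ip_norm_complete hip) of_.
exists (P x); split.
  apply/orthocomp_ker => w kw; apply: ip_oproj => k.
  have [Dk|nDk] := pselect (D k); last by rewrite of_.2// (sip0r sip).
  by have [_ fk _] := fQ; rewrite /zext asboolT// (sipC sip); exact: fk.
apply/eqP; rewrite eq_sym -subr_eq0 -linearB; apply/eqP/ker_sqrt.
have H w : orthocomp ip (ker S) w -> ip (x - P x) w = 0.
  move=> Hw; have := orthocomp_parseval Hw => pw.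
  have cw : cvg_ip ip (fun n => fproj (ip := ip) (zext D f) n w) w.
    rewrite /cvg_ip; under eq_fun do rewrite (sip_sqBC sip) (sq_Bproj sip of_).
    suff : (fun n => ip w w - \sum_(i < n) ip w (zext D f i) ^+ 2) @ \oo --> ip w w - ip w w.
      by rewrite subrr.
    by apply: cvgB => //; exact: cvg_cst.
  rewrite (sipC sip); have L := @sip_cvg _ _ _ sip _ _ cw (x - P x).
  apply: (cvg_unique _ L) => //; apply: cvg_near_cst; apply: nearW => n.
  rewrite (sip_suml sip) big1// => i _; rewrite (sipZl sip) (sipC sip _ (x - P x)).
  by rewrite (sipBl sip) /P ip_oproj_E subrr mulr0.
apply: (definite_eq sip def) => w; rewrite (sip0l sip) -SS !Ssym.
exact: H (range_orthocomp _).
Qed.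

Lemma pinvP x : orthocomp ip (ker S) (Defs.pinv ip S (S x)) /\ S (Defs.pinv ip S (S x)) = S x.
Proof.
rewrite /Defs.pinv; apply: (xgetPex 0 (P := [set z | orthocomp ip (ker S) z /\ S z = S x])).
exact: orthocomp_exists.
Qed.

Lemma pinvK z : orthocomp ip (ker S) z -> Defs.pinv ip S (S z) = z.
Proof. by move=> Hz; have [H1 H2] := pinvP z; exact: orthocomp_inj. Qed.

(** Restricted to the orthogonal complement of ker S this is a unitary map onto the Cameron-Martin
    space; completeness and bases are transported along it. *)
Definition cmS (z : X) : cm_space S := CMSpace (mem_set (ex_intro2 _ _ z I erefl)).

Let cpinv (h : cm_space S) := Defs.pinv ip S (cm_val h).

Lemma cm_val_range (h : cm_space S) : exists z, cm_val h = S z.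
Proof. by case: h => v /= /set_mem[z _ <-]; exists z. Qed.

Lemma cpinv_orth h : orthocomp ip (ker S) (cpinv h).
Proof. by rewrite /cpinv; have [z ->] := cm_val_range h; have [] := pinvP z. Qed.

Lemma cpinvK h : S (cpinv h) = cm_val h.
Proof. by rewrite /cpinv; have [z ->] := cm_val_range h; have [] := pinvP z. Qed.

Lemma cmS_cpinv h : cmS (cpinv h) = h.
Proof. by apply: val_inj; rewrite /= cpinvK. Qed.

Lemma cpinv_cmS z : orthocomp ip (ker S) z -> cpinv (cmS z) = z.
Proof. exact: pinvK. Qed.

Lemma cpinvDZ a h k : cpinv (a *: h + k) = a *: cpinv h + cpinv k.
Proof.
apply: orthocomp_inj; first exact: cpinv_orth.
  by apply: orthocompDZ; exact: cpinv_orth.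
by rewrite cpinvK linearP !cpinvK.
Qed.

Lemma cm_semi_inner : semi_inner (cm_ip ip S).
Proof.
split=> [x y|a x y z|x]; rewrite /cm_ip -/(cpinv x) ?(sip_ge0 sip)//.
- by rewrite (sipC sip).
- by rewrite -/(cpinv (a *: x + y)) cpinvDZ (sipDZ sip).
Qed.

Lemma cm_definite : definite_ip (cm_ip ip S).
Proof.
move=> h; rewrite /cm_ip => /def Hh.
by rewrite -(cmS_cpinv h) /cpinv Hh; apply: val_inj; rewrite /= linear0.
Qed.

Lemma cpinvB h k : cpinv (h - k) = cpinv h - cpinv k.
Proof. by rewrite addrC -scaleN1r cpinvDZ scaleN1r addrC. Qed.

Lemma cm_complete : complete_ip (cm_ip ip S).
Proof.
move=> u cu.
have cu' : cauchy_ip ip (fun n => cpinv (u n)).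
  move=> eps /cu[N HN]; exists N => m n Nm Nn.
  by rewrite -cpinvB; exact: HN.
have [z zlim] := ip_norm_complete hip cu'.
have Hz : orthocomp ip (ker S) z.
  move=> w kw; have L := @sip_cvg _ _ _ sip _ _ zlim w.
  apply: (cvg_unique _ L) => //; apply: cvg_near_cst; apply: nearW => n.
  exact: cpinv_orth.
exists (cmS z); rewrite /cvg_ip /cm_ip.
under eq_fun do rewrite -/(cpinv (u _ - cmS z)) cpinvB cpinv_cmS//.
exact: zlim.
Qed.

Lemma cm_ip_cmS y z : orthocomp ip (ker S) y -> orthocomp ip (ker S) z ->
  cm_ip ip S (cmS y) (cmS z) = ip y z.
Proof. by move=> Hy Hz; rewrite /cm_ip !pinvK. Qed.

Lemma zext_orth k : orthocomp ip (ker S) (zext D f k).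
Proof.
have [Dk|nDk] := pselect (D k); last by rewrite of_.2// => w _; rewrite (sip0l sip).
by have [_ fk _] := fQ; rewrite /zext asboolT//; apply/orthocomp_ker; exact: fk.
Qed.

(** The [f k] are orthonormal in [X]; it is their images under [S] that are orthonormal for the
    Cameron-Martin product. *)
Definition cm_basis k : cm_space S := cmS (zext D f k).

Lemma cm_basis_ortho : ortho_fam (ip := cm_ip ip S) D cm_basis.
Proof.
split=> [j k|k nDk].
  by rewrite cm_ip_cmS; [exact: of_.1|exact: zext_orth|exact: zext_orth].
by apply: val_inj; rewrite /= of_.2// linear0.
Qed.

Lemma cm_basis_parseval : parseval_fam (ip := cm_ip ip S) cm_basis.
Proof.
move=> h; have E k : cm_ip ip S h (cm_basis k) = ip (cpinv h) (zext D f k).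
  rewrite -{1}(cmS_cpinv h) cm_ip_cmS//; [exact: cpinv_orth|exact: zext_orth].
under eq_fun do under eq_bigr do rewrite E.
exact: (orthocomp_parseval (cpinv_orth h)).
Qed.

(* The vector Q u of the Cameron-Martin space; it represents <u, .>. *)
Definition cmQ u : cm_space S := cmS (S u).

Lemma cm_ip_cmQ u h : cm_ip ip S (cmQ u) h = ip u (cm_val h).
Proof.
rewrite -{1}(cmS_cpinv h) cm_ip_cmS; [|exact: range_orthocomp|exact: cpinv_orth].
by rewrite Ssym cpinvK.
Qed.

Lemma cm_ip_cmQ2 u v : cm_ip ip S (cmQ u) (cmQ v) = ip (Q u) v.
Proof. by rewrite cm_ip_cmQ /= SS -SS -Ssym -Ssym SS. Qed.

Lemma cmQDZ a u v : cmQ (a *: u + v) = a *: cmQ u + cmQ v.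
Proof. by apply: val_inj; rewrite /= !linearP. Qed.

Hypothesis Qc : continuous Q.
Variable l : nat -> R.
Hypothesis fl : forall k, D k -> Q (f k) = l k *: f k.

Lemma eigen_neq0 k : D k -> l k != 0.
Proof.
move=> Dk; apply/eqP => l0; have [fo fk _] := fQ.
have : ip (f k) (f k) = 1 by rewrite fo// eqxx.
rewrite (fk k Dk (f k)) => [/eqP|]; first by rewrite eq_sym oner_eq0.
by rewrite /ker /= fl// l0 scale0r.
Qed.

Lemma cm_dense_range (h : cm_space S) (eps : R) : 0 < eps ->
  exists u, cm_ip ip S (h - cmQ u) (h - cmQ u) < eps.
Proof.
move=> eps0.
have := parseval_proj cm_semi_inner cm_basis_ortho h cm_basis_parseval.
move=> /cvgr0Pnorm_lt/(_ _ eps0)[n _ /(_ n (leqnn n))] /=.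
rewrite ger0_norm ?(sip_ge0 cm_semi_inner)// (sip_sqBC cm_semi_inner) => Hn.
pose c i := cm_ip ip S h (cm_basis i).
(* Q S f_i = l_i S f_i, so dividing the coordinates by the eigenvalues turns a partial Fourier sum
   into a value of [Q]. *)
exists (\sum_(i < n) (c i / l i) *: S (zext D f i)).
suff <- : fproj (ip := cm_ip ip S) cm_basis n h =
  cmQ (\sum_(i < n) (c i / l i) *: S (zext D f i)) by [].
have QS x : Q (S x) = S (Q x) by rewrite -!SS.
apply: val_inj; rewrite /cmQ /= SS linear_sum.
rewrite (big_morph (@cm_val _ _ S) (id1 := 0) (op1 := +%R)) //; apply: eq_bigr => i _; rewrite linearZ /= QS.
rewrite -[LHS]/(c i *: S (zext D f i)).
have [Di|nDi] := pselect (D i); last by rewrite of_.2// !linear0.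
by rewrite /zext asboolT// fl// linearZ /= scalerA divfK ?eigen_neq0.
Qed.

(** The squared distance of [cmQ u] and [cmQ v] is <Q (u - v), u - v>, small for [v] near [u] by
    continuity of [Q]. *)
Lemma cm_dense (v : nat -> X) : dense (range v) ->
  forall (h : cm_space S) (eps : R), 0 < eps ->
  exists n, cm_ip ip S (h - cmQ (v n)) (h - cmQ (v n)) < eps.
Proof.
move=> dv h eps eps0.
have e40 : 0 < eps / 4 by rewrite divr_gt0.
have [u Hu] := cm_dense_range h e40.
have [n Hn] : exists n, ip (Q (u - v n)) (u - v n) < eps / 4.
  have c1 : (fun w => Q (u - w)) @ u --> Q (u - u).
    apply: (@continuous_comp _ _ _ (fun w => u - w) Q); last exact: Qc.
    by apply: cvgB; [exact: cvg_cst|exact: cvg_id].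
  have c2 : (fun w => u - w) @ u --> u - u.
    by apply: cvgB; [exact: cvg_cst|exact: cvg_id].
  rewrite subrr in c2; rewrite subrr linear0 in c1.
  have N1 : \forall w \near u, `|Q (u - w)| < eps / 4 by apply: cvgr0_norm_lt.
  have N2 : \forall w \near u, `|u - w| < 1 by apply: cvgr0_norm_lt.
  have [Y [oY Yu] YP] : exists2 Y, open_nbhs u Y & Y `<=` [set w | `|Q (u - w)| < eps / 4 /\ `|u - w| < 1].
    have N12 : nbhs u [set w | `|Q (u - w)| < eps / 4 /\ `|u - w| < 1] by exact: filterI.
    by move: N12; rewrite nbhsE.
  have [w [Yw [n _ vn]]] := dv Y (ex_intro _ u Yu) oY.
  exists n; rewrite vn; have [w1 w2] := YP _ Yw.
  apply: le_lt_trans w1; apply: le_trans (ler_norm _) _.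
  rewrite -(ler_pXn2r (n := 2))// ?nnegrE// real_normK ?num_real//.
  apply: le_trans (sip_CS sip _ _) _; rewrite !hip -[leRHS]mulr1.
  by rewrite ler_wpM2l ?sqr_ge0// expr_le1// ltW.
exists n; have -> : h - cmQ (v n) = (h - cmQ u) + cmQ (u - v n).
  have := cmQDZ (-1) (v n) u; rewrite scaleN1r addrC => ->.
  by rewrite scaleN1r addrA addrAC subrK.
apply: le_lt_trans (sip_leD cm_semi_inner _ _) _; rewrite cm_ip_cmQ2.
by move: Hu Hn; set a := cm_ip _ _ _ _; set b := ip _ _; lra.
Qed.

End pseudoinverse.

(** * Gaussian integrals of exponentials *)

Section measure_preliminaries.
Context d (T : measurableType d) (R : realType) (mu : {measure set T -> \bar R}).

Lemma mem_Lfun2 (f : T -> R) : measurable_fun setT f ->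
  (\int[mu]_x (f x ^+ 2)%:E < +oo)%E -> f \in Lfun mu 2%:E.
Proof.
move=> mf If; rewrite inE; apply/andP; split; rewrite inE//=.
rewrite /finite_norm unlock poweR_lty//.
under eq_integral => x _.
  rewrite abse_EFin poweR_EFin powR_mulrn// real_normK ?num_real//.
  over.
by [].
Qed.

Lemma Lfun2P (f : T -> R) : f \in Lfun mu 2%:E ->
  measurable_fun setT f /\ (\int[mu]_x (f x ^+ 2)%:E < +oo)%E.
Proof.
move=> fL; split.
  by move: fL; rewrite inE => /andP[]; rewrite inE.
exact: (integrable_lty _ (Lfun2_integrable_sqr fL)).
Qed.

Lemma integrable_mul2 (f g : T -> R) : f \in Lfun mu 2%:E -> g \in Lfun mu 2%:E ->
  mu.-integrable setT (EFin \o (fun x => f x * g x)).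
Proof. by move=> fL gL; apply/Lfun1_integrable; exact: Lfun2_mul_Lfun1. Qed.

End measure_preliminaries.

Section L2.
Context {R : realType} {X : completeNormedModType R}.
Variable mu : probability (borel_type X) R.

Lemma L2_integrable (f g : L2 mu) :
  mu.-integrable setT (EFin \o (fun x => f x * g x)).
Proof. by apply: integrable_mul2; exact: LfunP. Qed.

Lemma L2_semi_inner : semi_inner (L2_ip mu).
Proof.
split=> [f g|a f g h|f].
- by rewrite /L2_ip; apply: eq_Rintegral => x _; rewrite mulrC.
- rewrite /L2_ip -RintegralZl//; last exact: L2_integrable.
  rewrite -RintegralD//; last 2 first.
  + by apply: (eq_integrable _ (fun x => a%:E * (f x * h x)%:E)%E) => //;
      apply: integrableZl => //; exact: L2_integrable.
  + exact: L2_integrable.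
  by apply: eq_Rintegral => x _ /=; rewrite mulrDl mulrA.
- by apply: Rintegral_ge0 => x _; rewrite -expr2 sqr_ge0.
Qed.

Definition mkL2 (f : X -> R) (Hf : (f : borel_type X -> R) \in Lfun mu 2%:E) : L2 mu :=
  Lfun_Sub (lee1n 2) Hf.

Lemma L2_ip_sq (f : L2 mu) : (L2_ip mu f f)%:E = (\int[mu]_x ((f x) ^+ 2)%:E)%E.
Proof.
rewrite /L2_ip /Rintegral fineK.
  by apply: eq_integral => x _; rewrite expr2.
by apply: integrable_fin_num => //; exact: L2_integrable.
Qed.

Variable ip : X -> X -> R.
Hypotheses (sip : semi_inner ip) (hip : forall x, ip x x = `|x| ^+ 2).

Lemma ip_norm_CS x y : `|ip x y| <= `|x| * `|y|.
Proof.
rewrite -(ler_pXn2r (n := 2))// ?nnegrE// ?mulr_ge0//.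
by rewrite real_normK ?num_real// exprMn -!hip (sip_CS sip).
Qed.

Lemma continuous_ip u : continuous (ip u).
Proof.
move=> x; apply/cvgrPdist_lt => eps eps0.
have e1 : 0 < eps / (`|u| + 1) by rewrite divr_gt0// ltr_wpDl.
have : \forall y \near x, `|x - y| < eps / (`|u| + 1) by apply: cvgr_dist_lt.
apply: filterS => y; rewrite -(sipBr sip) ltr_pdivlMr ?ltr_wpDl// => H.
apply: le_lt_trans (ip_norm_CS _ _) _; apply: le_lt_trans H.
by rewrite mulrC ler_wpM2l// lerDl.
Qed.

Lemma continuous_measurable_borel (f : X -> R) : continuous f ->
  measurable_fun setT (f : borel_type X -> R).
Proof.
move=> cf; apply: (measurability _ (RGenOInfty.measurableE R)).
move=> _ [_ [x ->] <-]; rewrite setTI; apply: sub_sigma_algebra.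
by apply: open_comp => // y _; exact: cf.
Qed.

Lemma measurable_ip u : measurable_fun setT (ip u : borel_type X -> R).
Proof. by apply: continuous_measurable_borel; exact: continuous_ip. Qed.

Lemma measurable_exp_ip u : measurable_fun setT (fun x : borel_type X => expR (ip u x)).
Proof. exact: (measurableT_comp (@measurable_expR R) (measurable_ip u)). Qed.

End L2.

Section normal_exponential.
Context {R : realType}.
Notation leb := (@lebesgue_measure R).

(** The change of variables is available for the Radon-Nikodym derivative, which agrees with the
    normal density almost everywhere since both integrate to the same measure. *)
Lemma integral_normal_prob (m s : R) (f : R -> R) : s != 0 -> (forall x, 0 <= f x) ->
  measurable_fun setT f ->
  (\int[normal_prob m s]_x (f x)%:E = \int[leb]_x (f x * normal_pdf m s x)%:E)%E.
Proof.
move=> s0 f0 mf.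
have dom := normal_prob_dominates m s.
rewrite -(Radon_Nikodym_SigmaFinite.change_of_variables dom (f := fun x => (f x)%:E))//; last first.
  exact/measurable_EFinP.
under [RHS]eq_integral do rewrite EFinM.
apply: ae_eq_integral => //.
- apply: emeasurable_funM; first exact/measurable_EFinP.
  apply: (measurable_int leb); exact: Radon_Nikodym_SigmaFinite.f_integrable.
- apply: emeasurable_funM; first exact/measurable_EFinP.
  by apply/measurable_EFinP; exact: measurable_normal_pdf.
- apply: ae_eqe_mul2l; apply: integral_ae_eq => //.
  + exact: Radon_Nikodym_SigmaFinite.f_integrable.
  + by apply/measurable_EFinP; exact: measurable_normal_pdf.
  + by move=> E _ mE; rewrite -Radon_Nikodym_SigmaFinite.f_integral.
Qed.

Lemma normal_mgf (s : R) z : s != 0 ->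
  (\int[normal_prob 0 s]_x (expR (z * x))%:E = (expR (z ^+ 2 * s ^+ 2 / 2))%:E)%E.
Proof.
move=> s0; rewrite integral_normal_prob//; last first.
  by apply: measurableT_comp => //; exact: mulrl_measurable.
(* Completing the square: the tilted density is a constant times the normal density with mean z
   s^2. *)
transitivity (\int[leb]_x ((expR (z ^+ 2 * s ^+ 2 / 2))%:E * (normal_pdf (z * s ^+ 2) s x)%:E))%E.
  apply: eq_integral => x _; rewrite -EFinM; congr EFin.
  rewrite /normal_pdf (negbTE s0) mulrCA [RHS]mulrCA; congr (_ * _).
  rewrite /normal_fun -!expRD; congr expR.
  by field.
rewrite ge0_integralZl//=.
- by rewrite integral_normal_pdf mule1.
- by apply/measurable_EFinP; exact: measurable_normal_pdf.
- by move=> x _; rewrite lee_fin normal_pdf_ge0.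
Qed.

Lemma centered_normal_mgf (v z : R) : 0 <= v ->
  forall (P : {measure set (measurableTypeR R) -> \bar R}),
  (forall B, measurable B -> P B = centered_normal v B) ->
  (\int[P]_x (expR (z * x))%:E = (expR (z ^+ 2 * v / 2))%:E)%E.
Proof.
move=> v0 P HP.
have mz : measurable_fun setT (fun x : R => (expR (z * x))%:E).
  by apply/measurable_EFinP/measurableT_comp => //; exact: mulrl_measurable.
have [v00|vn0] := eqVneq v 0.
  rewrite (eq_measure_integral \d_(0 : measurableTypeR R)) => [|B mB _].
    by rewrite integral_dirac// diracT mul1e v00 !mulr0 mul0r.
  by have := HP B mB; rewrite /centered_normal v00 eqxx.
rewrite (eq_measure_integral (normal_prob 0 (Num.sqrt v))) => [|B mB _].
  by rewrite normal_mgf ?sqr_sqrtr// sqrtr_eq0 -ltNge lt_neqAle eq_sym vn0.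
by have := HP B mB; rewrite /centered_normal (negbTE vn0).
Qed.

End normal_exponential.

(** * Exponential moments of L^2 limits *)

Section exponential_limit.
Context d (T : measurableType d) (R : realType) (P : probability T R).
Variables (Z : T -> R) (Zm : nat -> T -> R) (vm : nat -> R) (v : R).
Hypotheses (mZ : measurable_fun setT Z) (mZm : forall m, measurable_fun setT (Zm m))
  (E1 : forall m, (\int[P]_x (expR (Zm m x))%:E = (expR (vm m / 2))%:E)%E)
  (E2 : forall m, (\int[P]_x (expR (2 * Zm m x))%:E = (expR (2 * vm m))%:E)%E)
  (vmv : vm @ \oo --> v)
  (dm : (fun m => \int[P]_x ((Zm m x - Z x) ^+ 2)%:E)%E @ \oo --> 0%E).

Lemma expR_tangent (a b : R) : expR a - expR b <= (a - b) * expR a.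
Proof.
have H := expR_ge1Dx (b - a); have a0 := expR_gt0 a.
move: H; rewrite -(ler_pM2l a0) mulrDr mulr1 -expRD [a + _]addrC subrK.
by set A := expR a; set B := expR b; lra.
Qed.

Lemma amgm (r a b : R) : 0 < r -> a * b <= r / 2 * b ^+ 2 + (2 * r)^-1 * a ^+ 2.
Proof.
move=> r0; rewrite -subr_ge0.
have -> : r / 2 * b ^+ 2 + (2 * r)^-1 * a ^+ 2 - a * b = (2 * r)^-1 * (r * b - a) ^+ 2.
  by field; rewrite gt_eqF.
by rewrite mulr_ge0 ?sqr_ge0// invr_ge0 mulr_ge0// ltW.
Qed.

Lemma good_index (eta : R) : 0 < eta -> exists m,
  [/\ (\int[P]_x ((Zm m x - Z x) ^+ 2)%:E <= eta%:E)%E,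
   `|expR (vm m / 2) - expR (v / 2)| <= eta & expR (2 * vm m) <= expR (2 * v) + 1].
Proof.
move=> eta0.
have N1 : \forall m \near \oo, (\int[P]_x ((Zm m x - Z x) ^+ 2)%:E <= eta%:E)%E.
  move: dm => /fine_cvgP[fin /cvgr0Pnorm_lt/(_ _ eta0)].
  apply: filterS2 fin => m fin H; rewrite -(fineK fin) lee_fin.
  by apply: le_trans (ler_norm _) _; exact: ltW.
have N2 : \forall m \near \oo, `|expR (v / 2) - expR (vm m / 2)| < eta.
  have : (fun m => expR (vm m / 2)) @ \oo --> expR (v / 2).
    apply: continuous_cvg; first exact: continuous_expR.
    by apply: cvgM => //; exact: cvg_cst.
  by move/cvgrPdist_lt; apply.
have N3 : \forall m \near \oo, `|expR (2 * v) - expR (2 * vm m)| < 1.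
  have : (fun m => expR (2 * vm m)) @ \oo --> expR (2 * v).
    apply: continuous_cvg; first exact: continuous_expR.
    by apply: cvgM => //; exact: cvg_cst.
  by move/cvgrPdist_lt; apply.
have [m _ /(_ m (leqnn m)) [H1 [H2 H3]]] := filterI N1 (filterI N2 N3).
exists m; split=> //; first by rewrite distrC ltW.
by move: H3; rewrite ltr_norml => /andP[H3 _]; lra.
Qed.

Let mDR m : measurable_fun setT (fun x => (Zm m x - Z x) ^+ 2).
Proof. by apply/measurable_funX/measurable_funB. Qed.

Let mD m : measurable_fun setT (fun x => ((Zm m x - Z x) ^+ 2)%:E).
Proof. by apply/measurable_EFinP. Qed.

Let mexpR (f : T -> R) : measurable_fun setT f -> measurable_fun setT (fun x => expR (f x)).
Proof. by move=> mf; apply: measurableT_comp. Qed.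

Let mexp (f : T -> R) : measurable_fun setT f -> measurable_fun setT (fun x => (expR (f x))%:E).
Proof. by move=> mf; apply/measurable_EFinP/measurableT_comp. Qed.

Lemma integral_quad (a b c : R) m : 0 <= a -> 0 <= b -> 0 <= c ->
  (\int[P]_x (expR (Zm m x) + (a + b * expR (2 * Zm m x) + c * (Zm m x - Z x) ^+ 2))%:E =
   (expR (vm m / 2))%:E + (a%:E + b%:E * (expR (2 * vm m))%:E +
     c%:E * \int[P]_x ((Zm m x - Z x) ^+ 2)%:E))%E.
Proof.
move=> a0 b0 c0.
have m2 : measurable_fun setT (fun x => 2 * Zm m x).
  by apply: measurable_funM => //.
have mb : measurable_fun setT (fun x => (b * expR (2 * Zm m x))%:E).
  by apply/measurable_EFinP; apply: measurable_funM => //; apply: mexpR.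
have mc : measurable_fun setT (fun x => (c * (Zm m x - Z x) ^+ 2)%:E).
  by apply/measurable_EFinP; apply: measurable_funM => //; exact: mDR.
under eq_integral do rewrite !EFinD.
have e0 (z : R) : (0 <= (expR z)%:E)%E by rewrite lee_fin expR_ge0.
have b0' x : (0 <= (b * expR (2 * Zm m x))%:E)%E by rewrite lee_fin mulr_ge0// expR_ge0.
have c0' x : (0 <= (c * (Zm m x - Z x) ^+ 2)%:E)%E by rewrite lee_fin mulr_ge0// sqr_ge0.
rewrite ge0_integralD//; last 3 first.
- exact: mexp.
- by move=> x _; rewrite !adde_ge0.
- by apply: emeasurable_funD => //; apply: emeasurable_funD.
rewrite E1; congr (_ + _)%E.
rewrite ge0_integralD//; last 2 first.
- by move=> x _; rewrite adde_ge0.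
- exact: emeasurable_funD.
congr (_ + _)%E.
  rewrite ge0_integralD//.
  congr (_ + _)%E.
    by rewrite integral_cst// -[RHS]mule1; congr (_ * _)%E; exact: probability_setT.
  under eq_integral do rewrite EFinM.
  by rewrite ge0_integralZl// ?E2//; exact: mexp.
under eq_integral do rewrite EFinM.
by rewrite ge0_integralZl// => x _; rewrite lee_fin sqr_ge0.
Qed.

(** By convexity e^Z <= e^Zm + (Z - Zm) e^Z. On Z <= M the last factor is at most e^M, so the error
    is controlled by the L^2 distance; monotone convergence then removes the truncation. *)
Lemma integral_exp_limit_le : (\int[P]_x (expR (Z x))%:E <= (expR (v / 2))%:E)%E.
Proof.
pose f M x := expR (Z x) * (Z x <= M%:R)%R%:R.
have mf M : measurable_fun setT (fun x => (f M x)%:E).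
  apply/measurable_EFinP; apply: measurable_funM; first by apply: mexpR.
  rewrite (_ : (fun x => (Z x <= M%:R)%R%:R) = \1_[set x | Z x <= M%:R]).
    apply: measurable_indic; rewrite -[X in measurable X]setTI.
    exact: measurable_fun_le.
  by apply/funext => x; rewrite indicE mem_setE.
have f0 M x : 0 <= f M x by rewrite mulr_ge0 ?expR_ge0// ler0n.
have fM M : (\int[P]_x (f M x)%:E <= (expR (v / 2))%:E)%E.
  apply/lee_addgt0Pr => eps eps0.
  pose eM : R := expR M%:R; have eM0 : 0 < eM by exact: expR_gt0.
  (* The constant error [r / 2 * eM] is then eps / 2. The bound in [eta0] is chosen so that 1 + c
     copies of it make the other half: one for the moment of Zm, c for the quadratic term. *)
  pose r := eps / eM; have r0 : 0 < r by rewrite divr_gt0.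
  pose c := (2 * r)^-1 * eM.
  have c0 : 0 < c by rewrite mulr_gt0// invr_gt0 mulr_gt0.
  have eta0 : 0 < eps / 2 / (1 + c) by rewrite !divr_gt0// addr_gt0.
  have [m [H1 H2 _]] := good_index eta0.
  apply: (@le_trans _ _ (\int[P]_x (expR (Zm m x) + (r / 2 * eM + 0 * expR (2 * Zm m x) +
      c * (Zm m x - Z x) ^+ 2))%:E)%E).
    apply: ge0_le_integral => //.
    - by move=> x _; rewrite lee_fin.
    - apply/measurable_EFinP; apply: measurable_funD; first by apply: mexpR.
      apply: measurable_funD; last by apply: measurable_funM => //; exact: mDR.
      apply: measurable_funD => //; apply: measurable_funM => //.
      by apply: mexpR; exact: measurable_funM.
    - move=> x _; rewrite lee_fin mul0r addr0 /f.
      case: (leP (Z x) M%:R) => ZM; last first.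
        rewrite mulr0 addr_ge0 ?expR_ge0// addr_ge0//.
          by rewrite mulr_ge0 ?(ltW eM0)// divr_ge0// ltW.
        by rewrite mulr_ge0 ?sqr_ge0// ltW.
      rewrite /= mulr1; have := expR_tangent (Z x) (Zm m x) => Ht.
      have := amgm (Z x - Zm m x) 1 r0; rewrite expr1n !mulr1 => Ha.
      have ZeM : expR (Z x) <= eM by rewrite ler_expR.
      rewrite -(sqrrN (Zm m x - Z x)) opprB.
      have e0 := expR_ge0 (Z x).
      have H3 : (Z x - Zm m x) * expR (Z x) <=
        (r / 2 + (2 * r)^-1 * (Z x - Zm m x) ^+ 2) * eM.
        apply: (@le_trans _ _ ((r / 2 + (2 * r)^-1 * (Z x - Zm m x) ^+ 2) * expR (Z x))).
          by rewrite ler_wpM2r.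
        rewrite ler_wpM2l// addr_ge0//; first by rewrite divr_ge0// ltW.
        by rewrite mulr_ge0 ?sqr_ge0// invr_ge0 mulr_ge0// ltW.
      have -> : r / 2 * eM + c * (Z x - Zm m x) ^+ 2 =
          (r / 2 + (2 * r)^-1 * (Z x - Zm m x) ^+ 2) * eM by rewrite /c; ring.
      by move: Ht H3; set q := (_ + _) * eM; lra.
  have a0 : 0 <= r / 2 * eM by rewrite mulr_ge0 ?(ltW eM0)// divr_ge0// ltW.
  rewrite (integral_quad m a0 (lexx 0) (ltW c0)).
  rewrite mul0e adde0.
  apply: (@le_trans _ _ ((expR (vm m / 2))%:E + ((r / 2 * eM)%:E + c%:E * (eps / 2 / (1 + c))%:E))%E).
    by rewrite leeD2l// leeD2l// lee_pmul2l// ?lte_fin.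
  rewrite -EFinM -!EFinD lee_fin.
  have -> : r / 2 * eM = eps / 2 by rewrite /r; field; rewrite gt_eqF.
  move: H2; rewrite ler_norml => /andP[_ H2].
  have H4 : eps / 2 / (1 + c) + c * (eps / 2 / (1 + c)) = eps / 2.
    by field; rewrite gt_eqF// addr_gt0.
  lra.
have HL : (\int[P]_x (limn (fun M => (f M x)%:E)) = \int[P]_x (expR (Z x))%:E)%E.
  apply: eq_integral => x _; apply/cvg_lim => //; apply: cvg_near_cst.
  have [N ZN] : exists N : nat, Z x <= N%:R.
    exists (Num.trunc `|Z x|).+1; rewrite (le_trans (ler_norm _))// ltW//.
    exact: truncnS_gt.
  exists N => // k /= Nk; rewrite /f (_ : (Z x <= k%:R) = true) ?mulr1//.
  by rewrite (le_trans ZN)// ler_nat.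
rewrite -HL.
rewrite monotone_convergence//.
- apply: lime_le; last exact: nearW.
  apply: ereal_nondecreasing_is_cvgn => m n mn; apply: ge0_le_integral => //.
  + by move=> x _; rewrite lee_fin.
  + move=> x _; rewrite lee_fin ler_wpM2l ?expR_ge0// ler_nat.
    by case: (leP (Z x) m%:R) => // H; rewrite (le_trans H)// ler_nat.
- by move=> n x _; rewrite lee_fin.
- move=> x _ m n mn; rewrite lee_fin ler_wpM2l ?expR_ge0// ler_nat.
  by case: (leP (Z x) m%:R) => // H; rewrite (le_trans H)// ler_nat.
Qed.

(** For the lower bound the tangent inequality is used at Zm, and the error is paid with the second
    exponential moments of Zm, bounded along the sequence; hence the hypothesis [E2]. *)
Lemma integral_exp_limit : (\int[P]_x (expR (Z x))%:E = (expR (v / 2))%:E)%E.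
Proof.
apply/eqP; rewrite eq_le integral_exp_limit_le/=.
apply/lee_addgt0Pr => eps eps0.
set b := expR (2 * v) + 1.
have b0 : 0 < b by rewrite addr_gt0 ?expR_gt0.
pose r := eps / b; have r0 : 0 < r by rewrite divr_gt0.
pose c := (2 * r)^-1; have c0 : 0 < c by rewrite invr_gt0 mulr_gt0.
have eta0 : 0 < eps / 2 / (1 + c) by rewrite !divr_gt0// addr_gt0.
have [m [H1 H2 H3]] := good_index eta0.
have m2 : measurable_fun setT (fun x => 2 * Zm m x) by exact: measurable_funM.
have mr : measurable_fun setT (fun x => (r / 2 * expR (2 * Zm m x))%:E).
  by apply/measurable_EFinP; apply: measurable_funM => //; apply: mexpR.
have mc : measurable_fun setT (fun x => (c * (Zm m x - Z x) ^+ 2)%:E).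
  by apply/measurable_EFinP; apply: measurable_funM => //; exact: mDR.
have r0' x : (0 <= (r / 2 * expR (2 * Zm m x))%:E)%E.
  by rewrite lee_fin mulr_ge0 ?expR_ge0// divr_ge0// ltW.
have c0' x : (0 <= (c * (Zm m x - Z x) ^+ 2)%:E)%E by rewrite lee_fin mulr_ge0 ?sqr_ge0// ltW.
have H : ((expR (vm m / 2))%:E <= \int[P]_x (expR (Z x))%:E +
   ((r / 2)%:E * (expR (2 * vm m))%:E + c%:E * \int[P]_x ((Zm m x - Z x) ^+ 2)%:E))%E.
  rewrite -E1 -E2 -!ge0_integralZl//=; last 4 first.
  - by move=> x _; rewrite lee_fin sqr_ge0.
  - by rewrite lee_fin ltW.
  - by apply: mexp.
  - by rewrite lee_fin divr_ge0// ltW.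
  rewrite -!ge0_integralD//; last 5 first.
  - exact: mexp.
  - by move=> x _; rewrite -!EFinM adde_ge0.
  - exact: (emeasurable_funD mr mc).
  - by move=> x _; rewrite -EFinM.
  - by move=> x _; rewrite -EFinM.
  apply: ge0_le_integral => //.
  - exact: mexp.
  - exact: (emeasurable_funD (mexp mZ) (emeasurable_funD mr mc)).
  move=> x _; rewrite -!EFinM -!EFinD lee_fin.
  have := expR_tangent (Zm m x) (Z x).
  have := amgm (Zm m x - Z x) (expR (Zm m x)) r0.
  have -> : expR (2 * Zm m x) = expR (Zm m x) ^+ 2.
    by rewrite mulr_natl mulr2n expRD expr2.
  rewrite -/c; set q := _ * _ ^+ 2; set q' := c * _; lra.
apply: (@le_trans _ _ ((expR (vm m / 2))%:E + (eps / 2 / (1 + c))%:E)%E).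
  rewrite -EFinD lee_fin; move: H2; rewrite ler_norml => /andP[H2 _]; lra.
apply: (@le_trans _ _ (\int[P]_x (expR (Z x))%:E + ((r / 2)%:E * b%:E + c%:E * (eps / 2 / (1 + c))%:E) +
   (eps / 2 / (1 + c))%:E)%E).
  rewrite leeD2r//; apply: le_trans H _; rewrite leeD2l//; apply: leeD.
    by rewrite lee_pmul2l ?lte_fin ?divr_gt0// lee_fin.
  by rewrite lee_pmul2l ?lte_fin.
rewrite -addeA leeD2l// -!EFinM -!EFinD lee_fin.
have -> : r / 2 * b = eps / 2 by rewrite /r; field; rewrite gt_eqF.
have H4 : eps / 2 / (1 + c) + c * (eps / 2 / (1 + c)) = eps / 2.
  by field; rewrite gt_eqF// addr_gt0.
lra.
Qed.

End exponential_limit.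

Import HBNNSimple.

(** Stated for arbitrary nonnegative functions because the squared norm integrated in
    [is_measurable_extension] comes without a measurability proof. The integral is a supremum over
    simple functions below, which is monotone. *)
Lemma le_integral_ge0 d (T : measurableType d) (R : realType) (mu : {measure set T -> \bar R})
    (f g : T -> \bar R) : (forall x, 0 <= f x)%E -> (forall x, f x <= g x)%E ->
  (\int[mu]_x f x <= \int[mu]_x g x)%E.
Proof.
move=> f0 fg; have g0 x : (0 <= g x)%E by exact: le_trans (f0 x) (fg x).
rewrite !ge0_integralTE//; apply: le_ereal_sup => _ [h Hh <-].
by exists h => // x; exact: le_trans (Hh x) (fg x).
Qed.

Lemma le_integralZl d (T : measurableType d) (R : realType) (mu : {measure set T -> \bar R})
    (f : T -> \bar R) (c : R) : 0 <= c -> (forall x, 0 <= f x)%E ->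
  (\int[mu]_x (c%:E * f x) <= c%:E * \int[mu]_x f x)%E.
Proof.
move=> c0 f0; have [->|cn0] := eqVneq c 0.
  by under eq_integral do rewrite mul0e; rewrite integral0 mul0e.
have cp : 0 < c by rewrite lt_neqAle eq_sym cn0.
rewrite ge0_integralTE => [|x]; last by rewrite mule_ge0.
apply: ge_ereal_sup => _ [h Hh <-]; rewrite -integralT_nnsfun.
have -> : (\int[mu]_x (h x)%:E = c%:E * \int[mu]_x (c^-1 * h x)%:E)%E.
  rewrite -ge0_integralZl//.
  - by apply: eq_integral => x _; rewrite -EFinM mulrA divff// mul1r.
  - by apply/measurable_EFinP; apply: measurable_funM.
  - by move=> x _; rewrite lee_fin mulr_ge0// invr_ge0.
rewrite lee_pmul2l//; apply: le_integral_ge0 => x.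
  by rewrite lee_fin mulr_ge0// invr_ge0.
by rewrite EFinM muleC lee_pdivrMr// muleC; exact: Hh.
Qed.

Section gaussian.
Context {R : realType} {X : completeNormedModType R} (ip : X -> X -> R).
Hypotheses (sip : semi_inner ip) (hip : forall x, ip x x = `|x| ^+ 2).
Variables (mu : probability (borel_type X) R) (Q : X -> X) (hmu : gaussian ip mu Q).

Definition mfun_of d1 d2 (T1 : measurableType d1) (T2 : measurableType d2)
    (f : T1 -> T2) (mf : measurable_fun setT f) : {mfun T1 >-> T2} :=
  HB.pack f (isMeasurableFun.Build _ _ _ _ f mf).

Lemma gaussian_mgf w :
  (\int[mu]_x (expR (ip w x))%:E = (expR (ip (Q w) w / 2))%:E)%E.
Proof.
have [[_ _ Q0 _] Hmu] := hmu.
have mw : @measurable_fun _ _ (borel_type X) (measurableTypeR R) setT (ip w).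
  exact: measurable_ip.
pose phi := mfun_of mw.
have := @centered_normal_mgf R (ip (Q w) w) 1 (Q0 w) (pushforward mu phi).
rewrite expr1n mul1r => <-; last by move=> B mB; exact: Hmu.
rewrite ge0_integral_pushforward//.
- by rewrite preimage_setT; apply: eq_integral => x _ /=; rewrite mul1r.
- by apply/measurable_EFinP; apply: measurableT_comp => //; exact: mulrl_measurable.
Qed.


Lemma measurable_ip_comp (A : X -> X) u :
  measurable_fun setT (A : borel_type X -> borel_type X) ->
  measurable_fun setT (fun x : borel_type X => ip u (A x)).
Proof. by move=> mA; exact: measurableT_comp (measurable_ip sip hip u) mA. Qed.

End gaussian.

Section extension.
Context {R : realType} {X : completeNormedModType R} (ip : X -> X -> R).
Hypotheses (sip : semi_inner ip) (hip : forall x, ip x x = `|x| ^+ 2).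
Variables (mu : probability (borel_type X) R) (Q S S' : {linear X -> X}).
Hypotheses (hmu : gaussian ip mu Q) (hS : is_sqrt_op ip Q S).
Variables (T : cm_space S -> cm_space S') (A : X -> X).
Hypothesis hA : is_measurable_extension ip mu Q T A.

(** The defect g = S f - sqrt(l) f satisfies S g = - sqrt(l) g, and positivity of [S] forces it to
    vanish. *)
Lemma sqrt_eigen (f : X) (l : R) : 0 <= l -> Q f = l *: f -> orthocomp ip (ker Q) f ->
  S f = Num.sqrt l *: f.
Proof.
move=> l0 Qf Hf; have [Ssym Spos SS] := hS.
have [l00|ln0] := eqVneq l 0.
  have -> : f = 0.
    by apply: (ip_norm_def hip); apply: Hf; rewrite /ker /= Qf l00 scale0r.
  by rewrite linear0 scaler0.
have s0 : 0 < Num.sqrt l by rewrite sqrtr_gt0 lt_neqAle eq_sym ln0.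
set g := S f - Num.sqrt l *: f.
have Sg : S g = - Num.sqrt l *: g.
  rewrite /g linearB linearZ /= SS Qf scalerBr scalerA mulNr -expr2 sqr_sqrtr//.
  by rewrite !scaleNr opprK addrC.
suff : g = 0 by move/eqP; rewrite subr_eq0 => /eqP.
apply: (ip_norm_def hip); apply/eqP; rewrite eq_le (sip_ge0 sip) andbT.
by have := Spos g; rewrite Sg (sipZl sip) mulNr oppr_ge0 pmulr_rle0.
Qed.

(** Here [k] represents <u, .> and [g] plays the role of T^* k. The variable <u, A x> is the L^2
    limit of <w_m, x>, Gaussian of variance sum_i l_i <g, f_i>^2, a Parseval sum of [g] as sqrt(l_i)
    f_i is orthonormal. *)
Lemma extension_mgf (u : X) (k : cm_space S') (g : cm_space S) :
  (forall h, cm_ip ip S' k h = ip u (cm_val h)) ->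
  (forall h, cm_ip ip S' k (T h) = cm_ip ip S g h) ->
  (\int[mu]_x (expR (ip u (A x)))%:E = (expR (cm_ip ip S g g / 2))%:E)%E.
Proof.
move=> ku kg; have [[mA _] [D [f [l [fQ fl dA]]]]] := hA.
pose F i := cm_val (f i); pose c i := ip u (cm_val (T (f i))).
have [fo fk _] := fQ.
pose w m := \sum_(i < m | `[< D i >]) c i *: F i.
have [[_ Qsym Q0 _] _] := hmu.
have Fx m x : ip (w m) x = \sum_(i < m | `[< D i >]) ip x (F i) * c i.
  by rewrite (sip_suml sip); apply: eq_bigr => i _; rewrite (sipZl sip) (sipC sip) mulrC.
have vE m : ip (Q (w m)) (w m) = \sum_(i < m) cm_ip ip S g (cm_basis S D F i) ^+ 2.
  rewrite linear_sum (sip_suml sip) big_mkcond; apply: eq_bigr => i _.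
  have [Di|nDi] := asboolP (D i); last first.
    rewrite (cm_basis_ortho sip hip hS fQ).2// (sip0r (cm_semi_inner sip hip hS fQ)) expr0n//.
  rewrite linearZ /= fl// (sipZl sip) (sipZl sip) (sip_sumr sip).
  rewrite (bigD1 i)/=; last exact/asboolP.
  rewrite big1 ?addr0; last first.
    move=> j /andP[/asboolP Dj ji]; rewrite (sipZr sip) fo//.
    by rewrite (_ : (i == j :> nat) = false) ?mulr0//; apply: contraNF ji => /eqP ij; apply/eqP/val_inj.
  rewrite (sipZr sip) fo// eqxx mulr1.
  have ff : ip (F i) (F i) = 1 by rewrite fo// eqxx.
  have l0 : 0 <= l i by have := Q0 (F i); rewrite fl// (sipZl sip) ff mulr1.
  have ln0 := eigen_neq0 fQ fl Di.
  have Sf : S (F i) = Num.sqrt (l i) *: F i by apply: sqrt_eigen => //; [exact: fl|exact: fk].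
  have -> : cm_basis S D F i = Num.sqrt (l i) *: f i.
    by apply: val_inj; rewrite /= /zext asboolT// Sf.
  have -> : c i = cm_ip ip S g (f i) by rewrite /c -ku kg.
  rewrite (sipZr (cm_semi_inner sip hip hS fQ)) exprMn sqr_sqrtr//; ring.
have v0 : (fun m => ip (Q (w m)) (w m)) @ \oo --> cm_ip ip S g g.
  by under eq_fun do rewrite vE; exact: (cm_basis_parseval sip hip hS fQ).
apply: (@integral_exp_limit _ _ _ mu (fun x => ip u (A x)) (fun m x => ip (w m) x) (fun m => ip (Q (w m)) (w m))) => //.
- exact: measurable_ip_comp.
- by move=> m; exact: measurable_ip.
- by move=> m; exact: (gaussian_mgf sip hip hmu).
- move=> m; have := gaussian_mgf sip hip hmu (2 *: w m).
  rewrite linearZ /= (sipZl sip) (sipZr sip).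
  under eq_integral do rewrite (sipZl sip).
  by move=> ->; congr (expR _)%:E; field.
have B0 m x : (0 <= ((ip (w m) x - ip u (A x)) ^+ 2)%:E)%E by rewrite lee_fin sqr_ge0.
pose N m := (\int[mu]_x (`|(\sum_(k < m | `[< D k >]) ip x (cm_val (f k)) *: cm_val (T (f k))) - A x| ^+ 2)%:E)%E.
have HB m : (\int[mu]_x ((ip (w m) x - ip u (A x)) ^+ 2)%:E <= (`|u| ^+ 2)%:E * N m)%E.
  apply: (le_trans _ (le_integralZl mu (sqr_ge0 _) _)); last by move=> x; rewrite lee_fin sqr_ge0.
  apply: le_integral_ge0 => // x.
  rewrite -EFinM lee_fin -!hip.
  have -> : ip (w m) x - ip u (A x) = ip u (\sum_(k < m | `[< D k >]) ip x (cm_val (f k)) *: cm_val (T (f k)) - A x).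
    rewrite (sipBr sip) Fx (sip_sumr sip); congr (_ - _).
    by apply: eq_bigr => i _; rewrite (sipZr sip).
  exact: (sip_CS sip).
apply: (@squeeze_cvge _ _ _ _ (cst 0%E) _ (fun m => (`|u| ^+ 2)%:E * N m)%E).
- by apply: nearW => m; rewrite integral_ge0//= HB.
- exact: cvg_cst.
- by rewrite -(mule0 (`|u| ^+ 2)%:E); apply: cvgeZl.
Qed.

End extension.

Lemma integrable_ge0_fin d (T : measurableType d) (R : realType) (mu : {measure set T -> \bar R})
    (f : T -> R) (c : R) : measurable_fun setT f -> (forall x, 0 <= f x) ->
  (\int[mu]_x (f x)%:E = c%:E)%E -> mu.-integrable setT (EFin \o f).
Proof.
move=> mf f0 If; apply/integrableP; split; first exact/measurable_EFinP.
under eq_integral do rewrite /= ger0_norm//.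
by rewrite If ltry.
Qed.

(** * Normalized exponentials and their images under Gamma(T) *)

Section exponential_functions.
Context {R : realType} {X : completeNormedModType R} (ip : X -> X -> R).
Hypotheses (sip : semi_inner ip) (hip : forall x, ip x x = `|x| ^+ 2).

Section one_measure.
Variables (mu : probability (borel_type X) R) (Q S : {linear X -> X}).
Hypotheses (hmu : gaussian ip mu Q).

Lemma Rintegral_exp w : \int[mu]_x expR (ip w x) = expR (ip (Q w) w / 2).
Proof. by rewrite /Rintegral (gaussian_mgf sip hip hmu). Qed.

Definition exp_fun u x := expR (ip u x - ip (Q u) u / 2).

Lemma exp_funE u x : exp_fun u x = expR (- (ip (Q u) u / 2)) * expR (ip u x).
Proof. by rewrite /exp_fun addrC expRD. Qed.

Lemma measurable_exp_fun u : measurable_fun setT (exp_fun u : borel_type X -> R).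
Proof.
have -> : exp_fun u = fun x => expR (- (ip (Q u) u / 2)) * expR (ip u x).
  by apply/funext => x; exact: exp_funE.
by apply: measurable_funM => //; exact: measurable_exp_ip.
Qed.

Lemma exp_ip_Lfun w : (fun x : borel_type X => expR (ip w x)) \in Lfun mu 2%:E.
Proof.
apply: mem_Lfun2; first exact: measurable_exp_ip.
have E x : expR (ip w x) ^+ 2 = expR (ip (2 *: w) x) by rewrite (sipZl sip) expRM_natl.
under eq_integral do rewrite E.
by rewrite (gaussian_mgf sip hip hmu) ltry.
Qed.

Lemma exp_fun_Lfun u : (exp_fun u : borel_type X -> R) \in Lfun mu 2%:E.
Proof.
apply: mem_Lfun2; first exact: measurable_exp_fun.
under eq_integral do rewrite exp_funE exprMn EFinM.
rewrite ge0_integralZl_EFin ?sqr_ge0//; last first.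
  by apply/measurable_EFinP; apply: measurable_funX; exact: measurable_exp_ip.
by rewrite lte_mul_pinfty ?lee_fin ?sqr_ge0//; have [] := Lfun2P (exp_ip_Lfun u).
Qed.

Definition exp_L2 u : L2 mu := mkL2 (exp_fun_Lfun u).

Lemma L2_ip_exp u v : L2_ip mu (exp_L2 u) (exp_L2 v) = expR (ip (Q u) v).
Proof.
have [[_ Qsym _ _] _] := hmu.
rewrite /L2_ip /=.
under eq_Rintegral => x _.
  rewrite !exp_funE mulrACA -(expRD (ip u _)) -(sipDl sip); over.
rewrite RintegralZl//; last first.
  by apply: integrable_ge0_fin (gaussian_mgf sip hip hmu _) => //; exact: measurable_exp_ip.
rewrite Rintegral_exp -!expRD; congr expR.
rewrite linearD (sipDl sip) !(sipDr sip) (Qsym v u) (sipC sip v); by field.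
Qed.

Lemma exp_fun_growth u : exp_growth (exp_fun u).
Proof.
exists (expR (- (ip (Q u) u / 2))), (`|u| + 1); split => [||x].
- exact: expR_gt0.
- by rewrite ltr_wpDl.
rewrite exp_funE normrM !ger0_norm ?expR_ge0// ler_wpM2l ?expR_ge0// ler_expR.
apply: le_trans (ler_norm _) _; apply: le_trans (ip_norm_CS sip hip _ _) _.
by rewrite ler_wpM2r// lerDl.
Qed.

End one_measure.

Section gamma.
Variables (mu nu : probability (borel_type X) R) (Qmu Qnu Smu Snu : {linear X -> X}).
Hypotheses (hmu : gaussian ip mu Qmu) (hnu : gaussian ip nu Qnu).
Hypotheses (hSmu : is_sqrt_op ip Qmu Smu) (hSnu : is_sqrt_op ip Qnu Snu).
Variables (T : {linear cm_space Smu -> cm_space Snu}) (Ts : {linear cm_space Snu -> cm_space Smu}).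
Hypothesis hTs : is_adjoint (cm_ip ip Smu) (cm_ip ip Snu) T Ts.
Variable C : {linear cm_space Smu -> cm_space Smu}.
Hypothesis hC : is_sqrt_op (cm_ip ip Smu) (fun h => h - Ts (T h)) C.
Variables A B : X -> X.
Hypotheses (hA : is_measurable_extension ip nu Qnu Ts A)
  (hB : is_measurable_extension ip mu Qmu C B).
Variables (G : L2 mu -> L2 nu) (hG : is_Gamma A B G).

Notation ipm := (cm_ip ip Smu).
Notation ipn := (cm_ip ip Snu).

Lemma mgf_A u : 
  (\int[nu]_x (expR (ip u (A x)))%:E = (expR (ipn (T (cmQ Smu u)) (T (cmQ Smu u)) / 2))%:E)%E.
Proof.
have [_ [Dm [fm [lm [fmQ _ _]]]]] := hB.
have [_ [Dn [fn [ln [fnQ _ _]]]]] := hA.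
have sm := cm_semi_inner sip hip hSmu fmQ; have sn := cm_semi_inner sip hip hSnu fnQ.
apply: (extension_mgf sip hip hnu hSnu hA (k := cmQ Smu u)) => h.
  by rewrite (cm_ip_cmQ sip hip hSmu fmQ).
by rewrite (sipC sm) hTs (sipC sn).
Qed.

Lemma mgf_B u : (\int[mu]_x (expR (ip u (B x)))%:E =
  (expR ((ip (Qmu u) u - ipn (T (cmQ Smu u)) (T (cmQ Smu u))) / 2))%:E)%E.
Proof.
have [_ [Dm [fm [lm [fmQ _ _]]]]] := hB.
have [_ [Dn [fn [ln [fnQ _ _]]]]] := hA.
have sm := cm_semi_inner sip hip hSmu fmQ; have sn := cm_semi_inner sip hip hSnu fnQ.
have [Csym _ CC] := hC.
rewrite (extension_mgf sip hip hmu hSmu hB (k := cmQ Smu u) (u := u) (g := C (cmQ Smu u))); [|move=> h|move=> h].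
- rewrite Csym CC (sipBr sm) (cm_ip_cmQ2 sip hip hSmu fmQ).
  by rewrite (sipC sm _ (Ts _)) hTs.
- by rewrite (cm_ip_cmQ sip hip hSmu fmQ).
- by rewrite Csym.
Qed.

(** Integrating out <u, B y>, of variance |h_u|^2 - |T h_u|^2, leaves |T h_u|^2 / 2 in place of the
    normalization |h_u|^2 / 2. *)
Lemma gamma_exp u : {ae nu, forall x : borel_type X, G (exp_L2 hmu u) x =
   expR (- (ipn (T (cmQ Smu u)) (T (cmQ Smu u)) / 2)) * expR (ip u (A x))}.
Proof.
have [[mB _] _] := hB.
have [_ _ H] := hG; have := H (exp_L2 hmu u) (exp_fun_growth Qmu u).
apply: filterS => x /= ->.
under eq_Rintegral => y _.
  rewrite exp_funE (sipDr sip) expRD mulrA; over.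
rewrite /= RintegralZl//; last first.
  apply: integrable_ge0_fin (mgf_B _) => //.
  by apply: measurableT_comp => //; exact: (measurable_ip_comp sip hip u mB).
rewrite /Rintegral mgf_B/= mulrAC -!expRD; congr expR; by field.
Qed.

Lemma gamma_gram u v :
  L2_ip nu (G (exp_L2 hmu u)) (G (exp_L2 hmu v)) =
  expR (ipn (T (cmQ Smu u)) (T (cmQ Smu v))).
Proof.
have [_ [Dn [fn [ln [fnQ _ _]]]]] := hA.
have sn := cm_semi_inner sip hip hSnu fnQ.
have [[mA _] _] := hA.
pose cu := expR (- (ipn (T (cmQ Smu u)) (T (cmQ Smu u)) / 2)).
pose cv := expR (- (ipn (T (cmQ Smu v)) (T (cmQ Smu v)) / 2)).
have mE : measurable_fun setT (fun x : borel_type X => expR (ip (u + v) (A x))).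
  by apply: measurableT_comp => //; exact: (measurable_ip_comp sip hip _ mA).
have iE : nu.-integrable setT (EFin \o fun x : borel_type X => expR (ip (u + v) (A x))).
  by apply: integrable_ge0_fin (mgf_A _).
transitivity (\int[nu]_x (cu * cv * expR (ip (u + v) (A x)))).
  rewrite /L2_ip /Rintegral; congr fine; apply: ae_eq_integral => //.
  - by have /integrableP[] := L2_integrable (G (exp_L2 hmu u)) (G (exp_L2 hmu v)).
  - by apply/measurable_EFinP; apply: measurable_funM.
  - have := gamma_exp u; have := gamma_exp v; apply: filterS2 => x /= -> -> _.
    by congr EFin; rewrite mulrACA -(expRD (ip u _)) -(sipDl sip).
rewrite RintegralZl// /Rintegral mgf_A /= -!expRD; congr expR.
have := cmQDZ Smu 1 u v; rewrite !scale1r => ->.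
rewrite linearD (sipDl sn) !(sipDr sn) (sipC sn (T (cmQ Smu v))); by field.
Qed.

End gamma.
End exponential_functions.

Import HBNNSimple.

(** * Totality of the exponentials *)

Section totality.
Context {R : realType} {X : completeNormedModType R} (ip : X -> X -> R).
Hypotheses (sip : semi_inner ip) (hip : forall x, ip x x = `|x| ^+ 2).
Variables (mu : probability (borel_type X) R) (Q : {linear X -> X}).
Hypotheses (hmu : gaussian ip mu Q).

(* With dominated limits instead of L^2 limits, stability under multiplication
   by a bounded function follows by induction from its case on exponentials. *)
Inductive exp_closure : (X -> R) -> Prop :=
| exp_closure_exp w : exp_closure (fun x => expR (ip w x))
| exp_closure_lin (a : R) f g : exp_closure f -> exp_closure g ->
    exp_closure (fun x => a * f x + g x)
| exp_closure_lim (F : L2 mu) (fn : nat -> X -> R) f :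
    (forall n, exp_closure (fn n)) -> (forall n x, `|fn n x| <= F x) ->
    (forall x, (fun n => fn n x) @ \oo --> f x) -> exp_closure f.

Lemma exp_closure0 : exp_closure (fun=> 0).
Proof.
have -> : (fun=> 0) = (fun x : X => -1 * expR (ip 0 x) + expR (ip 0 x)).
  by apply/funext => x; rewrite mulN1r addNr.
by apply: exp_closure_lin; exact: exp_closure_exp.
Qed.

Lemma exp_closureZ a f : exp_closure f -> exp_closure (fun x => a * f x).
Proof.
move=> Kf; have := exp_closure_lin a Kf exp_closure0.
by congr exp_closure; apply/funext => x; rewrite addr0.
Qed.

Lemma exp_closureD f g : exp_closure f -> exp_closure g ->
  exp_closure (fun x => f x + g x).
Proof.
move=> Kf Kg; have := exp_closure_lin 1 Kf Kg.
by congr exp_closure; apply/funext => x; rewrite mul1r.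
Qed.

Lemma exp_closure_sum (I : Type) (r : seq I) (P : pred I) (f : I -> X -> R) :
  (forall i, P i -> exp_closure (f i)) ->
  exp_closure (fun x => \sum_(i <- r | P i) f i x).
Proof.
move=> Kf; elim: r => [|i r IH].
  by have := exp_closure0; congr exp_closure; apply/funext => x; rewrite big_nil.
have E x : \sum_(j <- i :: r | P j) f j x =
    if P i then f i x + \sum_(j <- r | P j) f j x else \sum_(j <- r | P j) f j x.
  by rewrite big_cons.
rewrite (funext E); case: (P i) (Kf i) => // /(_ isT) Kfi.
exact: exp_closureD.
Qed.

Let expL w : L2 mu := mkL2 (exp_ip_Lfun sip hip hmu w).

Let expLE c a b x : (c *: (expL a + expL b)) x = c * (expR (ip a x) + expR (ip b x)).
Proof. by []. Qed.

Lemma pow_le_exp n (y : R) : `|y| ^+ n <= n`!%:R * expR `|y|.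
Proof.
case: n => [|n]; first by rewrite expr0 fact0 mul1r -expR0 ler_expR.
have := expR_ge1Dxn n (normr_ge0 y) => H.
rewrite mulrC -ler_pdivrMr ?ltr0n ?fact_gt0//; apply: le_trans H.
by rewrite lerDr.
Qed.

Lemma abs_expR_sub1 (z : R) : `|expR z - 1| <= `|z| * expR `|z|.
Proof.
have h1 := expR_ge1Dx z; have := expR_tangent z 0; rewrite expR0 subr0 => h2.
have h3 : expR z <= expR `|z| by rewrite ler_expR ler_norm.
have h4 : 1 <= expR `|z| by rewrite -expR0 ler_expR.
have z0 := normr_ge0 z.
rewrite ler_norml; apply/andP; split.
  apply: (@le_trans _ _ (- `|z|)); last by have := ler_norm (- z); rewrite normrN; lra.
  by rewrite lerN2 ler_peMr.
apply: le_trans h2 _; apply: (@le_trans _ _ (`|z| * expR z)).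
  by rewrite ler_wpM2r ?expR_ge0// ler_norm.
by rewrite ler_wpM2l.
Qed.

Lemma expR_abs_le (z : R) : expR `|z| <= expR z + expR (- z).
Proof.
have [z0|z0] := leP 0 z; first by rewrite ger0_norm// lerDl expR_ge0.
by rewrite ltr0_norm// lerDr expR_ge0.
Qed.

Lemma cvg_expR_sub1 (y : R) : (fun m => m.+1%:R * (expR (m.+1%:R^-1 * y) - 1)) @ \oo --> y.
Proof.
have ex : (fun m => y * expR (m.+1%:R^-1 * y)) @ \oo --> y.
  rewrite -[X in _ --> X]mulr1; apply: cvgM; first exact: cvg_cst.
  have H0 : (fun m => m.+1%:R^-1 * y) @ \oo --> (0 * y : R).
    by apply: cvgM; [exact: cvg_harmonic|exact: cvg_cst].
  have := continuous_cvg _ (@continuous_expR R _) H0.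
  by rewrite mul0r expR0; apply.
apply: squeeze_cvgr ex; [|exact: (@cvg_cst R)].
apply: nearW => m; have m0 : (0 : R) < m.+1%:R by [].
have E : y = m.+1%:R * (m.+1%:R^-1 * y) by rewrite mulrA divff ?mul1r// gt_eqF.
set z := _^-1 * y in E *; rewrite {1 2}E; apply/andP; split.
  by rewrite ler_wpM2l//; have := expR_ge1Dx z; lra.
rewrite -mulrA ler_wpM2l//; have := expR_tangent z 0; rewrite expR0 subr0; lra.
Qed.

(** A difference quotient of exp(<w + s u, x>) at s = 0 raises the power of <u, x> by one. *)
Lemma exp_closure_monomial u n w : exp_closure (fun x => ip u x ^+ n * expR (ip w x)).
Proof.
elim: n w => [|n IH] w.
  by have := exp_closure_exp w; congr exp_closure; apply/funext => x; rewrite expr0 mul1r.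
(* With y = <u, x>, the quotients are bounded by |y|^(n+1) e^|y| e^<w, x>, and |y|^(n+1) <= (n+1)!
   e^|y|; the resulting e^(2|y|) is at most e^(2y) + e^(-2y). *)
apply: (@exp_closure_lim (n.+1`!%:R *: (expL (w + 2 *: u) + expL (w - 2 *: u)))
  (fun m x => m.+1%:R * (ip u x ^+ n * expR (ip (w + m.+1%:R^-1 *: u) x)) +
     (- m.+1%:R) * (ip u x ^+ n * expR (ip w x)))).
- move=> m; have := exp_closure_lin m.+1%:R (IH (w + m.+1%:R^-1 *: u)) (exp_closureZ (- m.+1%:R) (IH w)).
  by [].
- move=> m x; rewrite (sipDl sip) (sipZl sip) expRD.
  set y := ip u x; set e := expR (ip w x).
  have e0 : 0 < e by exact: expR_gt0.
  set z := _^-1 * y.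
  have -> : m.+1%:R * (y ^+ n * (e * expR z)) + - m.+1%:R * (y ^+ n * e) =
     m.+1%:R * (expR z - 1) * y ^+ n * e by ring.
  have -> : (n.+1`!%:R *: (expL (w + 2 *: u) + expL (w - 2 *: u))) x =
     n.+1`!%:R * (expR (2 * y) + expR (- (2 * y))) * e.
    by rewrite expLE (sipDl sip) (sipBl sip) !(sipZl sip) !expRD -/y -/e; ring.
  rewrite !normrM (gtr0_norm e0) ler_pM2r// normrX normr_nat.
  have m0 : (0 : R) < m.+1%:R by [].
  have zE : `|z| = m.+1%:R^-1 * `|y| by rewrite normrM ger0_norm.
  have zy : `|z| <= `|y| by rewrite zE ler_piMl// invf_le1// ler1n.
  apply: (@le_trans _ _ (`|y| * expR `|y| * `|y| ^+ n)).
    rewrite ler_wpM2r ?exprn_ge0//; apply: le_trans (ler_wpM2l (ltW m0) (abs_expR_sub1 z)) _.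
    rewrite mulrA {1}zE mulrA divff ?mul1r ?gt_eqF//.
    by rewrite ler_wpM2l// ler_expR.
  rewrite mulrAC -exprS; apply: le_trans (ler_wpM2r (expR_ge0 _) (pow_le_exp _ _)) _.
  rewrite -mulrA -expRD ler_wpM2l//; apply: le_trans (expR_abs_le _).
  by rewrite ler_expR normrM ger0_norm//; lra.
- move=> x; rewrite exprSr -mulrA.
  have E m : m.+1%:R * (ip u x ^+ n * expR (ip (w + m.+1%:R^-1 *: u) x)) +
     - m.+1%:R * (ip u x ^+ n * expR (ip w x)) =
     ip u x ^+ n * (m.+1%:R * (expR (m.+1%:R^-1 * ip u x) - 1) * expR (ip w x)).
    by rewrite (sipDl sip) (sipZl sip) expRD; ring.
  under eq_fun do rewrite E.
  apply: cvgM; first exact: cvg_cst.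
  by apply: cvgM; [exact: cvg_expR_sub1|exact: cvg_cst].
Qed.

Lemma exp_closure_series (a : nat -> R) (phi : R -> R) u w :
  (forall k, `|a k| <= k`!%:R^-1) ->
  (forall y, (fun n => \sum_(k < n) a k * y ^+ k) @ \oo --> phi y) ->
  exp_closure (fun x => phi (ip u x) * expR (ip w x)).
Proof.
move=> ale aphi.
apply: (@exp_closure_lim (1 *: (expL (w + u) + expL (w - u)))
  (fun n x => \sum_(k < n) a k * (ip u x ^+ k * expR (ip w x)))).
- move=> n; apply: exp_closure_sum => k _; apply: exp_closureZ.
  exact: exp_closure_monomial.
- move=> n x; under eq_bigr do rewrite mulrA.
  rewrite -mulr_suml normrM (ger0_norm (expR_ge0 _)).
  set y := ip u x.
  have -> : (1 *: (expL (w + u) + expL (w - u))) x = (expR y + expR (- y)) * expR (ip w x).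
    by rewrite expLE (sipDl sip) (sipBl sip) !expRD -/y; ring.
  rewrite ler_wpM2r ?expR_ge0//; apply: le_trans (expR_abs_le _).
  apply: (@le_trans _ _ (series (exp_coeff `|y|) n)).
    apply: le_trans (ler_norm_sum _ _ _) _; rewrite /series /= big_mkord.
    by apply: ler_sum => k _; rewrite normrM normrX mulrC ler_wpM2l// exprn_ge0.
  rewrite /expR; apply: nondecreasing_cvgn_le; last exact: is_cvg_series_exp_coeff.
  by apply: nondecreasing_series => k _ _; rewrite exp_coeff_ge0.
- by move=> x; under eq_fun do [under eq_bigr do rewrite mulrA; rewrite -mulr_suml]; apply: cvgM; [exact: aphi|exact: cvg_cst].
Qed.

(** Boundedness keeps limits dominated after multiplication. The multipliers form an algebra closed
    under bounded pointwise limits, so they run from cos and sin through signs and half-spaces to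
    all Borel indicators. *)
Definition exp_multiplier (g : X -> R) :=
  (exists M, forall x, `|g x| <= M) /\
  forall w, exp_closure (fun x => g x * expR (ip w x)).

Lemma multiplier_closure g f : exp_multiplier g -> exp_closure f ->
  exp_closure (fun x => g x * f x).
Proof.
move=> [[M gM] Kg]; elim=> [w|a f1 f2 _ K1 _ K2|F fn f0 _ Kfn fnF fncvg]; first exact: Kg.
- have := exp_closure_lin a K1 K2; congr exp_closure; apply/funext => x; ring.
- apply: (@exp_closure_lim (M *: F) (fun n x => g x * fn n x)) => // [n x|x].
    by rewrite normrM; apply: ler_pM => //; exact: gM.
  by apply: cvgM; [exact: cvg_cst|exact: fncvg].
Qed.

Lemma multiplier_cst c : exp_multiplier (fun=> c).
Proof.
split; first by exists `|c|.
by move=> w; apply: exp_closureZ; exact: exp_closure_exp.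
Qed.

Lemma multiplier_lin a f g : exp_multiplier f -> exp_multiplier g ->
  exp_multiplier (fun x => a * f x + g x).
Proof.
move=> [[M fM] Kf] [[N gN] Kg]; split.
  exists (`|a| * M + N) => x; apply: le_trans (ler_normD _ _) _.
  by rewrite normrM lerD// ler_wpM2l.
move=> w; have := exp_closure_lin a (Kf w) (Kg w).
by congr exp_closure; apply/funext => x; ring.
Qed.

Lemma multiplierM f g : exp_multiplier f -> exp_multiplier g ->
  exp_multiplier (fun x => f x * g x).
Proof.
move=> mf [[N gN] Kg]; have [[M fM] _] := mf; split.
  by exists (M * N) => x; rewrite normrM ler_pM.
move=> w; have := multiplier_closure mf (Kg w).
by congr exp_closure; apply/funext => x; ring.
Qed.

Lemma multiplier_lim (M : R) (gn : nat -> X -> R) (g : X -> R) : (forall n, exp_multiplier (gn n)) ->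
  (forall n x, `|gn n x| <= M) -> (forall x, (fun n => gn n x) @ \oo --> g x) ->
  exp_multiplier g.
Proof.
move=> mg gM gcvg; split.
  exists M => x; have L : (fun n => `|gn n x|) @ \oo --> `|g x| by apply: cvg_norm; exact: gcvg.
  rewrite -(cvg_lim (@Rhausdorff R) L); apply: limr_le; first by apply/cvg_ex; eexists; exact: L.
  exact: nearW.
move=> w; apply: (@exp_closure_lim (M *: expL w) (fun n x => gn n x * expR (ip w x))).
- by move=> n; have [_] := mg n; exact.
- move=> n x; rewrite normrM (ger0_norm (expR_ge0 _)).
  by rewrite -[leRHS]/(M * expR (ip w x)) ler_wpM2r// expR_ge0.
- by move=> x; apply: cvgM; [exact: gcvg|exact: cvg_cst].
Qed.

Lemma multiplier_cos u : exp_multiplier (fun x => cos (ip u x)).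
Proof.
split; first by exists 1 => x; rewrite ler_norml cos_geN1 cos_le1.
move=> w; apply: (exp_closure_series (a := fun k => (~~ odd k)%:R * (-1) ^+ k./2 / k`!%:R)).
  move=> k; rewrite !normrM normrX normrN1 expr1n mulr1 normfV normr_nat normr_nat.
  by rewrite ler_piMl ?invr_ge0// lern1; case: odd.
move=> y; have H : series (cos_coeff y) @ \oo --> cos y.
  by rewrite unlock; exact: is_cvg_series_cos_coeff.
rewrite (_ : (fun n => \sum_(k < n) (~~ odd k)%:R * (-1) ^+ k./2 / k`!%:R * y ^+ k) = series (cos_coeff y))//.
by apply/funext => n; rewrite cos_coeffE /series /= big_mkord.
Qed.

Lemma multiplier_sin u : exp_multiplier (fun x => sin (ip u x)).
Proof.
split; first by exists 1 => x; rewrite ler_norml sin_geN1 sin_le1.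
move=> w; apply: (exp_closure_series (a := fun k => (odd k)%:R * (-1) ^+ k.-1./2 / k`!%:R)).
  move=> k; rewrite !normrM normrX normrN1 expr1n mulr1 normfV normr_nat normr_nat.
  by rewrite ler_piMl ?invr_ge0// lern1; case: odd.
move=> y; have H : series (sin_coeff y) @ \oo --> sin y.
  by rewrite unlock; exact: is_cvg_series_sin_coeff.
rewrite (_ : (fun n => \sum_(k < n) (odd k)%:R * (-1) ^+ k.-1./2 / k`!%:R * y ^+ k) = series (sin_coeff y))//.
by apply/funext => n; rewrite sin_coeffE /series /= big_mkord.
Qed.

(* The iterates of (3t - t^3)/2 on [-1, 1] converge to the sign of t. *)
Let sign_step (t : R) := (3 * t - t ^+ 3) / 2.

Lemma sign_iter_pos (t : R) n : 0 < t <= 1 ->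
  [/\ t <= iter n sign_step t, iter n sign_step t <= 1 &
      1 - iter n sign_step t <= (1 - t / 2) ^+ n].
Proof.
move=> /andP[t0 t1]; elim: n => [|n [IH1 IH2 IH3]]; first by rewrite /= expr0; split=> //; lra.
rewrite iterS; set s := iter n sign_step t in IH1 IH2 IH3 *.
have s0 : 0 < s by exact: lt_le_trans IH1.
(* The last factor is 1 - s/2 - s^2/2, at most 1 - t/2 because s >= t; this gives the geometric
   rate. *)
have E : 1 - sign_step s = (1 - s) * ((1 - s) * (s + 2) / 2) by rewrite /sign_step; field.
split.
- apply: le_trans IH1 _; rewrite -subr_ge0.
  have -> : sign_step s - s = s * ((1 - s) * (1 + s)) / 2 by rewrite /sign_step; field.
  by rewrite divr_ge0// mulr_ge0 ?(ltW s0)// mulr_ge0//; lra.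
- rewrite -subr_ge0 E mulr_ge0 ?subr_ge0//.
  by rewrite divr_ge0// mulr_ge0//; lra.
- rewrite E exprSr; apply: ler_pM => //.
  + by rewrite subr_ge0.
  + by rewrite divr_ge0// mulr_ge0//; lra.
  + rewrite ler_pdivrMr//; nra.
Qed.

Lemma sign_iter_opp (t : R) n : iter n sign_step (- t) = - iter n sign_step t.
Proof.
by elim: n => //= n ->; rewrite /sign_step; by field.
Qed.

Lemma sign_iter0 n : iter n sign_step 0 = 0.
Proof. by elim: n => //= n ->; rewrite /sign_step expr0n/=; field. Qed.

Lemma sign_iter_pos_cvg (t : R) : 0 < t <= 1 -> (fun n => iter n sign_step t) @ \oo --> (1 : R).
Proof.
move=> t01; have /andP[t0 t1] := t01.
have L : (fun n => 1 - (1 - t / 2) ^+ n) @ \oo --> (1 : R).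
  rewrite -[X in _ --> X]subr0; apply: cvgB; first exact: cvg_cst.
  by apply: cvg_expr; rewrite ger0_norm; lra.
apply: squeeze_cvgr L (@cvg_cst R _ _ _ _); apply: nearW => n.
by have [_ h1 h2] := sign_iter_pos n t01; rewrite h1 andbT; lra.
Qed.

Lemma sign_iter_bound (t : R) n : `|t| <= 1 -> `|iter n sign_step t| <= 1.
Proof.
move=> t1; have [t0|t0|->] := ltgtP t 0; last by rewrite sign_iter0 normr0.
  have t01 : 0 < - t <= 1 by rewrite oppr_gt0 t0/= -(ltr0_norm t0).
  have [h1 h2 _] := sign_iter_pos n t01.
  by rewrite -(opprK t) sign_iter_opp normrN ger0_norm//; lra.
have t01 : 0 < t <= 1 by rewrite t0/= -(gtr0_norm t0).
by have [h1 h2 _] := sign_iter_pos n t01; rewrite ger0_norm//; lra.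
Qed.

Lemma sign_iter_cvg (t : R) : `|t| <= 1 -> (fun n => iter n sign_step t) @ \oo --> Num.sg t.
Proof.
move=> t1; have [t0|t0|->] := ltgtP t 0.
- rewrite ltr0_sg//; have t01 : 0 < - t <= 1 by rewrite oppr_gt0 t0/= -(ltr0_norm t0).
  under eq_fun do rewrite -{1}(opprK t) sign_iter_opp.
  by apply: cvgN; exact: sign_iter_pos_cvg.
- by rewrite gtr0_sg//; apply: sign_iter_pos_cvg; rewrite t0/= -(gtr0_norm t0).
- by rewrite sgr0; under eq_fun do rewrite sign_iter0; exact: cvg_cst.
Qed.

Lemma multiplier_sg g : (forall x, `|g x| <= 1) -> exp_multiplier g ->
  exp_multiplier (fun x => Num.sg (g x)).
Proof.
move=> g1 mg; apply: (@multiplier_lim 1 (fun n x => iter n sign_step (g x))).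
- elim=> //= n IH; have := multiplierM IH (multiplierM IH IH) => H.
  have := multiplier_lin (- 2^-1) H (multiplier_lin (3 / 2) IH (multiplier_cst 0)).
  by congr exp_multiplier; apply/funext => x; rewrite /sign_step; by field.
- by move=> n x; exact: sign_iter_bound.
- by move=> x; exact: sign_iter_cvg.
Qed.

Lemma multiplier_sin_shift u a : exp_multiplier (fun x => sin (ip u x - a)).
Proof.
have := multiplier_lin (cos a) (multiplier_sin u)
  (multiplier_lin (- sin a) (multiplier_cos u) (multiplier_cst 0)).
by congr exp_multiplier; apply/funext => x; rewrite sinB; ring.
Qed.

(* sg (y - a) is the limit of sg (sin ((y - a) / m)). *)
Lemma multiplier_halfspace_sg u a : exp_multiplier (fun x => Num.sg (ip u x - a)).
Proof.
apply: (@multiplier_lim 1 (fun n x => Num.sg (sin (n.+1%:R^-1 * (ip u x - a))))).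
- move=> n; apply: multiplier_sg; first by move=> x; rewrite ler_norml sin_geN1 sin_le1.
  have := multiplier_sin_shift (n.+1%:R^-1 *: u) (n.+1%:R^-1 * a).
  by congr exp_multiplier; apply/funext => x; rewrite (sipZl sip) mulrBr.
- by move=> n x; rewrite normr_sg; case: eqP.
- move=> x; set y := ip u x - a; apply: cvg_near_cst.
  have L : (fun n => n.+1%:R^-1 * `|y|) @ \oo --> (0 : R).
    by rewrite -(mul0r `|y|); apply: cvgM; [exact: cvg_harmonic|exact: cvg_cst].
  have [N _ HN] := cvgr_lt 0 L 2 (ltr0n R 2).
  have ypos z : 0 < z -> z < 2 -> Num.sg (sin z) = 1 :> R.
    by move=> z0 z2; rewrite gtr0_sg// sin2_gt0// z0.
  exists N => // n /= Nn; have := HN n Nn => /=.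
  have m0 : (0 : R) < n.+1%:R^-1 by rewrite invr_gt0.
  have [y0|y0|->] := ltgtP y 0.
  + rewrite ltr0_norm// (ltr0_sg y0) => H.
    by rewrite -(opprK (_ * y)) sinN sgrN -mulrN ypos// mulr_gt0// oppr_gt0.
  + by rewrite gtr0_norm// (gtr0_sg y0) => H; rewrite ypos// mulr_gt0.
  + by rewrite mulr0 sin0.
Qed.

Lemma multiplier_halfspace u a : exp_multiplier (\1_[set x | ip u x <= a] : X -> R).
Proof.
have := multiplier_halfspace_sg u a => H.
(* With s the sign of <u, x> - a, the indicator is 1 - s/2 - s^2/2, which is 1 for s = 0. *)
have := multiplier_lin (- 2^-1) (multiplierM H H) (multiplier_lin (- 2^-1) H (multiplier_cst 1)).
congr exp_multiplier; apply/funext => x; rewrite indicE.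
have [h|h|h] := ltgtP (ip u x) a.
- by rewrite mem_set//= ?ltW// ltr0_sg ?subr_lt0//; field.
- by rewrite memNset//= ?leNgt ?h// gtr0_sg ?subr_gt0//; field.
- by rewrite mem_set//= ?h// subrr sgr0; field.
Qed.

Lemma multiplier_indic (A : set X) : exp_multiplier (\1_A : X -> R) ->
  exp_multiplier (\1_(~` A) : X -> R).
Proof.
move=> mA; have := multiplier_lin (-1) mA (multiplier_cst 1).
congr exp_multiplier; apply/funext => x; rewrite !indicE in_setC.
by case: (x \in A) => /=; ring.
Qed.

Lemma multiplier_bigcap (A : nat -> set X) : (forall n, exp_multiplier (\1_(A n) : X -> R)) ->
  exp_multiplier (\1_(\bigcap_n A n) : X -> R).
Proof.
move=> mA; pose gn n (x : X) : R := \prod_(i < n) \1_(A i) x.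
apply: (@multiplier_lim 1 gn).
- elim=> [|n IH].
    have := multiplier_cst 1; congr exp_multiplier; apply/funext => x.
    by rewrite /gn big_ord0.
  have := multiplierM IH (mA n); congr exp_multiplier; apply/funext => x.
  by rewrite /gn big_ord_recr.
- move=> n x; rewrite /gn normr_prod; apply: prodr_ile1 => i _.
  by rewrite normr_ge0/= indicE normr_nat lern1; case: (_ \in _).
- move=> x; rewrite indicE; have [Ax|nAx] := pselect ((\bigcap_n A n) x).
    rewrite mem_set//; apply: cvg_near_cst; apply: nearW => n.
    by rewrite /gn big1// => i _; rewrite indicE mem_set//; exact: Ax.
  rewrite memNset//; have [k nk] : exists k, ~ A k x.
    by apply/existsNP => H; apply: nAx => i _; exact: H.
  apply: cvg_near_cst; exists k.+1 => // n /= kn; rewrite /gn.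
  by rewrite (bigD1 (Ordinal kn))//= indicE memNset// mul0r.
Qed.

Lemma multiplier_bigcup (A : nat -> set X) : (forall n, exp_multiplier (\1_(A n) : X -> R)) ->
  exp_multiplier (\1_(\bigcup_n A n) : X -> R).
Proof.
move=> mA; rewrite -(setCK (\bigcup_n A n)) setC_bigcup.
by apply: multiplier_indic; apply: multiplier_bigcap => n; exact: multiplier_indic.
Qed.

Variable v : nat -> X.
Hypothesis dv : dense (range v).

Lemma dense_norm_lt x (eps : R) : 0 < eps -> exists n, `|x - v n| < eps.
Proof.
move=> e0; have N : nbhs x [set w | `|x - w| < eps] by apply: cvgr_dist_lt.
move: N; rewrite nbhsE => -[Y [oY Yx] YP].
have [w [Yw [n _ vn]]] := dv (ex_intro _ x Yx) oY.
by exists n; rewrite vn; exact: YP.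
Qed.

(** Conversely, testing z = x - c with [v n] close to z gives |z|^2 <= r |z| up to an arbitrarily
    small error. *)
Lemma ball_halfspaces c (r : R) : 0 <= r ->
  [set x | `|x - c| <= r] = \bigcap_n [set x | ip (v n) x <= ip (v n) c + r * `|v n|].
Proof.
move=> r0; apply/seteqP; split => x /=.
  move=> Hx n _ /=; rewrite -lerBlDl -(sipBr sip); apply: le_trans (ler_norm _) _.
  by apply: le_trans (ip_norm_CS sip hip _ _) _; rewrite mulrC ler_wpM2r.
move=> Hx; set z := x - c.
have Hz n : ip (v n) z <= r * `|v n| by rewrite (sipBr sip) lerBlDl; exact: Hx.
have H (eps : R) : 0 < eps -> `|z| ^+ 2 <= r * `|z| + (r + `|z|) * eps.
  move=> e0; have [n Hn] := dense_norm_lt z e0.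
  rewrite -hip -{1}(subrK (v n) z) (sipDl sip).
  have h1 : ip (z - v n) z <= eps * `|z|.
    apply: le_trans (ler_norm _) _; apply: le_trans (ip_norm_CS sip hip _ _) _.
    by rewrite ler_wpM2r// ltW.
  have h2 : `|v n| <= `|z| + eps.
    have -> : v n = z - (z - v n) by rewrite opprB addrC subrK.
    by apply: le_trans (ler_normB _ _) _; rewrite lerD2l ltW.
  have h3 : r * `|v n| <= r * (`|z| + eps) by rewrite ler_wpM2l.
  have := Hz n; rewrite mulrDr in h3; rewrite mulrDl; lra.
have z0 := normr_ge0 z; rewrite leNgt; apply/negP => rz.
have d0 : 0 < `|z| * (`|z| - r) by rewrite mulr_gt0// ?subr_gt0//; exact: le_lt_trans rz.
have s0 : 0 < r + `|z| by apply: ltr_wpDl => //; exact: le_lt_trans rz.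
(* This [eps] makes the error half of the gap |z|^2 - r |z|. *)
have := H (`|z| * (`|z| - r) / (r + `|z|) / 2); rewrite divr_gt0 ?divr_gt0// => /(_ isT).
have -> : (r + `|z|) * (`|z| * (`|z| - r) / (r + `|z|) / 2) = `|z| * (`|z| - r) / 2.
  by field; rewrite gt_eqF.
move: d0; nra.
Qed.

Lemma multiplier_ball c (r : R) : 0 <= r -> exp_multiplier (\1_[set x | `|x - c| <= r] : X -> R).
Proof.
move=> r0; rewrite ball_halfspaces//; apply: multiplier_bigcap => n.
exact: multiplier_halfspace.
Qed.

Lemma multiplier_set0 : exp_multiplier (\1_set0 : X -> R).
Proof.
have := multiplier_cst 0; congr exp_multiplier; apply/funext => x.
by rewrite indicE memNset.
Qed.

Lemma multiplier_open (U : set X) : open U -> exp_multiplier (\1_U : X -> R).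
Proof.
move=> oU; pose B n k := [set x : X | `|x - v n| <= k.+1%:R^-1].
pose V n k := if `[< B n k `<=` U >] then B n k else set0.
have -> : U = \bigcup_n \bigcup_k V n k.
  apply/seteqP; split => x; last first.
    by move=> [n _ [k _]]; rewrite /V; case: asboolP => // BU /BU.
  move=> Ux; have : nbhs x U by exact: open_nbhs_nbhs.
  rewrite -nbhs_ballE => -[e /= e0 eU].
  have e20 : 0 < e / 2 by rewrite divr_gt0.
  have [k _ Hk] := cvgr_lt 0 (@cvg_harmonic R) _ e20.
  have k0 : (0 : R) < k.+1%:R^-1 by rewrite invr_gt0.
  have [n Hn] := dense_norm_lt x k0.
  exists n => //; exists k => //; rewrite /V asboolT; first by rewrite /B /= ltW.
  move=> y; rewrite /B /= => Hy; apply: eU; rewrite -ball_normE /=.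
  rewrite -(subrK (v n) x) -addrA; apply: le_lt_trans (ler_normD _ _) _.
  have := Hk k (leqnn k) => /= Hk'; rewrite (distrC (v n)).
  move: Hn Hy Hk'; set a := _^-1; lra.
apply: multiplier_bigcup => n; apply: multiplier_bigcup => k.
rewrite /V; case: asboolP => _; last exact: multiplier_set0.
by apply: multiplier_ball; rewrite invr_ge0.
Qed.

Lemma multiplier_borel (A : set (borel_type X)) : measurable A -> exp_multiplier (\1_A : X -> R).
Proof.
move=> mA; suff : (@measurable _ (borel_type X)) `<=` [set A | exp_multiplier (\1_A : X -> R)] by apply.
apply: smallest_sub => [|U oU]; last exact: multiplier_open.
split => [|B mB|B mB]; first exact: multiplier_set0.
- by rewrite /= setTD; exact: multiplier_indic.
- exact: multiplier_bigcup.
Qed.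

Lemma exp_closure_L2_ge0 (f : L2 mu) : (forall x, 0 <= f x) -> exp_closure f.
Proof.
move=> f0; have mf : measurable_fun setT (f : borel_type X -> R).
  by have [] := Lfun2P (LfunP f).
have mEf : measurable_fun setT (EFin \o (f : borel_type X -> R)) by exact/measurable_EFinP.
pose g n := nnsfun_approx measurableT mEf n.
have gcvg x : (fun n => g n x) @ \oo --> f x.
  have H0 t : setT t -> (0 <= (EFin \o (f : borel_type X -> R)) t)%E by rewrite lee_fin.
  have := @cvg_nnsfun_approx _ _ _ _ measurableT _ mEf H0 x I.
  by move/fine_cvgP => -[_].
have gnd x : nondecreasing_seq (fun n => g n x).
  by move=> m n mn; have /lefP := nd_nnsfun_approx measurableT mEf mn; exact.
apply: (@exp_closure_lim f (fun n => g n)) => // n => [|x].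
  have -> : (g n : X -> R) = fun x => \sum_(y \in range (g n)) y * \1_(g n @^-1` [set y]) x.
    by apply/funext => x; exact: fimfunE.
  have -> : (fun x => \sum_(y \in range (g n)) y * \1_(g n @^-1` [set y]) x) =
    (fun x => \sum_(y <- finmap.enum_fset (fset_set (range (g n)))) y * \1_(g n @^-1` [set y]) x).
    by apply/funext => x; rewrite fsbig_finite.
  apply: exp_closure_sum => y _; apply: exp_closureZ.
  (* At w = 0 the exponential is 1, so the indicator itself is in the closure. *)
  have /multiplier_borel[_ /(_ 0)] : measurable (g n @^-1` [set y]) by exact: measurable_sfunP.
  by congr exp_closure; apply/funext => x; rewrite (sip0l sip) expR0 mulr1.
by rewrite ger0_norm//; exact: (@cvg_qf_bound R (fun n => g n x) (f x) n (gnd x) (gcvg x)).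
Qed.

Lemma exp_closure_L2 (f : L2 mu) : exp_closure f.
Proof.
have [mf If] := Lfun2P (LfunP f).
have H (s : R) : s ^+ 2 = 1 -> ((fun x => Num.max (s * f x) 0) : borel_type X -> R) \in Lfun mu 2%:E.
  move=> s1; apply: mem_Lfun2; first by apply: measurable_maxr => //; exact: measurable_funM.
  apply: le_lt_trans If; apply: le_integral_ge0 => x; rewrite lee_fin ?sqr_ge0//.
  have -> : f x ^+ 2 = (s * f x) ^+ 2 by rewrite exprMn s1 mul1r.
  by case: (leP (s * f x) 0) => //; rewrite expr0n sqr_ge0.
have K s (s1 : s ^+ 2 = 1) := @exp_closure_L2_ge0 (mkL2 (H s s1)) (fun x => ltac:(by rewrite /= le_max lexx orbT)).
have := exp_closure_lin (- 1) (K (-1) ltac:(by rewrite sqrrN expr1n)) (K 1 (expr1n _ _)).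
congr exp_closure; apply/funext => x /=; rewrite !mulN1r mul1r.
by case: (ltgtP (f x) 0) => h; case: (ltgtP (- f x) 0) => h'; lra.
Qed.

End totality.

(** * An orthonormal basis of L^2 made of combinations of exponentials *)

Section isometric_image.
Context {R : realType} {V W : lmodType R} {ip : V -> V -> R} {ipW : W -> W -> R}.
Hypotheses (sip : semi_inner ip) (sipW : semi_inner ipW).
Variable J : V -> W.
Hypothesis JDZ : forall a x y, J (a *: x + y) = a *: J x + J y.
Hypothesis Jip : forall x y, ipW (J x) (J y) = ip x y.
Hypothesis Jdense : forall f (eps : R), 0 < eps -> exists x, ipW (f - J x) (f - J x) < eps.
Variables (D : set nat) (b : nat -> V).
Hypotheses (ob : ortho_fam (ip := ip) D b) (pb : parseval_fam (ip := ip) b).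

Let J0 : J 0 = 0.
Proof. by have := JDZ (-1) 0 0; rewrite scaler0 add0r scaleN1r addNr. Qed.

Let J_sum (c : nat -> R) n : J (\sum_(i < n) c i *: b i) = \sum_(i < n) c i *: J (b i).
Proof.
elim: n => [|n IH]; first by rewrite !big_ord0 J0.
by rewrite !big_ord_recr /= addrC JDZ IH addrC.
Qed.

Lemma isometry_ortho : ortho_fam (ip := ipW) D (J \o b).
Proof.
by split=> [j k|k nD] /=; [rewrite Jip; exact: ob.1|rewrite ob.2// J0].
Qed.

Lemma isometry_parseval : parseval_fam (ip := ipW) (J \o b).
Proof.
apply: (approx_parseval sipW isometry_ortho) => f eps eps0.
have e40 : 0 < eps / 4 by rewrite divr_gt0.
have [x Hx] := Jdense f e40.
have := parseval_proj sip ob x pb.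
move=> /cvgr0Pnorm_lt/(_ _ e40)[n _ /(_ n (leqnn n))] /=.
rewrite ger0_norm ?(sip_ge0 sip)// (sip_sqBC sip) => Hn.
exists n, (fun i => ip x (b i)); split=> [k nD|].
  by rewrite ob.2// (sip0r sip).
have -> : f - \sum_(i < n) ip x (b i) *: (J \o b) i = (f - J x) + J (x - fproj (ip := ip) b n x).
  have -> : J (x - fproj (ip := ip) b n x) = J x - J (fproj (ip := ip) b n x).
    by rewrite addrC -scaleN1r JDZ scaleN1r addrC.
  by rewrite addrA subrK (J_sum (fun i => ip x (b i))).
apply: le_lt_trans (sip_leD sipW _ _) _; rewrite Jip.
move: Hx Hn; set a1 := ipW _ _; set a2 := ip _ _; lra.
Qed.

End isometric_image.

Section L2_basis.
Context {R : realType} {X : completeNormedModType R} (ip : X -> X -> R).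
Hypotheses (sip : semi_inner ip) (hip : forall x, ip x x = `|x| ^+ 2).
Variables (mu : probability (borel_type X) R) (Q S : {linear X -> X}).
Hypotheses (hmu : gaussian ip mu Q) (hS : is_sqrt_op ip Q S).
Variables (D : set nat) (f : nat -> X) (l : nat -> R).
Hypothesis fQ : hilbert_basis_of ip (orthocomp ip (ker Q)) D f.
Hypothesis fl : forall k, D k -> Q (f k) = l k *: f k.
Variable v : nat -> X.
Hypothesis dv : dense (range v).

Let ipS := cm_ip ip S.
Let sipS : semi_inner ipS := cm_semi_inner sip hip hS fQ.
Let h n : cm_space S := cmQ S (v n).
Let Qc : continuous Q. Proof. by have [[]] := hmu. Qed.
Let hdense := cm_dense sip hip hS fQ Qc fl dv.
Let eps_ n : L2 mu := exp_L2 sip hip hmu (v n).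
Let sL := L2_semi_inner mu.

Definition exp_comb (p : {poly R}) : L2 mu := pcomb eps_ p.

Lemma exp_comb_ip p q :
  L2_ip mu (exp_comb p) (exp_comb q) = pker (expker (ip := ipS) h) p q.
Proof.
rewrite /exp_comb (pcomb_ip _ _ _ sL); congr pker; apply/funext => i; apply/funext => j.
by rewrite L2_ip_exp /expker /ipS (cm_ip_cmQ2 sip hip hS fQ).
Qed.

Lemma L2_ip_ext (g1 g2 : L2 mu) : g1 =1 g2 -> L2_ip mu g1 g1 = L2_ip mu g2 g2.
Proof. by move=> E; apply: eq_Rintegral => x _; rewrite E. Qed.

(** Members of the closure are bare functions, so the induction also produces the L^2 element [g'].
    Exponentials at arbitrary [w] are reached by density of the [h n], limits by dominated
    convergence. *)
Lemma exp_total_raw g : exp_closure ip mu g -> exists2 g' : L2 mu, g' =1 g &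
  forall eps : R, 0 < eps -> exists p, L2_ip mu (g' - exp_comb p) (g' - exp_comb p) < eps.
Proof.
elim=> {g} [w|a g1 g2 _ [g1' E1 H1] _ [g2' E2 H2]|F gn g _ IH gnF gcvg].
- exists (expR (ip (Q w) w / 2) *: exp_L2 sip hip hmu w).
    move=> x; rewrite -[LHS]/(expR _ * exp_fun ip Q w x) exp_funE mulrA -expRD.
    by rewrite subrr expR0 mul1r.
  move=> eps eps0; set c := expR _.
  have [s sw] := dense_seq sipS hdense (cmQ S w).
  have sc : (fun n => ipS (cmQ S w) (h (s n))) @ \oo --> ipS (cmQ S w) (cmQ S w).
    by under eq_fun do rewrite (sipC sipS); exact: (@sip_cvg _ _ _ sipS _ _ sw).
  have c2 : (fun n => expR (ipS (cmQ S w) (cmQ S w)) - 2 * expR (ipS (cmQ S w) (h (s n))) +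
      expR (ipS (h (s n)) (h (s n)))) @ \oo --> (0 : R).
    have -> : 0 = expR (ipS (cmQ S w) (cmQ S w)) - 2 * expR (ipS (cmQ S w) (cmQ S w)) +
      expR (ipS (cmQ S w) (cmQ S w)) by ring.
    apply: cvgD; [apply: cvgB; [exact: cvg_cst|apply: cvgM; first exact: cvg_cst]|].
      by apply: (continuous_cvg _ (@continuous_expR R _)).
    by apply: (continuous_cvg _ (@continuous_expR R _)); exact: (cvg_ip2 sipS sw sw).
  have e0 : 0 < eps / c ^+ 2 by rewrite divr_gt0// exprn_gt0// expR_gt0.
  have [n _ /(_ n (leqnn n))/= Hn] := cvgr_lt 0 c2 _ e0.
  exists (c *: 'X^(s n)); rewrite /exp_comb pcombZX -scalerBr (sip_sqZ sL) mulrC.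
  rewrite -ltr_pdivlMr ?exprn_gt0 ?expR_gt0//; apply: le_lt_trans Hn.
  rewrite (sip_sqB sL) !L2_ip_exp.
  by rewrite /ipS /h !(cm_ip_cmQ2 sip hip hS fQ).
- exists (a *: g1' + g2').
    by move=> x; rewrite -[LHS]/(a * g1' x + g2' x) E1 E2.
  move=> eps eps0.
  have a0 : 0 < a ^+ 2 + 1 by rewrite ltr_wpDl// sqr_ge0.
  have e1 : 0 < eps / 4 / (a ^+ 2 + 1) by rewrite divr_gt0// divr_gt0.
  have e2 : 0 < eps / 4 by rewrite divr_gt0.
  have [p1 P1] := H1 _ e1; have [p2 P2] := H2 _ e2.
  exists (a *: p1 + p2); rewrite /exp_comb pcombDZ -!/(exp_comb _).
  have -> : a *: g1' + g2' - (a *: exp_comb p1 + exp_comb p2) =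
    a *: (g1' - exp_comb p1) + (g2' - exp_comb p2) by rewrite scalerBr opprD addrACA.
  apply: le_lt_trans (sip_leD sL _ _) _; rewrite (sip_sqZ sL).
  have H : a ^+ 2 * L2_ip mu (g1' - exp_comb p1) (g1' - exp_comb p1) <= eps / 4.
    move: P1; rewrite ltr_pdivlMr// => /ltW; apply: le_trans; rewrite mulrC.
    by rewrite ler_wpM2l ?(sip_ge0 sL)// lerDl.
  move: H P2; set b1 := _ * _; set b2 := L2_ip _ _ _; lra.
- have H n : {g' : L2 mu | g' =1 gn n /\ forall eps : R, 0 < eps ->
      exists p, L2_ip mu (g' - exp_comb p) (g' - exp_comb p) < eps}.
    by apply/cid; have [g' ? ?] := IH n; exists g'.
  pose gn' n := projT1 (H n).
  have gE n : gn' n =1 gn n by have [] := projT2 (H n).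
  have gH n := proj2 (projT2 (H n)).
  have [mF IF] := Lfun2P (LfunP F).
  have mg : measurable_fun setT (g : borel_type X -> R).
    apply: (@measurable_fun_cvg _ (borel_type X) R setT gn) => [n|x _]; last exact: gcvg.
    by rewrite -(funext (gE n)); have [] := Lfun2P (LfunP (gn' n)).
  have gF x : `|g x| <= F x.
    have L : (fun n => `|gn n x|) @ \oo --> `|g x| by apply: cvg_norm; exact: gcvg.
    rewrite -(cvg_lim (@Rhausdorff R) L); apply: limr_le; first by apply/cvg_ex; eexists; exact: L.
    exact: nearW.
  have F0 x : 0 <= F x by exact: le_trans (gF x).
  have gL : (g : borel_type X -> R) \in Lfun mu 2%:E.
    apply: mem_Lfun2 => //; apply: le_lt_trans IF; apply: le_integral_ge0 => x; rewrite lee_fin ?sqr_ge0//.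
    by rewrite -(real_normK (num_real (g x))) ler_pXn2r// nnegrE.
  exists (mkL2 gL) => // eps eps0.
  have c0 : (fun n => (L2_ip mu (mkL2 gL - gn' n) (mkL2 gL - gn' n))%:E) @ \oo --> (0%E : \bar R).
    under eq_fun do rewrite L2_ip_sq.
    (* Both [g] and [gn n] are bounded by [F], so 4 F^2 dominates the squared differences. *)
    rewrite -(integral0 mu setT).
    apply: (@dominated_cvg _ _ _ _ _ measurableT _ _ (fun x => 4%:E * (F x ^+ 2)%:E)%E) => //.
    + move=> n; apply/measurable_EFinP; apply: measurable_funX.
      by have [] := Lfun2P (LfunP (mkL2 gL - gn' n)).
    + move=> x _; apply/fine_cvgP; split; first exact: nearW.
      rewrite (_ : fine \o _ = (fun n => (g x - gn n x) ^+ 2)); last first.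
        by apply/funext => n /=; rewrite -(gE n).
      rewrite -[X in _ --> X](expr0n _ 2) /= -(subrr (g x)).
      by apply: cvg_exprn; apply: cvgB; [exact: cvg_cst|exact: gcvg].
    + apply: integrableZl => //; apply/integrableP; split; first by apply/measurable_EFinP; exact: measurable_funX.
      by under eq_integral do rewrite /= ger0_norm ?sqr_ge0//.
    + move=> n x _; rewrite -EFinM /= lee_fin ger0_norm ?sqr_ge0//.
      rewrite -[leLHS]/((g x - gn' n x) ^+ 2) gE -real_normK ?num_real//.
      have -> : 4 * F x ^+ 2 = (F x + F x) ^+ 2 by ring.
      rewrite ler_pXn2r ?nnegrE// ?addr_ge0//.
      by apply: le_trans (ler_normB _ _) _; rewrite lerD.
  have e40 : 0 < eps / 4 by rewrite divr_gt0.
  have /fine_cvgP[_ /= c1] := c0.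
  have [n _ /(_ n (leqnn n))/= Hn] := cvgr_lt 0 c1 _ e40.
  have [p Hp] := gH n _ e40; exists p.
  have -> : mkL2 gL - exp_comb p = (mkL2 gL - gn' n) + (gn' n - exp_comb p).
    by rewrite addrA subrK.
  apply: le_lt_trans (sip_leD sL _ _) _.
  move: Hn Hp; rewrite -/(gn' n); set b1 := L2_ip _ _ _; set b2 := L2_ip _ _ _; lra.
Qed.

Lemma exp_total (g : L2 mu) (eps : R) : 0 < eps ->
  exists p, L2_ip mu (g - exp_comb p) (g - exp_comb p) < eps.
Proof.
move=> eps0; have [g' E /(_ _ eps0)[p Hp]] := exp_total_raw (exp_closure_L2 sip hip hmu dv g).
exists p; rewrite (L2_ip_ext (g2 := g' - exp_comb p))// => x.
by rewrite -[LHS]/(g x - exp_comb p x) -E.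
Qed.

(** Gram-Schmidt acts on formal combinations rather than on functions, so that the coefficients of
    the basis can also be inserted in the image kernel exp(<T h, T k>). *)
Definition exp_dom := gs_dom (ip := pker (expker (ip := ipS) h)) (fun n => 'X^n).
Definition exp_poly := gs (ip := pker (expker (ip := ipS) h)) (fun n => 'X^n).

Let oS : ortho_fam (ip := ipS) D (cm_basis S D f) := cm_basis_ortho sip hip hS fQ.
Let pS : parseval_fam (ip := ipS) (cm_basis S D f) := cm_basis_parseval sip hip hS fQ.
Let sipK := expker_semi_inner sipS oS pS h.

Lemma exp_poly_ortho : ortho_fam (ip := pker (expker (ip := ipS) h)) exp_dom exp_poly.
Proof. exact: (gs_ortho sipK). Qed.

Lemma exp_poly_parseval : parseval_fam (ip := pker (expker (ip := ipS) h)) exp_poly.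
Proof.
apply: (gs_parseval sipK) => p eps eps0; exists (size p), (fun i => p`_i).
by rewrite -poly_def coefK subrr (sip0l sipK).
Qed.

Lemma exp_basis_ortho : ortho_fam (ip := L2_ip mu) exp_dom (exp_comb \o exp_poly).
Proof.
apply: (isometry_ortho (ip := pker (expker (ip := ipS) h))) exp_poly_ortho.
- by move=> a p q; exact: pcombDZ.
- exact: exp_comb_ip.
Qed.

Lemma exp_basis_parseval : parseval_fam (ip := L2_ip mu) (exp_comb \o exp_poly).
Proof.
apply: (isometry_parseval sipK sL _ exp_comb_ip exp_total exp_poly_ortho exp_poly_parseval).
by move=> a p q; exact: pcombDZ.
Qed.

End L2_basis.

(** * The Hilbert-Schmidt norm of Gamma(T) *)

Section operator_norms.
Context {R : realType} {V W : lmodType R} {ip : V -> V -> R} {ipW : W -> W -> R}.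
Hypotheses (sip : semi_inner ip) (sipW : semi_inner ipW).

Section null_linear.
Variable G : V -> W.
Hypothesis Glin : null_linear (ipW := ipW) G.

Lemma null_linear_ip a x y z : ipW (G (a *: x + y)) z = a * ipW (G x) z + ipW (G y) z.
Proof.
rewrite -(sipDZ sipW); apply/eqP; rewrite -subr_eq0 -(sipBl sipW); apply/eqP.
exact: (sip_null sipW).
Qed.

Lemma null_linear0 z : ipW (G 0) z = 0.
Proof. by have := null_linear_ip (-1) 0 0 z; rewrite scaler0 addr0; lra. Qed.

Lemma null_linearZ a x z : ipW (G (a *: x)) z = a * ipW (G x) z.
Proof. by have := null_linear_ip a x 0 z; rewrite addr0 null_linear0 addr0. Qed.

Lemma null_linear_sqZ a x : ipW (G (a *: x)) (G (a *: x)) = a ^+ 2 * ipW (G x) (G x).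
Proof. by rewrite null_linearZ (sipC sipW) null_linearZ; ring. Qed.

Lemma null_linear_pcomb (v : nat -> V) p :
  ipW (G (pcomb v p)) (G (pcomb v p)) = pker (fun i j => ipW (G (v i)) (G (v j))) p p.
Proof.
have H (n : nat) (c : nat -> R) z : ipW (G (\sum_(i < n) c i *: v i)) z = \sum_(i < n) c i * ipW (G (v i)) z.
  elim: n => [|n IH]; first by rewrite !big_ord0 null_linear0.
  by rewrite !big_ord_recr /= addrC null_linear_ip IH addrC.
rewrite pkerE /pcomb (H _ (fun i => p`_i)); apply: eq_bigr => i _.
rewrite (sipC sipW) (H _ (fun i => p`_i)) mulr_sumr; apply: eq_bigr => j _.
by rewrite (sipC sipW (G (v j))); ring.
Qed.

Lemma opnorm_le (M : R) : (opnorm ip ipW G <= M%:E)%E ->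
  forall x, ipW (G x) (G x) <= M ^+ 2 * ip x x.
Proof.
move=> GM x.
have H y : ip y y <= 1 -> ipW (G y) (G y) <= M ^+ 2.
  move=> y1; have : ((ip_norm ipW (G y))%:E <= M%:E)%E.
    apply: le_trans GM; apply: ereal_sup_ubound; exists y => //=.
    by rewrite /ip_norm -sqrtr1 ler_sqrt.
  rewrite lee_fin -(ip_norm_sqr sipW) => h.
  have n0 : 0 <= ip_norm ipW (G y) by exact: sqrtr_ge0.
  by rewrite ler_pXn2r// nnegrE// (le_trans n0).
have := sip_ge0 sip x; rewrite le_eqVlt => /predU1P[x0|x0].
  (* All multiples of a null vector lie in the unit ball, so a nonzero image could be scaled beyond
     [M]. *)
  rewrite -x0 mulr0 leNgt; apply/negP => G0.
  pose c := Num.sqrt ((M ^+ 2 + 1) / ipW (G x) (G x)).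
  have c2 : c ^+ 2 * ipW (G x) (G x) = M ^+ 2 + 1.
    rewrite sqr_sqrtr ?divfK ?gt_eqF// divr_ge0 ?(ltW G0)//.
    by rewrite addr_ge0 ?sqr_ge0.
  have := H (c *: x); rewrite (sip_sqZ sip) -x0 mulr0 => /(_ ler01).
  by rewrite null_linear_sqZ c2; lra.
pose c := (Num.sqrt (ip x x))^-1.
have c2 : c ^+ 2 = (ip x x)^-1 by rewrite exprVn sqr_sqrtr// ltW.
have := H (c *: x); rewrite (sip_sqZ sip) null_linear_sqZ c2 mulVf ?gt_eqF// => /(_ (lexx _)).
by rewrite mulrC ler_pdivrMr.
Qed.

End null_linear.

Lemma le_opnorm (G : V -> W) (M : R) : 0 <= M ->
  (forall x, ipW (G x) (G x) <= M * ip x x) -> (opnorm ip ipW G <= (Num.sqrt M)%:E)%E.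
Proof.
move=> M0 H; apply: ge_ereal_sup => _ [x /= x1 <-]; rewrite lee_fin /ip_norm.
have x1' : ip x x <= 1.
  by rewrite -(ip_norm_sqr sip) expr_le1 ?sqrtr_ge0.
by rewrite ler_wsqrtr//; apply: le_trans (H x) _; rewrite ler_piMr.
Qed.

Lemma hs_norm_sqr (G : V -> W) D e : ipW (G 0) (G 0) = 0 ->
  (hs_norm ipW G D e ^+ 2 = \sum_(0 <= k <oo) (ipW (G (zext D e k)) (G (zext D e k)))%:E)%E.
Proof.
move=> G0; rewrite /hs_norm.
have -> : (\esum_(k in D) ((ip_norm ipW (G (e k))) ^+ 2)%:E =
   \sum_(0 <= k <oo) (ipW (G (zext D e k)) (G (zext D e k)))%:E)%E.
  rewrite -(esum_zext D e (f := fun x => ipW (G x) (G x)))//; last by move=> x; exact: (sip_ge0 sipW).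
  by apply: eq_esum => k _; rewrite (ip_norm_sqr sipW).
set s := (\sum_(0 <= k <oo) _)%E.
have : (0 <= s)%E by apply: nneseries_ge0 => k _ _; rewrite lee_fin (sip_ge0 sipW).
case: s => [r| |]//; last by rewrite poweRyr ?invr_eq0 ?pnatr_eq0// expe2 mulyy.
by rewrite lee_fin => r0; rewrite poweR_EFin powR12_sqrt// -EFin_expe sqr_sqrtr.
Qed.

Lemma hs_norm_lty (G : V -> W) D e : ipW (G 0) (G 0) = 0 ->
  ((hs_norm ipW G D e < +oo) =
   (\sum_(0 <= k <oo) (ipW (G (zext D e k)) (G (zext D e k)))%:E < +oo))%E.
Proof.
move=> G0; rewrite -(hs_norm_sqr _ _ G0).
have : (0 <= hs_norm ipW G D e)%E by exact: poweR_ge0.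
by case: (hs_norm _ _ _ _) => [r| |]//= _; rewrite ?expe2 ?mulyy// -EFinM !ltry.
Qed.

Section adjoint.
Variables (T : V -> W) (Ts : W -> V).
Hypothesis hTs : is_adjoint ip ipW T Ts.
Hypothesis Tc : forall x, ipW (T x) (T x) <= ip x x.

(** With z = Ts y: |z|^4 = <y, T z>^2 <= |y|^2 |T z|^2 <= |y|^2 |z|^2. *)
Lemma adjoint_contraction y : ip (Ts y) (Ts y) <= ipW y y.
Proof.
have := sip_ge0 sip (Ts y); rewrite le_eqVlt => /predU1P[<-|y0]; first exact: (sip_ge0 sipW).
rewrite -(ler_pM2r y0); have := sip_CS sipW y (T (Ts y)).
rewrite -hTs expr2 => /le_trans; apply.
by rewrite ler_wpM2l ?(sip_ge0 sipW).
Qed.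

Lemma hs_adjoint E U : parseval_fam (ip := ip) E -> parseval_fam (ip := ipW) U ->
  (\sum_(0 <= k <oo) (ipW (T (E k)) (T (E k)))%:E =
   \sum_(0 <= k <oo) (ip (Ts (U k)) (Ts (U k)))%:E)%E.
Proof.
move=> pE pU.
transitivity (\sum_(0 <= k <oo) \sum_(0 <= j <oo) (ipW (T (E k)) (U j) ^+ 2)%:E)%E.
  by apply: eq_eseriesr => k _; rewrite (parseval_ereal _ pU).
rewrite nneseries_interchange; last by move=> i j; rewrite lee_fin sqr_ge0.
apply: eq_eseriesr => j _; rewrite -(parseval_ereal _ pE).
by apply: eq_eseriesr => k _; rewrite hTs (sipC sipW).
Qed.

End adjoint.
End operator_norms.

(** * Products of geometric series *)

Section diagonal_products.
Context {R : realType}.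
Variable t : nat -> R.
Hypothesis t0 : forall k, 0 <= t k.

Lemma geom_prodE n : (forall k, (k < n)%N -> t k < 1) ->
  geom_prod t n = (\prod_(k < n) (1 / (1 - t k)))%:E.
Proof.
elim: n => [|n IH] t1 /=; first by rewrite big_ord0.
rewrite IH => [|k kn]; last by apply: t1; exact: ltn_trans kn _.
have tn := t1 n (ltnSn n).
rewrite big_ord_recr /= mulrC EFinM; congr (_ * _)%E.
apply/cvg_lim => //; have := cvg_geometric_series (a := 1 : R) (z := t n).
rewrite ger0_norm// => /(_ tn) H.
apply/fine_cvgP; split; first by apply: nearW => m; rewrite sumEFin.
apply: cvg_trans H; apply: near_eq_cvg; apply: nearW => m /=.
rewrite sumEFin /series /=; apply: eq_bigr => i _; by rewrite mul1r.
Qed.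

Lemma geom_prod_ge1 n : (1 <= geom_prod t n)%E.
Proof.
elim: n => //= n IH; rewrite -[leLHS]mul1e; apply: lee_pmul => //.
by apply: le_trans (nneseries_lim_ge 1 _); rewrite ?big_nat1// => k _ _; rewrite lee_fin exprn_ge0.
Qed.

Lemma geom_prod_le n : (geom_prod t n <= geom_prod t n.+1)%E.
Proof.
rewrite /= -[leLHS]mul1e; apply: lee_pmul => //.
  by apply: le_trans (geom_prod_ge1 n); rewrite lee01.
by apply: le_trans (nneseries_lim_ge 1 _); rewrite ?big_nat1// => k _ _; rewrite lee_fin exprn_ge0.
Qed.

Lemma geom_prod_pinfty n : 1 <= t n -> geom_prod t n.+1 = +oo%E.
Proof.
move=> t1 /=; suff -> : (\sum_(0 <= j <oo) (t n ^+ j)%:E = +oo)%E.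
  by rewrite gt0_mulye//; apply: lt_le_trans (geom_prod_ge1 n).
apply/eqyP => A A0; have [m Am] : exists m, A <= m%:R.
  by exists (Num.truncn A).+1; rewrite ltW// truncnS_gt.
apply: (@le_trans _ _ (m%:R)%:E); first by rewrite lee_fin.
apply: (@le_trans _ _ (\sum_(0 <= j < m) (t n ^+ j)%:E)%E).
  rewrite big_mkord sumEFin lee_fin -[leLHS](mulr_natl 1) mulr1.
  rewrite -[X in X%:R <= _](card_ord m) -sum1_card natr_sum.
  by apply: ler_sum => i _; exact: exprn_ege1.
by apply: nneseries_lim_ge => k _ _; rewrite lee_fin exprn_ge0.
Qed.

(** Each factor is 1 + t/(1 - t), at most exp(t / (1 - tau)). *)
Lemma geom_prod_le_exp (tau S : R) n : tau < 1 -> (forall k, t k <= tau) ->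
  (\sum_(k < n) t k <= S) -> (geom_prod t n <= (expR (S / (1 - tau)))%:E)%E.
Proof.
move=> tau1 ttau tS; rewrite geom_prodE => [|k _]; last exact: le_lt_trans (ttau k) _.
have d0 : 0 < 1 - tau by rewrite subr_gt0.
rewrite lee_fin; apply: (@le_trans _ _ (expR (\sum_(k < n) t k / (1 - tau)))); last first.
  by rewrite ler_expR -mulr_suml ler_pM2r ?invr_gt0.
rewrite expR_sum; apply: ler_prod => k _.
have tk := le_lt_trans (ttau k) tau1; have h := ttau k.
have dk : 0 < 1 - t k by rewrite subr_gt0.
rewrite divr_ge0//= ?(ltW dk)//.
have -> : 1 / (1 - t k) = 1 + t k / (1 - t k) by field; rewrite gt_eqF.
apply: le_trans (expR_ge1Dx _).
by rewrite lerD2l ler_wpM2l// lef_pV2// ?posrE// lerD2l lerN2.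
Qed.

(** All but finitely many terms are at most 1/2, and finitely many numbers below 1 have a maximum
    below 1. *)
Lemma summable_sup_lt1 (S : R) : (forall n, \sum_(k < n) t k <= S) -> (forall k, t k < 1) ->
  exists2 tau, 0 <= tau < 1 & forall k, t k <= tau.
Proof.
move=> tS t1; have [N HN] : exists N, forall k, (N <= k)%N -> t k <= 2^-1.
  have H : cvgn (series t).
    apply: nondecreasing_is_cvgn; first by apply: nondecreasing_series => k _ _.
    by exists S => _ [n _ <-]; rewrite /series /= big_mkord.
  have [N _ HN] := cvgr_le 0 (cvg_series_cvg_0 H) (2^-1) (ltac:(by rewrite invr_gt0)).
  by exists N => k; exact: HN.
have [tau /andP[h0 h1] Htau] : exists2 tau, 0 <= tau < 1 & forall k, (k < N)%N -> t k <= tau.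
  elim: {HN} N => [|N [tau /andP[h0 h1] Htau]]; first by exists 0; rewrite ?lexx ?ltr01.
  exists (Num.max tau (t N)); first by rewrite le_max h0/= gt_max h1 t1.
  move=> k; rewrite ltnS leq_eqVlt => /predU1P[->|kN]; first by rewrite le_max lexx orbT.
  by rewrite le_max Htau.
exists (Num.max tau 2^-1); first by rewrite le_max h0/= gt_max h1/= invf_lt1// ltr1n.
move=> k; have [kN|kN] := leqP N k; first by rewrite le_max HN// orbT.
by rewrite le_max Htau.
Qed.

End diagonal_products.

Lemma linear_null_linear {R : realType} {V W : lmodType R} (ipW : W -> W -> R)
  (sipW : semi_inner ipW) (T : {linear V -> W}) : null_linear (ipW := ipW) T.
Proof. by move=> a x y; rewrite linearP subrr (sip0l sipW). Qed.

Section second_quantization.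
Context {R : realType} {X : completeNormedModType R} (ip : X -> X -> R).
Hypotheses (sip : semi_inner ip) (hip : forall x, ip x x = `|x| ^+ 2).
Variables (mu nu : probability (borel_type X) R) (Qmu Qnu Smu Snu : {linear X -> X}).
Hypotheses (hmu : gaussian ip mu Qmu) (hnu : gaussian ip nu Qnu).
Hypotheses (hSmu : is_sqrt_op ip Qmu Smu) (hSnu : is_sqrt_op ip Qnu Snu).
Notation ipm := (cm_ip ip Smu).
Notation ipn := (cm_ip ip Snu).
Variables (T : {linear cm_space Smu -> cm_space Snu}) (Ts : {linear cm_space Snu -> cm_space Smu}).
Hypothesis hT : (opnorm ipm ipn T <= 1)%E.
Hypothesis hTs : is_adjoint ipm ipn T Ts.
Variable C : {linear cm_space Smu -> cm_space Smu}.
Hypothesis hC : is_sqrt_op ipm (fun h => h - Ts (T h)) C.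
Variables A B : X -> X.
Hypotheses (hA : is_measurable_extension ip nu Qnu Ts A)
  (hB : is_measurable_extension ip mu Qmu C B).
Variables (G : L2 mu -> L2 nu) (hG : is_Gamma A B G).
Variables (Dm Dn : set nat) (fm fn : nat -> X) (lm ln : nat -> R).
Hypotheses (fmQ : hilbert_basis_of ip (orthocomp ip (ker Qmu)) Dm fm)
  (fml : forall k, Dm k -> Qmu (fm k) = lm k *: fm k)
  (fnQ : hilbert_basis_of ip (orthocomp ip (ker Qnu)) Dn fn)
  (fnl : forall k, Dn k -> Qnu (fn k) = ln k *: fn k).
Variable v : nat -> X.
Hypothesis dv : dense (range v).

Let sm : semi_inner ipm := cm_semi_inner sip hip hSmu fmQ.
Let sn : semi_inner ipn := cm_semi_inner sip hip hSnu fnQ.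
Let Em := cm_basis Smu Dm fm.
Let En := cm_basis Snu Dn fn.
Let oEm : ortho_fam (ip := ipm) Dm Em := cm_basis_ortho sip hip hSmu fmQ.
Let pEm : parseval_fam (ip := ipm) Em := cm_basis_parseval sip hip hSmu fmQ.
Let oEn : ortho_fam (ip := ipn) Dn En := cm_basis_ortho sip hip hSnu fnQ.
Let pEn : parseval_fam (ip := ipn) En := cm_basis_parseval sip hip hSnu fnQ.
Let h n : cm_space Smu := cmQ Smu (v n).
Let Qc : continuous Qmu. Proof. by have [[]] := hmu. Qed.
Let hdense : forall x (eps : R), 0 < eps -> exists n, ipm (x - h n) (x - h n) < eps :=
  cm_dense sip hip hSmu fmQ Qc fml dv.
Let kap i j := ipn (T (h i)) (T (h j)).
Let Db := exp_dom ip Smu v.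
Let b := exp_poly ip Smu v.
Let ob := exp_poly_ortho sip hip hSmu fmQ v.
Let pb := @exp_poly_parseval _ _ _ sip hip _ _ hSmu _ _ fmQ v.
Let tr := (\sum_(0 <= k <oo) (pker (fun i j => expR (kap i j)) (b k) (b k))%:E)%E.

Lemma gamma_null_linear : null_linear (ipW := L2_ip nu) G.
Proof.
move=> a f g; have [Glin _ _] := hG; apply/EFin_inj; rewrite L2_ip_sq.
rewrite -[RHS](integral0 nu setT); apply: ae_eq_integral => //.
  apply/measurable_EFinP; apply: measurable_funX.
  by have [] := Lfun2P (LfunP (G (a *: f + g) - (a *: G f + G g))).
apply: filterS (Glin a f g) => x /= H _.
by rewrite -[X in (X ^+ 2)%:E]/(G (a *: f + g) x - (a * G f x + G g x)) H subrr expr0n.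
Qed.

Lemma gamma_bounded : exists N, forall f, L2_ip nu (G f) (G f) <= N * L2_ip mu f f.
Proof.
have [_ GN _] := hG.
have [M HM] : exists M : R, (opnorm (L2_ip mu) (L2_ip nu) G <= M%:E)%E.
  move: GN; case: (opnorm _ _ _) => [r| |]// _; first by exists r.
  by exists 0; rewrite leNye.
exists (M ^+ 2); exact: (opnorm_le (L2_semi_inner mu) (L2_semi_inner nu) gamma_null_linear HM).
Qed.

Let sL := L2_semi_inner nu.

Let G0 : L2_ip nu (G 0) (G 0) = 0.
Proof. exact: (null_linear0 sL gamma_null_linear). Qed.

(** By basis independence the norm is computed on the exponential basis of L^2(mu), where
    [gamma_gram] gives the image kernel. The basis of L^2(nu) supplies the coordinates in the
    target. *)
Lemma gamma_trace E g : hilbert_basis (L2_ip mu) E g -> (hs_norm (L2_ip nu) G E g ^+ 2 = tr)%E.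
Proof.
move=> /(hilbert_basis_parseval (L2_semi_inner mu))[og pg].
rewrite (hs_norm_sqr sL E g G0).
have [N HN] := gamma_bounded.
have oM := exp_basis_ortho sip hip hmu hSmu fmQ v.
have pM := exp_basis_parseval sip hip hmu hSmu fmQ fml dv.
have oN := exp_basis_ortho sip hip hnu hSnu fnQ v.
have pN := exp_basis_parseval sip hip hnu hSnu fnQ fnl dv.
rewrite (hs_basis_indep (L2_semi_inner mu) sL og pg oM pM oN pN gamma_null_linear HN).
apply: eq_eseriesr => k _; congr EFin.
rewrite /= /exp_comb (null_linear_pcomb sL gamma_null_linear); congr pker.
apply/funext => i; apply/funext => j.
exact: (gamma_gram sip hip hmu hnu hSmu hSnu hTs hC hA hB hG).
Qed.

(** For a finite trace the required Hilbert basis is the Gram-Schmidt family itself. *)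
Lemma gamma_hs : hilbert_schmidt (L2_ip mu) (L2_ip nu) G <-> (tr < +oo)%E.
Proof.
split=> [[E [g [Hg]]]|trlt].
  rewrite (hs_norm_lty sL E g G0) -(hs_norm_sqr sL E g G0).
  by rewrite gamma_trace.
have oM := exp_basis_ortho sip hip hmu hSmu fmQ v.
have pM := exp_basis_parseval sip hip hmu hSmu fmQ fml dv.
set g := (_ \o _) in oM pM.
have zg : zext Db g = g.
  by apply/funext => k; rewrite /zext; case: asboolP => // nD; rewrite oM.2.
have Hg : hilbert_basis (L2_ip mu) Db g.
  apply: (parseval_hilbert_basis (L2_semi_inner mu)); last by rewrite zg.
  by move=> j k _ Dk; rewrite oM.1 asboolT// andbT.
exists Db, g; split=> //; rewrite (hs_norm_lty sL _ _ G0) -(hs_norm_sqr sL _ _ G0).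
by rewrite gamma_trace.
Qed.

Lemma cm_contraction x : ipn (T x) (T x) <= ipm x x.
Proof.
by have := opnorm_le sm sn (linear_null_linear sn T) hT x; rewrite expr1n mul1r.
Qed.

Let T0 : ipn (T 0) (T 0) = 0. Proof. by rewrite linear0 (sip0l sn). Qed.

Lemma hs_sum D e : hilbert_basis ipm D e ->
  (\sum_(0 <= k <oo) (ipn (T (zext D e k)) (T (zext D e k)))%:E =
   \sum_(0 <= k <oo) (ipn (T (Em k)) (T (Em k)))%:E)%E.
Proof.
move=> /(hilbert_basis_parseval sm)[oe pe].
apply: (hs_basis_indep sm sn oe pe oEm pEm oEn pEn (linear_null_linear sn T) (N := 1)) => x.
by rewrite mul1r cm_contraction.
Qed.

Lemma cm_basis_hilbert : hilbert_basis ipm Dm Em.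
Proof.
apply: (parseval_hilbert_basis sm); first by move=> j k _ Dk; rewrite oEm.1 asboolT// andbT.
suff -> : zext Dm Em = Em by [].
by apply/funext => k; rewrite /zext; case: asboolP => // nD; rewrite oEm.2.
Qed.

Lemma cm_hs : hilbert_schmidt ipm ipn T <->
  (\sum_(0 <= k <oo) (ipn (T (Em k)) (T (Em k)))%:E < +oo)%E.
Proof.
split=> [[D [e [He]]]|H].
  by rewrite (hs_norm_lty sn D e T0) hs_sum.
exists Dm, Em; split; first exact: cm_basis_hilbert.
by rewrite (hs_norm_lty sn _ _ T0) hs_sum//; exact: cm_basis_hilbert.
Qed.

(** [Ts] is a contraction, so T^* T is Hilbert-Schmidt along with [T], and the spectral theorem
    applies. *)
Lemma hs_eigen_enumeration :
  (\sum_(0 <= k <oo) (ipn (T (Em k)) (T (Em k)))%:E < +oo)%E ->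
  exists D e t, eigen_enumeration ipm (fun x => Ts (T x)) D e t.
Proof.
move=> HS.
have s0 k : 0 <= ipn (T (Em k)) (T (Em k)) by exact: (sip_ge0 sn).
have [S HS'] : exists S : R, (\sum_(0 <= k <oo) (ipn (T (Em k)) (T (Em k)))%:E <= S%:E)%E.
  move: HS; case: (\sum_(0 <= k <oo) _)%E => [r| |]// _; first by exists r.
  by exists 0; rewrite leNye.
apply: (spectral_theorem sm (cm_complete sip hip hSmu fmQ) (cm_definite sip hip hSmu fmQ)
  (F := fun x => Ts (T x)) (E := Em) (S := S) (h := h)) => //.
- by move=> a x y; rewrite !linearP.
- by move=> x y; rewrite hTs (sipC sm) hTs (sipC sn).
- by move=> x; rewrite hTs (sip_ge0 sn).
- move=> n; apply: le_trans (ereal_nneg_sum_le s0 HS' n).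
  by apply: ler_sum => i _; exact: (adjoint_contraction sm sn hTs cm_contraction).
Qed.

Section eigenvalues.
Variables (D : set nat) (e : nat -> cm_space Smu) (t : nat -> R).
Hypothesis He : eigen_enumeration ipm (fun x => Ts (T x)) D e t.
Let E := zext D e.
Let s k := if `[< D k >] then t k else 0.

Let oE : ortho_fam (ip := ipm) D E. Proof. by have [/(hilbert_basis_parseval sm)[]] := He. Qed.
Let pE : parseval_fam (ip := ipm) E. Proof. by have [/(hilbert_basis_parseval sm)[]] := He. Qed.

Lemma eigenE k : Ts (T (E k)) = s k *: E k.
Proof.
rewrite /E /s /zext; case: asboolP => Dk; last by rewrite scale0r !linear0.
by have [_] := He; exact.
Qed.

Lemma eigen_sqnorm k : ipn (T (E k)) (T (E k)) = s k.
Proof.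
rewrite -hTs eigenE (sipZl sm) oE.1 eqxx/= /s.
by case: asboolP => Dk; rewrite ?mulr1// mul0r.
Qed.

Lemma eigen_ge0 k : 0 <= s k. Proof. by rewrite -eigen_sqnorm (sip_ge0 sn). Qed.

Lemma eigen_out k : ~ D k -> s k = 0. Proof. by move=> nD; rewrite /s asboolF. Qed.

Lemma eigen_form x y : (fun n => \sum_(k < n) s k * (ipm x (E k) * ipm y (E k))) @ \oo -->
  ipn (T x) (T y).
Proof.
rewrite -hTs; have L := @parseval_ip _ _ _ sm D _ oE (Ts (T x)) y pE.
suff -> : (fun n => \sum_(k < n) s k * (ipm x (E k) * ipm y (E k))) =
  (fun n => \sum_(k < n) ipm (Ts (T x)) (E k) * ipm y (E k)) by [].
apply/funext => n; apply: eq_bigr => k _; rewrite mulrA; congr (_ * _).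
by rewrite hTs -(sipC sn) -hTs eigenE (sipZl sm) (sipC sm).
Qed.

Let trace_ge_s n : (geom_prod s n <= tr)%E.
Proof. apply: (trace_ge sm oE pE hdense ob pb (t := s) (kap := kap) eigen_ge0 eigen_out) => i j; exact: eigen_form. Qed.

Let trace_le_s (M : R) : (forall n, (geom_prod s n <= M%:E)%E) -> (tr <= M%:E)%E.
Proof. apply: (trace_le sm oE pE hdense ob pb (t := s) (kap := kap) eigen_ge0 eigen_out) => i j; exact: eigen_form. Qed.

Lemma eigen_sum : (\sum_(0 <= k <oo) (s k)%:E = \sum_(0 <= k <oo) (ipn (T (Em k)) (T (Em k)))%:E)%E.
Proof.
by rewrite -(hs_sum (let: conj H _ := He in H)); apply: eq_eseriesr => k _; rewrite eigen_sqnorm.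
Qed.

Lemma trace_lty_eigen_lt1 : (tr < +oo)%E -> forall k, s k < 1.
Proof.
move=> trlt k; rewrite ltNge; apply/negP => sk.
by have := trace_ge_s k.+1; rewrite geom_prod_pinfty// ?leye_eq; [move=> /eqP E'; rewrite E' in trlt|exact: eigen_ge0].
Qed.

Lemma eigen_opnorm tau : 0 <= tau -> (forall k, s k <= tau) ->
  (opnorm ipm ipn T <= (Num.sqrt tau)%:E)%E.
Proof.
move=> tau0 stau; apply: (le_opnorm sm) => // x.
have L : (fun n => tau * \sum_(k < n) ipm x (E k) ^+ 2) @ \oo --> tau * ipm x x.
  by apply: cvgM; [exact: cvg_cst|exact: pE].
have L' := @eigen_form x x; apply: (ler_cvg_to L' L).
apply: nearW => n /=; rewrite mulr_sumr; apply: ler_sum => k _.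
by rewrite -expr2 ler_wpM2r// sqr_ge0.
Qed.

Lemma eigen_le (tau : R) : (opnorm ipm ipn T <= tau%:E)%E -> forall k, s k <= tau ^+ 2.
Proof.
move=> Ttau k; rewrite -eigen_sqnorm.
apply: le_trans (opnorm_le sm sn (linear_null_linear sn T) Ttau (E k)) _.
by rewrite oE.1 eqxx /=; case: asboolP => _; rewrite ?mulr1// mulr0 sqr_ge0.
Qed.

(** With tau the norm of [T], the eigenvalues are at most tau^2 < 1 and summable, which bounds all
    partial products at once. *)
Lemma trace_lty_of_hs : (opnorm ipm ipn T < 1)%E ->
  (\sum_(0 <= k <oo) (ipn (T (Em k)) (T (Em k)))%:E < +oo)%E -> (tr < +oo)%E.
Proof.
move=> T1; rewrite -eigen_sum => HS.
have [S HS'] : exists S : R, (\sum_(0 <= k <oo) (s k)%:E <= S%:E)%E.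
  move: HS; case: (\sum_(0 <= k <oo) _)%E => [r| |]// _; first by exists r.
  by exists 0; rewrite leNye.
have [tau [tau0 tau1 Ttau]] : exists tau : R, [/\ 0 <= tau, tau < 1 & (opnorm ipm ipn T <= tau%:E)%E].
  have : (0%:E <= opnorm ipm ipn T)%E.
    apply: ereal_sup_ubound; exists 0 => /=; first by rewrite /ip_norm (sip0l sm) sqrtr0.
    by rewrite /ip_norm T0 sqrtr0.
  move: T1; case: (opnorm _ _ _) => [r| |]//.
  by rewrite lte_fin lee_fin => r1 r0; exists r; split.
have t21 : tau ^+ 2 < 1 by rewrite expr_lt1.
apply: (@le_lt_trans _ _ (expR (S / (1 - tau ^+ 2)))%:E); last by rewrite ltry.
apply: trace_le_s => n.
apply: (geom_prod_le_exp eigen_ge0) => //; first exact: eigen_le.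
exact: (ereal_nneg_sum_le eigen_ge0 HS').
Qed.

(** A finite trace gives each eigenvalue below 1; summability is what yields a common bound below 1,
    hence a strict contraction. *)
Lemma opnorm_lt1_of_trace : (tr < +oo)%E ->
  (\sum_(0 <= k <oo) (ipn (T (Em k)) (T (Em k)))%:E < +oo)%E -> (opnorm ipm ipn T < 1)%E.
Proof.
move=> trlt; rewrite -eigen_sum => HS.
have [S HS'] : exists S : R, (\sum_(0 <= k <oo) (s k)%:E <= S%:E)%E.
  move: HS; case: (\sum_(0 <= k <oo) _)%E => [r| |]// _; first by exists r.
  by exists 0; rewrite leNye.
have [tau /andP[tau0 tau1] stau] := summable_sup_lt1 eigen_ge0
  (ereal_nneg_sum_le eigen_ge0 HS') (trace_lty_eigen_lt1 trlt).
apply: le_lt_trans (eigen_opnorm tau0 stau) _; rewrite lte_fin.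
by rewrite -sqrtr1 ltr_sqrt.
Qed.

Lemma cvg_eigen_prod : (tr < +oo)%E ->
  (\prod_(k < n | `[< D k >]) (1 / (1 - t k)))%:E @[n --> \oo] --> tr.
Proof.
move=> trlt; have s1 := trace_lty_eigen_lt1 trlt.
have -> : (fun n => (\prod_(k < n | `[< D k >]) (1 / (1 - t k)))%:E) = geom_prod s.
  apply/funext => n; rewrite geom_prodE//; last exact: eigen_ge0.
  rewrite big_mkcond; congr EFin; apply: eq_bigr => k _; rewrite /s.
  by case: ifP => //; rewrite subr0 divr1.
have nd : {homo geom_prod s : n m / (n <= m)%N >-> (n <= m)%E}.
  by apply/nondecreasing_seqP => n; apply: geom_prod_le; exact: eigen_ge0.
suff <- : ereal_sup (range (geom_prod s)) = tr by exact: ereal_nondecreasing_cvgn.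
apply/eqP; rewrite eq_le; apply/andP; split.
  by apply: ge_ereal_sup => _ [n _ <-]; exact: trace_ge_s.
have ub n : (geom_prod s n <= ereal_sup (range (geom_prod s)))%E.
  by apply: ereal_sup_ubound; exists n.
have := ub 0%N; move: ub; case: (ereal_sup _) => [M| |] ub // _; [exact: trace_le_s|exact: leey].
Qed.

End eigenvalues.

(** No eigenbasis is available here. The Hilbert-Schmidt sum of [T] is passed to [Ts] on the basis
    [En] of H_nu, and [trace_hs_ge] is applied to the vectors [Ts (En k)]. *)
Lemma trace_lty_hs : (tr < +oo)%E ->
  (\sum_(0 <= k <oo) (ipn (T (Em k)) (T (Em k)))%:E < +oo)%E.
Proof.
move=> trlt; rewrite (hs_adjoint sn hTs pEm pEn).
apply: le_lt_trans trlt.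
apply: (trace_hs_ge sm oEm pEm hdense ob pb) => i j.
have E x k : ipm x (Ts (En k)) = ipn (T x) (En k) by rewrite (sipC sm) hTs (sipC sn).
under eq_fun do under eq_bigr do rewrite !E.
exact: (@parseval_ip _ _ _ sn Dn _ oEn (T (h i)) (T (h j)) pEn).
Qed.

Lemma gamma_hs_iff : ((opnorm ipm ipn T < 1)%E /\ hilbert_schmidt ipm ipn T) <->
  hilbert_schmidt (L2_ip mu) (L2_ip nu) G.
Proof.
rewrite gamma_hs; split=> [[T1 /cm_hs HS]|trlt].
  by have [D [e [t He]]] := hs_eigen_enumeration HS; exact: (trace_lty_of_hs He).
have HS := trace_lty_hs trlt.
have [D [e [t He]]] := hs_eigen_enumeration HS.
by split; [exact: (opnorm_lt1_of_trace He)|apply/cm_hs].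
Qed.

Lemma gamma_hs_norm : hilbert_schmidt (L2_ip mu) (L2_ip nu) G ->
  (exists D e t, eigen_enumeration ipm (fun x => Ts (T x)) D e t) /\
  forall D e t, eigen_enumeration ipm (fun x => Ts (T x)) D e t ->
    forall E g, hilbert_basis (L2_ip mu) E g ->
      (\prod_(k < n | `[< D k >]) (1 / (1 - t k)))%:E @[n --> \oo] -->
        (hs_norm (L2_ip nu) G E g ^+ 2)%E.
Proof.
move=> /gamma_hs trlt; split; first exact: (hs_eigen_enumeration (trace_lty_hs trlt)).
by move=> D e t He E g Hg; rewrite (gamma_trace Hg); exact: (cvg_eigen_prod He).
Qed.

End second_quantization.

Lemma separable_sequence {R : realType} (X : completeNormedModType R) :
  separable X -> exists v : nat -> X, dense (range v).
Proof.
move=> [A [cA dA]]; have /pcard_surjP[g Ag] : (A #<= [set: nat])%card by [].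
exists g => U U0 oU; have [x [Ux Ax]] := dA U U0 oU.
by exists x; split=> //; exact: Ag.
Qed.

Theorem proposition4p20 (R : realType) (X : completeNormedModType R)
    (ip : {dot X for idfun}) (hip : forall x, ip x x = `|x| ^+ 2)
    (hsep : separable X)
    (mu nu : probability (borel_type X) R) (Qmu Qnu : {linear X -> X})
    (hmu : gaussian ip mu Qmu) (hnu : gaussian ip nu Qnu)
    (* Smu = Qmu^(1/2), Snu = Qnu^(1/2) *)
    (Smu Snu : {linear X -> X})
    (hSmu : is_sqrt_op ip Qmu Smu) (hSnu : is_sqrt_op ip Qnu Snu)
    (T : {linear cm_space Smu -> cm_space Snu})
    (hT : (opnorm (cm_ip ip Smu) (cm_ip ip Snu) T <= 1)%E)
    (* Ts = T^*, C = (I - T^* T)^(1/2) *)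
    (Ts : {linear cm_space Snu -> cm_space Smu})
    (hTs : is_adjoint (cm_ip ip Smu) (cm_ip ip Snu) T Ts)
    (C : {linear cm_space Smu -> cm_space Smu})
    (hC : is_sqrt_op (cm_ip ip Smu) (fun h => h - Ts (T h)) C)
    (* A and B are the measurable extensions of T^* and C *)
    (A B : X -> X)
    (hA : is_measurable_extension ip nu Qnu Ts A)
    (hB : is_measurable_extension ip mu Qmu C B)
    (G : L2 mu -> L2 nu) (hG : is_Gamma A B G) :
  ((opnorm (cm_ip ip Smu) (cm_ip ip Snu) T < 1)%E /\
     hilbert_schmidt (cm_ip ip Smu) (cm_ip ip Snu) T
   <-> hilbert_schmidt (L2_ip mu) (L2_ip nu) G) /\
  (hilbert_schmidt (L2_ip mu) (L2_ip nu) G ->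
   (exists D e t,
      eigen_enumeration (cm_ip ip Smu) (fun h => Ts (T h)) D e t) /\
   forall D e t,
     eigen_enumeration (cm_ip ip Smu) (fun h => Ts (T h)) D e t ->
     forall E g, hilbert_basis (L2_ip mu) E g ->
       (\prod_(k < n | `[< D k >]) (1 / (1 - t k)))%:E @[n --> \oo] -->
         (hs_norm (L2_ip nu) G E g ^+ 2)%E).
Proof.
have sip := dot_semi_inner ip.
have [v dv] := separable_sequence hsep.
(* The eigenbases of both covariances are taken from the definition of the measurable extensions. *)
have [_ [Dm [fm [lm [fmQ fml _]]]]] := hB.
have [_ [Dn [fn [ln [fnQ fnl _]]]]] := hA.
split.
  exact: (gamma_hs_iff sip hip hmu hnu hSmu hSnu hT hTs hC hA hB hG fmQ fml fnQ fnl dv).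
exact: (gamma_hs_norm sip hip hmu hnu hSmu hSnu hT hTs hC hA hB hG fmQ fml fnQ fnl dv).
Qed.
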